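(* Let $A\in\mathbb{R}^{K\times d}$, $y\in\mathbb{R}^K$, let $\Gamma\in\mathbb{R}^{K\times K}$, $\Gamma_0\in\mathbb{R}^{d\times d}$ be symmetric positive-definite, and let $\Phi_R(u)=\frac12\|Au-y\|_\Gamma^2+\frac12\|u\|_{\Gamma_0}^2$ and $\rho_\infty(u)=e^{-\Phi_R(u)}/\int_{\mathbb{R}^d}e^{-\Phi_R(v)}\,dv$. Let $\rho_0$ be a non-Gaussian initial condition for $$\partial_t\rho=\nabla\cdot\bigl(\rho\,\mathcal{C}(\rho)\nabla\Phi_R(u)\bigr)+\mathcal{C}(\rho):D^2\rho \qquad ( * )$$ satisfying $\mathrm{KL}(\rho_0\|\rho_\infty)<\infty$. Then any solution $\rho(t)$ of $( * )$ with initial condition $\rho_0$ converges exponentially fast to $\rho_\infty$ as $t\to\infty$, both in entropy and in $L^1(\mathbb{R}^d)$; that is, there exist constants $c,\kappa>0$ such that for all $t>0$ $$\mathrm{KL}(\rho(t)\|\rho_\infty)\le c\,e^{-\kappa t}\qquad\text{and}\qquad \|\rho(t)-\rho_\infty\|_{L^1(\mathbb{R}^d)}\le c\,e^{-\kappa t}.$$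
   Context: For symmetric positive-definite $M$, $\|a\|_M=\|M^{-1/2}a\|$ with the Euclidean norm on the right. $A_1:A_2$ denotes the Frobenius inner product of matrices, and $D^2\rho$ the Hessian of $\rho$ in $u$. For a probability density $\rho$ on $\mathbb{R}^d$ with finite second moment, $$m(\rho)=\int v\,\rho(v)\,dv,\qquad \mathcal{C}(\rho)=\int (v-m(\rho))\otimes(v-m(\rho))\,\rho(v)\,dv .$$ The relative entropy is $\mathrm{KL}(\rho\|\rho_\infty)=\int\rho\ln(\rho/\rho_\infty)\,du$. A solution of $( * )$ is a curve $t\mapsto\rho(t)$ of probability densities with finite second moment satisfying $( * )$ with $\rho(0)=\rho_0$; it is understood to be sufficiently regular and decaying at infinity that integrations by parts are justified. *)

(* Defs.v *)
From HB Require Import structures.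
From mathcomp Require Import all_boot all_order all_algebra.
From mathcomp Require Import all_classical all_reals all_analysis.

Set Implicit Arguments.
Unset Strict Implicit.
Unset Printing Implicit Defensive.

Import Order.TTheory GRing.Theory Num.Theory.
Import numFieldNormedType.Exports.

Local Open Scope classical_set_scope.
Local Open Scope ring_scope.

Section measurable_cV.
Context {d} {T : sigmaRingType d}.
Variable n : nat.

Let coord : 'I_n -> 'cV[T]_n -> T := fun i v => v i ord0.

Let cV_set0 : g_sigma_preimage coord set0.
Proof. exact: sigma_algebra0. Qed.

Let cV_setC A : g_sigma_preimage coord A -> g_sigma_preimage coord (~` A).
Proof. exact: sigma_algebraC. Qed.

Let cV_bigcup (F : (set 'cV[T]_n)^nat) :
  (forall i, g_sigma_preimage coord (F i)) ->
  g_sigma_preimage coord (\bigcup_i (F i)).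
Proof. exact: sigma_algebra_bigcup. Qed.

(* The product sigma-algebra, generated by the coordinates (for [T] the reals,
   the Borel sigma-algebra of [R^n]); same construction as for [n.-tuple T]. *)
HB.instance Definition _ := @isMeasurable.Build (measure_tuple_display d)
  'cV[T]_n (g_sigma_preimage coord) cV_set0 cV_setC cV_bigcup.

End measurable_cV.

Section lebesgue_cV.
Context {R : realType}.

Lemma measurable_coord n (i : 'I_n) :
  measurable_fun [set: 'cV[R]_n] (fun v : 'cV[R]_n => v i ord0).
Proof.
move=> _ Y mY; rewrite setTI; apply: sub_sigma_algebra => /=.
rewrite -bigcup_seq/=; exists i => /=; first by rewrite mem_index_enum.
by exists Y => //; rewrite setTI.
Qed.

Lemma measurable_fun_cVP d (T : measurableType d) n (f : T -> 'cV[R]_n) :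
  (forall i, measurable_fun [set: T] (fun x => f x i ord0)) ->
  measurable_fun [set: T] f.
Proof.
move=> mf; suff pf : preimage_set_system setT f measurable `<=` measurable.
  by move=> _ A mA; apply: pf; exists A.
have -> : preimage_set_system setT f measurable =
    g_sigma_preimage (fun i : 'I_n => (fun v : 'cV[R]_n => v i ord0) \o f).
  by rewrite g_sigma_preimage_comp.
apply: smallest_sub; first exact: sigma_algebra_measurable.
rewrite -bigcup_seq/=; apply: bigcup_sub => i _ A [B mB <-].
exact: mf.
Qed.

(* [measurableTypeR R] rather than [R]: the type on which [lebesgue_measure] is
   defined. Unification of the two measurable structures may diverge. *)
Definition cons_cV n (p : measurableTypeR R * 'cV[R]_n) : 'cV[R]_n.+1 :=
  col_mx (p.1 : R)%:M p.2.

Definition uncons_cV n (v : 'cV[R]_n.+1) :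
    measurableTypeR R * 'cV[R]_n :=
  (usubmx (v : 'cV[R]_(1 + n)) ord0 ord0, dsubmx (v : 'cV[R]_(1 + n))).

Lemma cons_cVK n : cancel (@cons_cV n) (@uncons_cV n).
Proof.
move=> [x v]; rewrite /uncons_cV /cons_cV col_mxKu col_mxKd /=.
by rewrite mxE eqxx mulr1n.
Qed.

Lemma uncons_cVK n : cancel (@uncons_cV n) (@cons_cV n).
Proof.
move=> v; rewrite /cons_cV /uncons_cV /= -mx11_scalar.
exact: (@vsubmxK _ 1 n 1 v).
Qed.

Lemma cons_cV0 n (p : measurableTypeR R * 'cV[R]_n) : cons_cV p ord0 ord0 = p.1.
Proof.
rewrite (_ : ord0 = @lshift 1 n ord0); last exact: val_inj.
by apply: (etrans (@col_mxEu _ 1 n 1 _ _ _ _)); rewrite mxE eqxx mulr1n.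
Qed.

Lemma cons_cVS n (p : measurableTypeR R * 'cV[R]_n) i :
  cons_cV p (lift ord0 i) ord0 = p.2 i ord0.
Proof.
rewrite (_ : lift ord0 i = @rshift 1 n i); last exact: val_inj.
exact: (etrans (@col_mxEd _ 1 n 1 _ _ _ _)).
Qed.

Lemma measurable_cons_cV n : measurable_fun setT (@cons_cV n).
Proof.
apply: measurable_fun_cVP => i; have [j ->|->] := unliftP ord0 i.
  under eq_fun do rewrite cons_cVS.
  exact: (measurableT_comp (measurable_coord j) measurable_snd).
by under eq_fun do rewrite cons_cV0; exact: measurable_fst.
Qed.

Lemma measurable_uncons_cV n : measurable_fun setT (@uncons_cV n).
Proof.
apply: measurable_fun_pair.
  rewrite (_ : (fun _ => _) = fun v : 'cV[R]_n.+1 => v (@lshift 1 n ord0) ord0).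
    exact: measurable_coord.
  by apply/funext => v; rewrite mxE.
apply: measurable_fun_cVP => i.
rewrite (_ : (fun _ => _) = fun v : 'cV[R]_n.+1 => v (rshift 1 i) ord0).
  exact: measurable_coord.
by apply/funext => v; rewrite mxE.
Qed.

Section lebesgue_cV_step.
Variables (n : nat) (mu : {sigma_finite_measure set 'cV[R]_n -> \bar R}).

Definition lebesgue_cV_step : set 'cV[R]_n.+1 -> \bar R :=
  pushforward (@lebesgue_measure R \x mu)%E (@cons_cV n).

Let mcons := @measurable_cons_cV n.

Let step0 : lebesgue_cV_step set0 = 0%E. Proof. exact: measure0. Qed.

Let step_ge0 A : (0 <= lebesgue_cV_step A)%E.
Proof. by apply: measure_ge0; exact: mcons. Qed.

Let step_sigma_additive : semi_sigma_additive lebesgue_cV_step.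
Proof. by apply: measure_semi_sigma_additive; exact: mcons. Qed.

HB.instance Definition _ :=
  isMeasure.Build _ _ _ lebesgue_cV_step step0 step_ge0 step_sigma_additive.

Let step_sigma_finite : sigma_finite setT lebesgue_cV_step.
Proof.
have /sigma_finiteP[F [FT ndF Foo]] := sigma_finiteT (@lebesgue_measure R).
have /sigma_finiteP[G [GT ndG Goo]] := sigma_finiteT mu.
exists (fun k => @uncons_cV n @^-1` (F k `*` G k)).
  apply/seteqP; split=> // v _; rewrite -preimage_bigcup /=.
  have : (\bigcup_i F i) (uncons_cV v).1 by rewrite -FT.
  have : (\bigcup_i G i) (uncons_cV v).2 by rewrite -GT.
  move=> [j _ Gj] [i _ Fi]; exists (maxn i j) => //; split.
    by move: Fi; exact/subsetPset/ndF/leq_maxl.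
  by move: Gj; exact/subsetPset/ndG/leq_maxr.
move=> k; have [mF Fk] := Foo k; have [mG Gk] := Goo k; split.
  by rewrite -[X in measurable X]setTI; apply: measurable_uncons_cV => //;
    exact: measurableX.
rewrite /lebesgue_cV_step /pushforward -comp_preimage.
rewrite (_ : _ \o _ = id) ?preimage_id; last exact/funext/cons_cVK.
by rewrite product_measure1E// lte_mul_pinfty// ge0_fin_numE.
Qed.

HB.instance Definition _ :=
  Measure_isSigmaFinite.Build _ _ _ lebesgue_cV_step step_sigma_finite.

End lebesgue_cV_step.

(* Lebesgue measure on [R^n]: iterated product of the one-dimensional one, carried
   to column vectors along [cons_cV]; cf. [lebesgue_cV_box]. *)
Fixpoint lebesgue_cV n : {sigma_finite_measure set 'cV[R]_n -> \bar R} :=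
  match n with
  | 0%N => \d_(0 : 'cV[R]_0)
  | m.+1 => lebesgue_cV_step (lebesgue_cV m)
  end.

Lemma lebesgue_cV_box n (A : 'I_n -> set R) : (forall i, measurable (A i)) ->
  lebesgue_cV n [set v | forall i, A i (v i ord0)] =
  (\prod_(i < n) lebesgue_measure (A i))%E.
Proof.
elim: n A => [|n ih] A mA.
  by rewrite big_ord0 /= diracE mem_set// => -[].
rewrite big_ord_recl -ih//=.
have mB : measurable [set v : 'cV[R]_n | forall i, A (lift ord0 i) (v i ord0)].
  rewrite [X in measurable X](_ : _ = \bigcap_(i in [set: 'I_n])
      (fun v : 'cV[R]_n => v i ord0) @^-1` A (lift ord0 i)).
    apply: fin_bigcap_measurable => // i _.
    by rewrite -[X in measurable X]setTI; exact: measurable_coord.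
  by apply/seteqP; split => v /= h i; [move=> _; exact: h|exact: h i I].
rewrite /lebesgue_cV_step /pushforward -product_measure1E//; last exact: mA.
congr (_ _); apply/seteqP; split => -[x v] /=.
  move=> h; split => [|i]; first by have := h ord0; rewrite cons_cV0.
  by have := h (lift ord0 i); rewrite cons_cVS.
by move=> [hx hv] i; have [j ->|->] := unliftP ord0 i;
  rewrite ?cons_cVS ?cons_cV0.
Qed.

End lebesgue_cV.

Section linear_algebra.
Context {R : realType}.

(* Euclidean; the canonical norm of ['cV[R]_n] is the sup norm. *)
Definition enorm n (x : 'cV[R]_n) : R := Num.sqrt (\sum_i x i ord0 ^+ 2).

Definition spd n (M : 'M[R]_n) : Prop :=
  M^T = M /\ forall x : 'cV[R]_n, x != 0 -> 0 < (x^T *m M *m x) ord0 ord0.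

(* The symmetric positive-definite square root, which exists and is unique for
   [M] symmetric positive-definite; a junk value for other [M]. *)
Definition spd_sqrt n (M : 'M[R]_n) : 'M[R]_n :=
  xget 0 [set S | spd S /\ S *m S = M].

Definition wnorm n (M : 'M[R]_n) (a : 'cV[R]_n) : R :=
  enorm (invmx (spd_sqrt M) *m a).

Definition frobenius n (A B : 'M[R]_n) : R := \sum_i \sum_j A i j * B i j.

End linear_algebra.

Section differential_operators.
Context {R : realType} {n : nat}.
Implicit Types (f : 'cV[R]_n -> R) (u : 'cV[R]_n).

Definition basis_vec (i : 'I_n) : 'cV[R]_n := delta_mx i ord0.

Definition partial (i : 'I_n) f u : R := 'D_(basis_vec i) f u.

Definition gradient f u : 'cV[R]_n := \col_i partial i f u.

Definition divergence (F : 'cV[R]_n -> 'cV[R]_n) u : R :=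
  \sum_i partial i (fun v => F v i ord0) u.

Definition hessian f u : 'M[R]_n :=
  \matrix_(i, j) partial i (partial j f) u.

End differential_operators.

Section densities.
Context {R : realType} {n : nat}.
Implicit Types (f g : 'cV[R]_n -> R).

Local Notation leb := (lebesgue_cV n).

Definition prob_density f : Prop :=
  [/\ measurable_fun setT f, forall u, 0 <= f u &
      (\int[leb]_u (f u)%:E = 1)%E].

Definition second_moment f : \bar R :=
  (\int[leb]_u (enorm u ^+ 2 * f u)%:E)%E.

Definition mean f : 'cV[R]_n := \col_i \int[leb]_u (u i ord0 * f u).

Definition covariance f : 'M[R]_n := \matrix_(i, j)
  \int[leb]_u ((u - mean f) i ord0 * (u - mean f) j ord0 * f u).

(* Convention [0 ln 0 = 0]. For densities [f] and [g > 0] the negative part of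
   the integrand is bounded by [g], so the integral is meaningful in [\bar R]. *)
Definition KL f g : \bar R := (\int[leb]_u (f u * ln (f u / g u))%:E)%E.

Definition L1_dist f g : \bar R := ('N[leb]_1[EFin \o (f \- g)%R])%E.

Definition gaussian_pdf (m : 'cV[R]_n) (S : 'M[R]_n) (u : 'cV[R]_n) : R :=
  expR (- (2^-1 * wnorm S (u - m) ^+ 2)) / Num.sqrt ((2 * pi) ^+ n * \det S).

Definition gaussian f : Prop :=
  exists m S, spd S /\ {ae leb, forall u, f u = gaussian_pdf m S u}.

End densities.

Section fokker_planck.
Context {R : realType} {n : nat}.
Implicit Types (Phi : 'cV[R]_n -> R) (rho : R -> 'cV[R]_n -> R).

Local Notation leb := (lebesgue_cV n).

Definition gibbs Phi (u : 'cV[R]_n) : R :=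
  expR (- Phi u) / \int[leb]_v expR (- Phi v).

Definition time_derivative rho (t : R) (u : 'cV[R]_n) : R :=
  derive1 (fun s => rho s u) t.

Definition fp_equation_at Phi rho (t : R) (u : 'cV[R]_n) : Prop :=
  time_derivative rho t u =
    divergence (fun v => rho t v *: (covariance (rho t) *m gradient Phi v)) u
    + frobenius (covariance (rho t)) (hessian (rho t) u).

(* [C^{1,2}] on [(0, +oo) x R^n]; nothing is asked of [rho 0]. *)
Definition classical_regularity rho : Prop :=
  forall (t : R) (u : 'cV[R]_n), 0 < t ->
  [/\ {for (t, u), continuous (fun p : R * 'cV[R]_n => rho p.1 p.2)},
      derivable (fun s => rho s u) t 1 /\
      {for (t, u), continuous
        (fun p : R * 'cV[R]_n => time_derivative rho p.1 p.2)},
      forall i, derivable (rho t) u (basis_vec i) /\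
      {for (t, u), continuous
        (fun p : R * 'cV[R]_n => partial i (rho p.1) p.2)} &
      forall i j, derivable (partial j (rho t)) u (basis_vec i) /\
      {for (t, u), continuous
        (fun p : R * 'cV[R]_n => partial i (partial j (rho p.1)) p.2)}].

(* With second moments locally bounded in time, the flux
   [J = rho C(rho) grad Phi + C(rho) grad rho] of the equation, for quadratic
   [Phi], is such that [(1 + |u|) J] is integrable on [(0, T) x R^n]. Hence the
   boundary terms at infinity vanish when [d_t rho = div J] is integrated against
   functions of [(t, u)] that are bounded, or quadratic in [u]. *)
Definition decay_at_infinity rho : Prop :=
  forall T : R, 0 < T ->
  (exists M : R, forall t : R, 0 <= t <= T -> (second_moment (rho t) <= M%:E)%E) /\
  (\int[lebesgue_measure]_(t in `]0%R, T[%classic) \int[leb]_u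
     ((1 + enorm u) * enorm (gradient (rho t) u))%:E < +oo)%E.

Record fp_solution Phi (rho0 : 'cV[R]_n -> R) rho : Prop := FpSolution {
  fp_init : rho 0 = rho0;
  fp_density : forall t : R, 0 <= t -> prob_density (rho t);
  fp_moment : forall t : R, 0 <= t -> (second_moment (rho t) < +oo)%E;
  fp_regular : classical_regularity rho;
  (* ties the equation, posed for [t > 0] only, to the initial datum *)
  fp_trace : (L1_dist (rho t) rho0 @[t --> 0^'+] --> 0)%E;
  fp_decay : decay_at_infinity rho;
  fp_eq : forall (t : R) u, 0 < t -> fp_equation_at Phi rho t u
}.

Definition regularized_misfit K (A : 'M[R]_(K, n)) (y : 'cV[R]_K)
    (Gam : 'M[R]_K) (Gam0 : 'M[R]_n) (u : 'cV[R]_n) : R :=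
  2^-1 * wnorm Gam (A *m u - y) ^+ 2 + 2^-1 * wnorm Gam0 u ^+ 2.

End fokker_planck.

(* Main.v *)
Require Import Defs.
From mathcomp Require Import all_boot all_order all_algebra.
From mathcomp Require Import complex.
From mathcomp Require Import all_classical all_reals all_analysis measurable_realfun.
From mathcomp Require Import ring lra.

Set Implicit Arguments.
Unset Strict Implicit.
Unset Printing Implicit Defensive.

Import Order.TTheory GRing.Theory Num.Theory.
Import numFieldNormedType.Exports.

Local Open Scope classical_set_scope.
Local Open Scope ring_scope.

(** The equation is nonlinear only through the covariance of the solution, and
    that covariance can be computed: the proof solves for it, recognizes the
    solution as the image of the initial datum under an explicit Gaussian kernel,
    and estimates this kernel.

    The potential is quadratic and strictly convex, so that it is half a sum of
    squares [w_a(u) ^ 2] in suitable affine coordinates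
    ([regularized_misfit_quadratic], [simultaneous_diagonalization]), and its
    Gibbs density is the standard Gaussian there ([gibbs_equilibrium]). Testing the
    equation against the functions [w_a] and [w_a w_b] shows that the covariance
    [W] in these coordinates solves the closed Riccati equation [W' = 2 W - 2 W^2]
    ([is_derive_wcov]). The coordinates can be rotated so that [W] is diagonal at
    time [1]; then it is diagonal at all positive times, with entries
    [e^(2 t) / (e^(2 t) + k_i)] and [1 + k_i > 0] ([wcov_formula]). Hence the
    solution solves a linear Fokker-Planck equation with known coefficients, that
    of an Ornstein-Uhlenbeck process in which each coordinate runs at its own
    speed.

    Uniqueness for this linear equation is obtained by duality, without any
    construction of solutions. For fixed [T] and [a], the density of the process
    at [(T, a)], as a function of the starting time and point, solves the backward
    equation; so its integral against the solution is conserved on [(0, T)]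
    ([bkernel_generator], [bkernel_conserved]). At time [0] this integral is the
    image of the initial datum under the Mehler kernel
    ([expect_bkernel_initial]); as the time increases to [T] its lower limit is at
    least [rho T a], by the lemma of Fatou ([solution_le_mehler]). An inequality
    between two probability densities is an equality almost everywhere
    ([transported_ae_eq]).

    Relative entropy is the integral of [x ln x - x + 1] at the ratio of the
    densities, weighted by the equilibrium; this function is nonnegative and
    convex. By Jensen, the entropy of the solution is at most the average over the
    initial datum of the entropy of the kernel, which is of order
    [e^(- 2 t) (1 + |u|^2)] for [t >= 1] ([entropy_le_cost], [entropy_decay]).
    By Jensen again and detailed balance, it is at most the entropy of the initial
    datum, which covers [t < 1] ([entropy_contraction]). So the entropy decays like
    [e^(- 2 t)], and the [L^1] distance like its square root ([L1_le_entropy]).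

    The technical part is the passage from the pointwise equation to balances for
    test functions of quadratic growth ([tested_increment]): the test function is
    cut off, Fubini and integration by parts are applied to the compactly
    supported product, and the cutoff is removed by dominated convergence, for
    which the integrability of [(1 + |u|) |grad rho|] in space and time is
    exactly what is needed. *)

(** * Symmetric matrices *)

Section symmetric_matrices.
Context {R : realType}.

Lemma mulmx_trE n (x y : 'cV[R]_n) :
  (x^T *m y) ord0 ord0 = \sum_i x i ord0 * y i ord0.
Proof. by rewrite mxE; apply: eq_bigr => i _; rewrite mxE. Qed.

Lemma sum_sqr_eq0 n (x : 'cV[R]_n) : \sum_i x i ord0 ^+ 2 = 0 -> x = 0.
Proof.
move=> /eqP; rewrite psumr_eq0 => [/allP x0|i _]; last exact: sqr_ge0.
apply/colP => i; rewrite mxE; apply/eqP.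
by rewrite -sqrf_eq0 (implyP (x0 i (mem_index_enum _))).
Qed.

Lemma sum_sqr_gt0 n (x : 'cV[R]_n) : x != 0 -> 0 < \sum_i x i ord0 ^+ 2.
Proof.
move=> x0; rewrite lt_neqAle sumr_ge0 ?andbT => [|i _]; last exact: sqr_ge0.
by rewrite eq_sym; apply: contra x0 => /eqP/sum_sqr_eq0 ->.
Qed.

Lemma enorm_sqr n (x : 'cV[R]_n) : enorm x ^+ 2 = \sum_i x i ord0 ^+ 2.
Proof. by rewrite sqr_sqrtr// sumr_ge0// => i _; exact: sqr_ge0. Qed.

Lemma enorm_ge0 n (x : 'cV[R]_n) : 0 <= enorm x.
Proof. exact: sqrtr_ge0. Qed.

(** A complex eigenvalue [l] of a real symmetric matrix is real, since
    [v A v^*] is its own conjugate; hence it is a root of the real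
    characteristic polynomial and has a real eigenvector. *)
Lemma symmetric_eigenvector n (A : 'M[R]_n.+1) : A^T = A ->
  exists a (x : 'cV[R]_n.+1), x != 0 /\ A *m x = a *: x.
Proof.
move=> As; pose toC := real_complex R.
pose cj : {rmorphism R[i] -> R[i]} := @conjc R.
have cjM a b : cj (a * b) = cj a * cj b by exact: rmorphM.
have cjK a : cj (cj a) = a by exact: conjcK.
have cjr a : cj (toC a) = toC a by exact: conjc_real.
pose AC : 'M[R[i]]_n.+1 := map_mx toC A.
have [l rl] : exists l, root (char_poly AC) l.
  by apply/closed_rootP; rewrite size_char_poly.
have /eigenvalueP[v vA v0] : eigenvalue AC l by rewrite eigenvalue_root_char.
pose N := \sum_i v ord0 i * cj (v ord0 i).
have N0 : N != 0.
  rewrite psumr_eq0; last by move=> i _; exact: mul_conjC_ge0.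
  apply: contra v0 => /allP h; apply/eqP/rowP => i; rewrite mxE; apply/eqP.
  by have := implyP (h i (mem_index_enum _)) isT; rewrite mul_conjC_eq0.
have cjN : cj N = N.
  rewrite /N raddf_sum; apply: eq_bigr => i _.
  by rewrite [LHS]cjM cjK mulrC.
have e1 : \sum_i (v *m AC) ord0 i * cj (v ord0 i) = l * N.
  by rewrite vA mulr_sumr; apply: eq_bigr => i _; rewrite mxE mulrA.
have e2 : cj (\sum_i (v *m AC) ord0 i * cj (v ord0 i)) =
    \sum_i (v *m AC) ord0 i * cj (v ord0 i).
  have E : \sum_i (v *m AC) ord0 i * cj (v ord0 i) =
      \sum_i \sum_j v ord0 j * toC (A j i) * cj (v ord0 i).
    apply: eq_bigr => i _; rewrite mxE mulr_suml.
    by apply: eq_bigr => j _; rewrite mxE.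
  rewrite E raddf_sum exchange_big /=; apply: eq_bigr => i _.
  rewrite raddf_sum; apply: eq_bigr => j _.
  rewrite [LHS]cjM cjK [cj (_ * _)]cjM cjr -{1}As mxE.
  by rewrite mulrC mulrA (mulrAC (v ord0 i)).
have lR : cj l = l.
  apply: (mulIf N0); rewrite -[X in _ * X]cjN -cjM.
  by rewrite -e1 e2.
have {lR} [a la] : exists a, l = toC a.
  clear -lR; case: l lR => x y; rewrite /cj /= => -[] /eqP.
  by rewrite eq_sym -subr_eq0 opprK -mulr2n mulrn_eq0 /= => /eqP ->; exists x.
have ra : root (char_poly A) a.
  by move: rl; rewrite la -map_char_poly fmorph_root.
have /eigenvalueP[w wA w0] : eigenvalue A a by rewrite eigenvalue_root_char.
exists a, w^T; split; first by rewrite trmx_eq0.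
by rewrite -{1}As -trmx_mul wA linearZ.
Qed.

Let trmxB m n (X Y : 'M[R]_(m, n)) : (X - Y)^T = X^T - Y^T.
Proof. exact: raddfB. Qed.

Let trmxZ m n a (X : 'M[R]_(m, n)) : (a *: X)^T = a *: X^T.
Proof. exact: linearZ. Qed.

Definition orthogonal_mx n (Q : 'M[R]_n) : Prop := Q^T *m Q = 1%:M.

Lemma orthogonal_mxC n (Q : 'M[R]_n) : orthogonal_mx Q -> Q *m Q^T = 1%:M.
Proof. exact: mulmx1C. Qed.

(** The Householder reflection through the bisector of [e] and [x] exchanges
    these two unit vectors. *)
Lemma householder n (e x : 'cV[R]_n) : e^T *m e = 1%:M -> x^T *m x = 1%:M ->
  exists2 Q, orthogonal_mx Q & Q *m e = x.
Proof.
move=> e1 x1; have [->|nxe] := eqVneq x e.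
  by exists 1%:M; rewrite ?mul1mx// /orthogonal_mx trmx1 mulmx1.
pose v := x - e; pose s := (e^T *m x) ord0 ord0.
have exs : e^T *m x = s%:M by rewrite [LHS]mx11_scalar.
have xes : x^T *m e = s%:M.
  by rewrite -[LHS]trmxK trmx_mul trmxK exs tr_scalar_mx.
pose c := 2 * (1 - s).
have vv : v^T *m v = c%:M.
  rewrite /v trmxB mulmxBl !mulmxBr e1 x1 exs xes -!raddfB /=.
  by congr (_%:M); rewrite /c; ring.
have c0 : c != 0.
  have : v != 0 by rewrite subr_eq0.
  apply: contra => /eqP c0; apply/eqP/sum_sqr_eq0.
  have /matrixP/(_ ord0 ord0) := vv; rewrite c0 mulmx_trE mxE mul0rn => h.
  by rewrite -[RHS]h; apply: eq_bigr => i _; rewrite expr2.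
have ve : v^T *m e = (s - 1)%:M.
  by rewrite /v trmxB mulmxBl xes e1 -raddfB.
exists (1%:M - (2 / c) *: (v *m v^T)).
  rewrite /orthogonal_mx trmxB trmx1 trmxZ trmx_mul trmxK.
  set k := 2 / c; rewrite mulmxBl mul1mx mulmxBr mulmx1 -scalemxAl -scalemxAr !mulmxA.
  rewrite -[v *m v^T *m v]mulmxA vv mul_mx_scalar -scalemxAl !scalerA.
  rewrite (_ : k * (k * c) = k + k); last by rewrite /k; field.
  move: (v *m v^T) => W; apply/matrixP => i j; rewrite !mxE; ring.
rewrite mulmxBl mul1mx -scalemxAl -mulmxA ve mul_mx_scalar scalerA.
rewrite (_ : 2 / c * (s - 1) = -1); first by rewrite scaleN1r opprK addrC subrK.
by rewrite /c; field; move: c0; rewrite /c mulf_eq0 pnatr_eq0.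
Qed.

(** Deflation: a reflection that takes the first basis vector to an eigenvector
    splits off a block of size one. *)
Theorem spectral_symmetric n (A : 'M[R]_n) : A^T = A ->
  exists2 Q, orthogonal_mx Q & exists l, A = Q *m diag_mx l *m Q^T.
Proof.
elim: n A => [|n ih] A As.
  by exists 1%:M; rewrite /orthogonal_mx ?flatmx0//; exists 0; rewrite !flatmx0.
change (exists2 Q : 'M[R]_(1 + n), orthogonal_mx Q &
  exists l : 'rV[R]_(1 + n), (A : 'M[R]_(1 + n)) = Q *m diag_mx l *m Q^T).
have [a [x [x0 Ax]]] := symmetric_eigenvector As.
pose r := Num.sqrt (\sum_i x i ord0 ^+ 2); have r0 : 0 < r.
  by rewrite sqrtr_gt0 sum_sqr_gt0.
pose y := r^-1 *: x.
have y1 : y^T *m y = 1%:M.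
  rewrite [LHS]mx11_scalar mulmx_trE; congr (_%:M).
  rewrite (eq_bigr (fun i => r^-2 * x i ord0 ^+ 2)); last first.
    by move=> i _; rewrite !mxE; field; rewrite gt_eqF.
  rewrite -mulr_sumr -[X in _ * X]sqr_sqrtr ?mulVf ?expf_neq0 ?gt_eqF//.
  by apply: sumr_ge0 => i _; exact: sqr_ge0.
have Ay : A *m y = a *: y by rewrite -scalemxAr Ax !scalerA mulrC.
pose e : 'cV[R]_(1 + n) := col_mx 1%:M 0.
have e1 : e^T *m e = 1%:M.
  by rewrite tr_col_mx mul_row_col trmx1 trmx0 mul0mx addr0 mulmx1.
have [H Ho He] := @householder (1 + n) e y e1 y1.
have HHt := orthogonal_mxC Ho.
pose B : 'M[R]_(1 + n) := H^T *m A *m H.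
have Bs : B^T = B by rewrite /B !trmx_mul trmxK As mulmxA.
have Be : B *m e = a *: e.
  by rewrite /B -!mulmxA He Ay -scalemxAr -He mulmxA Ho mul1mx.
have [ul dl] : ulsubmx B = a%:M /\ dlsubmx B = 0.
  move: Be; rewrite -[B]submxK /e mul_block_col !mulmx1 !mulmx0 !addr0.
  rewrite scale_col_mx scaler0 block_mxKul block_mxKdl => /eq_col_mx[-> ->].
  by rewrite scalemx1.
have ur : ursubmx B = 0 by rewrite -Bs -trmx_dlsub dl trmx0.
have [|Q Qo [l Bl]] := ih (drsubmx B); last first.
  exists (H *m block_mx 1%:M 0 0 Q).
    rewrite /orthogonal_mx trmx_mul mulmxA -[_ *m H^T *m H]mulmxA Ho mulmx1.
    rewrite tr_block_mx !trmx0 trmx1 mulmx_block !(mul0mx, mulmx0, addr0, add0r).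
    by rewrite mulmx1 Qo -scalar_mx_block.
  exists (row_mx a%:M l); rewrite trmx_mul !mulmxA.
  have -> : A = H *m B *m H^T.
    by rewrite /B !mulmxA HHt mul1mx -mulmxA HHt mulmx1.
  congr (_ *m _); rewrite -!mulmxA; congr (_ *m _).
  rewrite -[LHS]submxK ul dl ur Bl tr_block_mx !trmx0 trmx1 diag_mx_row.
  rewrite !mulmx_block !(mul0mx, mulmx0, addr0, add0r, mulmx1, mul1mx) mulmxA.
  by congr block_mx; apply/matrixP => i j; rewrite !mxE !ord1 eqxx.
  by rewrite trmx_drsub Bs.
Qed.

Lemma diag_quadratic n (l : 'rV[R]_n) (x : 'cV[R]_n) :
  (x^T *m diag_mx l *m x) ord0 ord0 = \sum_i l ord0 i * x i ord0 ^+ 2.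
Proof.
rewrite -mulmxA mul_diag_mx mxE; apply: eq_bigr => i _.
by rewrite !mxE; ring.
Qed.

Lemma spd_unitmx n (M : 'M[R]_n) : spd M -> M \in unitmx.
Proof.
move=> [Ms Mp]; rewrite -row_free_unit -kermx_eq0; apply/rowV0P => v /sub_kermxP vM.
apply/eqP/negPn/negP => v0; have := Mp v^T.
by rewrite trmx_eq0 trmxK vM mul0mx mxE ltxx => /(_ v0).
Qed.

Lemma spd_congr n (M L : 'M[R]_n) : L \in unitmx -> spd M -> spd (L^T *m M *m L).
Proof.
move=> Lu [Ms Mp]; split; first by rewrite !trmx_mul trmxK Ms mulmxA.
move=> x x0; rewrite !mulmxA -trmx_mul -mulmxA; apply: Mp.
by apply: contra x0 => /eqP Lx; rewrite -(mulKmx Lu x) Lx mulmx0.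
Qed.

Lemma spd_diag n (l : 'rV[R]_n) : spd (diag_mx l) <-> forall i, 0 < l ord0 i.
Proof.
split=> [[_ lp] i|lp].
  have := lp (delta_mx i ord0); rewrite diag_quadratic (bigD1 i)//= big1.
    rewrite mxE !eqxx expr1n mulr1 addr0; apply.
    by apply/negP => /eqP/colP/(_ i)/eqP; rewrite !mxE !eqxx oner_eq0.
  by move=> j ji; rewrite mxE (negbTE ji) expr0n mulr0.
split=> [|x x0]; first by rewrite tr_diag_mx.
rewrite diag_quadratic lt_neqAle eq_sym sumr_ge0 ?andbT; last first.
  by move=> i _; rewrite mulr_ge0 ?sqr_ge0 ?ltW.
rewrite psumr_eq0; last by move=> i _; rewrite mulr_ge0 ?sqr_ge0 ?ltW.
apply: contra x0 => /allP h; apply/eqP/colP => i; rewrite mxE; apply/eqP.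
by have := implyP (h i (mem_index_enum _)) isT;
  rewrite mulf_eq0 gt_eqF//= sqrf_eq0.
Qed.

Lemma orthogonal_unitmx n (Q : 'M[R]_n) : orthogonal_mx Q -> Q \in unitmx.
Proof. by move=> /mulmx1_unit[]. Qed.

Lemma spd_sqrtP n (M : 'M[R]_n) : spd M ->
  spd (spd_sqrt M) /\ spd_sqrt M *m spd_sqrt M = M.
Proof.
move=> Mpd; have [Ms _] := Mpd.
have [Q Qo [l Ml]] := spectral_symmetric Ms.
have Qu := orthogonal_unitmx Qo; have QQt := orthogonal_mxC Qo.
have l0 : forall i, 0 < l ord0 i.
  apply/spd_diag; suff -> : diag_mx l = Q^T *m M *m Q by exact: spd_congr.
  by rewrite Ml !mulmxA Qo mul1mx -mulmxA Qo mulmx1.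
pose s : 'rV[R]_n := \row_i Num.sqrt (l ord0 i).
have ss : diag_mx s *m diag_mx s = diag_mx l.
  apply/matrixP => i j; rewrite mul_diag_mx !mxE mulrnAr -expr2 sqr_sqrtr//.
  by rewrite ltW.
rewrite /spd_sqrt.
apply: (@xgetPex _ _ [set S | spd S /\ S *m S = M]).
exists (Q *m diag_mx s *m Q^T); split.
  rewrite -{1}[Q]trmxK; apply: spd_congr; first by rewrite unitmx_tr.
  by apply/spd_diag => i; rewrite mxE sqrtr_gt0.
rewrite Ml -ss !mulmxA; congr (_ *m _); rewrite -!mulmxA; congr (_ *m (_ *m _)).
by rewrite mulmxA Qo mul1mx.
Qed.

(** Reducing both [B] to the identity and [C] to a diagonal matrix: [L] is
    [B^(1/2)] followed by the rotation that diagonalizes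
    [B^(1/2) C B^(1/2)]. *)
Lemma simultaneous_diagonalization n (B C : 'M[R]_n) : spd B -> spd C ->
  exists2 L, L \in unitmx & L^T *m L = B /\
    exists2 l : 'rV[R]_n, forall i, 0 < l ord0 i & L *m C *m L^T = diag_mx l.
Proof.
move=> Bpd Cpd; have [Gpd GG] := spd_sqrtP Bpd; set G := spd_sqrt B in Gpd GG.
have [Gs _] := Gpd; have Gu := spd_unitmx Gpd.
have Tpd : spd (G *m C *m G) by rewrite -{1}Gs; exact: spd_congr.
have [Ts _] := Tpd; have [Q Qo [l Tl]] := spectral_symmetric Ts.
have QQt := orthogonal_mxC Qo; have Qu := orthogonal_unitmx Qo.
have e : Q^T *m G *m C *m (Q^T *m G)^T = diag_mx l.
  rewrite trmx_mul trmxK Gs !mulmxA -!(mulmxA Q^T) mulmxA Tl.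
  by rewrite !mulmxA Qo mul1mx -mulmxA Qo mulmx1.
exists (Q^T *m G); first by rewrite unitmx_mul unitmx_tr Qu.
split; first by rewrite trmx_mul trmxK Gs mulmxA -(mulmxA G) QQt mulmx1.
exists l => //; apply/spd_diag; rewrite -e -{1}[Q^T *m G]trmxK.
by apply: spd_congr => //; rewrite unitmx_tr unitmx_mul unitmx_tr Qu.
Qed.

Lemma wnorm_sqr n (M : 'M[R]_n) (a : 'cV[R]_n) :
  wnorm M a ^+ 2 =
  (a^T *m ((invmx (spd_sqrt M))^T *m invmx (spd_sqrt M)) *m a) ord0 ord0.
Proof.
rewrite /wnorm enorm_sqr mulmxA -trmx_mul -mulmxA mulmx_trE.
by apply: eq_bigr => i _; rewrite expr2.
Qed.

(** Completing the square: the minimizer solves the normal equations. *)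
Lemma regularized_misfit_quadratic K n (A : 'M[R]_(K, n)) y (Gam : 'M[R]_K)
    (Gam0 : 'M[R]_n) : spd Gam0 ->
  exists2 B, spd B & exists m0 c0, forall u,
    regularized_misfit A y Gam Gam0 u =
      2^-1 * ((u - m0)^T *m B *m (u - m0)) ord0 ord0 + c0.
Proof.
move=> Gpd; have [Spd _] := spd_sqrtP Gpd.
set P := invmx (spd_sqrt Gam); set P0 := invmx (spd_sqrt Gam0).
have P0u : P0 \in unitmx by rewrite unitmx_inv spd_unitmx.
pose B := A^T *m (P^T *m P) *m A + P0^T *m P0.
have Bpd : spd B.
  split; first by rewrite /B raddfD /= !trmx_mul !trmxK !mulmxA.
  move=> x x0; rewrite mulmxDr mulmxDl mxE.
  have -> : x^T *m (A^T *m (P^T *m P) *m A) *m x = (P *m A *m x)^T *m (P *m A *m x).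
    by rewrite !trmx_mul !mulmxA.
  have -> : x^T *m (P0^T *m P0) *m x = (P0 *m x)^T *m (P0 *m x).
    by rewrite !trmx_mul !mulmxA.
  rewrite !mulmx_trE; apply: ltr_wpDl.
    by apply: sumr_ge0 => i _; rewrite -expr2 sqr_ge0.
  under eq_bigr do rewrite -expr2.
  by apply: sum_sqr_gt0; apply: contra x0 => /eqP Px; rewrite -(mulKmx P0u x) Px mulmx0.
have Bu := spd_unitmx Bpd; have [Bs _] := Bpd.
exists B => //.
pose g := A^T *m (P^T *m P) *m y; pose m0 := invmx B *m g.
have Bm : B *m m0 = g by rewrite mulKVmx.
exists m0, (2^-1 * ((y^T *m (P^T *m P) *m y) ord0 ord0 - (m0^T *m g) ord0 ord0)) => u.
rewrite /regularized_misfit !wnorm_sqr -/P -/P0 -!mulrDr; congr (_ * _).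
have E1 : (A *m u - y)^T *m (P^T *m P) *m (A *m u - y) + u^T *m (P0^T *m P0) *m u =
    u^T *m B *m u - u^T *m g - (u^T *m g)^T + y^T *m (P^T *m P) *m y.
  rewrite trmxB trmx_mul !mulmxBl !mulmxBr /B /g.
  rewrite mulmxDr mulmxDl !trmx_mul !trmxK !mulmxA.
  move: (y^T *m P^T *m P *m y) (u^T *m P0^T *m P0 *m u) => a b.
  move: (u^T *m A^T *m P^T *m P *m A *m u) (y^T *m P^T *m P *m A *m u) => c e.
  move: (u^T *m A^T *m P^T *m P *m y) => f.
  by apply/matrixP => i j; rewrite !mxE; ring.
have E2 : (u - m0)^T *m B *m (u - m0) =
    u^T *m B *m u - u^T *m g - (u^T *m g)^T + m0^T *m g.
  rewrite trmxB !mulmxBl !mulmxBr.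
  have -> : u^T *m B *m m0 = u^T *m g by rewrite -mulmxA Bm.
  have -> : m0^T *m B *m m0 = m0^T *m g by rewrite -mulmxA Bm.
  have -> : m0^T *m B *m u = (u^T *m g)^T.
    by rewrite [RHS]trmx_mul trmxK -{1}Bm [(B *m m0)^T]trmx_mul Bs.
  by rewrite opprB addrA addrAC.
have /matrixP/(_ ord0 ord0) := E1; have /matrixP/(_ ord0 ord0) := E2.
rewrite !mxE => -> ->; ring.
Qed.

End symmetric_matrices.

(** * Lebesgue measure on column vectors *)

Section one_dimensional_affine_maps.
Context {R : realType}.
Local Notation mu := (@lebesgue_measure R).

Definition affine1 (a b : R) (x : measurableTypeR R) : measurableTypeR R :=
  a * x + b.

Lemma measurable_affine1 a b : measurable_fun setT (affine1 a b).
Proof.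
apply: (@continuous_measurable_fun R) => x; apply: cvgD; last exact: cvg_cst.
by apply: cvgM; [exact: cvg_cst|exact: cvg_id].
Qed.

(** The scaled image measure agrees with Lebesgue measure on half-open
    intervals, and these determine it. *)
Lemma lebesgue_measure_affine1 (a b : R) (A : set (measurableTypeR R)) :
  a != 0 -> measurable A ->
  mu A = (`|a|%:E * mu (affine1 a b @^-1` A))%E.
Proof.
move=> a0 mA; have m1 := measurable_affine1 a b.
pose nu : {measure set (measurableTypeR R) -> \bar R} :=
  mscale (NngNum (normr_ge0 a)) (pushforward mu (affine1 a b)).
apply: (@lebesgue_measure_unique _ (nu m1)) => // _ [[x y] /= xy <-].
rewrite /nu /mscale /= /pushforward.
have [a_lt0|a_gt0|a00] := ltgtP a 0; last by rewrite a00 eqxx in a0.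
  have -> : affine1 a b @^-1` `]x, y] = `[(y - b) / a, (x - b) / a[%classic.
    apply/seteqP; split=> z /=; rewrite !in_itv/= /affine1;
      rewrite ler_ndivrMr// ltr_ndivlMr// lerBrDr ltrBlDr [z * a]mulrC andbC.
    done.
    done.
  rewrite !lebesgue_measure_itv/= !lte_fin ltr_ndivrMr// mulrVK ?unitfE//.
  rewrite ltrD2r; case: ifPn => xy'; last by rewrite mule0.
  by rewrite -EFinB -EFinM ltr0_norm//; congr EFin; field.
have -> : affine1 a b @^-1` `]x, y] = `](x - b) / a, (y - b) / a]%classic.
  apply/seteqP; split=> z /=; rewrite !in_itv/= /affine1;
    by rewrite ltr_pdivrMr// ler_pdivlMr// ltrBlDr lerBrDr [z * a]mulrC.
rewrite !lebesgue_measure_itv/= !lte_fin ltr_pdivrMr// mulrVK ?unitfE//.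
rewrite ltrD2r; case: ifPn => xy'; last by rewrite mule0.
by rewrite -EFinB -EFinM gtr0_norm//; congr EFin; field.
Qed.

Lemma ge0_integral_affine1 (a b : R) (f : measurableTypeR R -> \bar R) :
  a != 0 -> measurable_fun setT f -> (forall x, 0 <= f x)%E ->
  (\int[mu]_x f (affine1 a b x) = `|a|^-1%:E * \int[mu]_x f x)%E.
Proof.
move=> a0 mf f0; have m1 := measurable_affine1 a b.
have Na0 : `|a| != 0 by rewrite normr_eq0.
have -> : (\int[mu]_x f x = `|a|%:E * \int[mu]_x f (affine1 a b x))%E.
  pose nu : {measure set (measurableTypeR R) -> \bar R} :=
    mscale (NngNum (normr_ge0 a)) (pushforward mu (affine1 a b)).
  transitivity (\int[nu m1]_x f x)%E.
    apply: eq_measure_integral => A mA _.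
    exact: (lebesgue_measure_affine1 b a0 mA).
  rewrite ge0_integral_mscale//= ge0_integral_pushforward//.
by rewrite muleA -EFinM mulVf// mul1e.
Qed.

End one_dimensional_affine_maps.

Section iterated_integrals.
Context d1 d2 (T1 : measurableType d1) (T2 : measurableType d2) (R : realType).
Variable m2 : {sigma_finite_measure set T2 -> \bar R}.
Local Open Scope ereal_scope.

Lemma measurable_ge0_integral (f : T1 -> T2 -> \bar R) :
  measurable_fun setT (fun p : T1 * T2 => f p.1 p.2) ->
  (forall x y, 0 <= f x y) ->
  measurable_fun setT (fun x => \int[m2]_y f x y).
Proof.
move=> mf f0.
exact: (@measurable_fun_fubini_tonelli_F _ _ _ _ _ m2 _ mf (fun p => f0 p.1 p.2)).
Qed.

End iterated_integrals.

Section change_of_variables.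
Context {R : realType}.
Local Open Scope ereal_scope.
Local Notation mu := (@lebesgue_measure R).
Local Notation leb n := (@lebesgue_cV R n).

Lemma measurable_mulmx m n (M : 'M[R]_(m, n)) (b : 'cV[R]_m) :
  measurable_fun setT (fun v : 'cV[R]_n => M *m v + b)%R.
Proof.
apply: measurable_fun_cVP => i; under eq_fun do rewrite mxE mxE.
apply: (measurable_funD _ (measurable_cst _)).
apply: measurable_sum => j; apply: measurable_funM => //.
exact: measurable_coord.
Qed.

Lemma ge0_integral_cons n (f : 'cV[R]_n.+1 -> \bar R) :
  measurable_fun setT f -> (forall v, 0 <= f v) ->
  \int[leb n.+1]_v f v = \int[mu]_x \int[leb n]_v f (cons_cV (x, v)).
Proof.
move=> mf f0; have mc := @measurable_cons_cV R n.
rewrite [LHS](@ge0_integral_pushforward _ _ _ _ _ _ mc)//.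
rewrite preimage_setT.
exact: (@fubini_tonelli1 _ _ _ _ R mu (leb n) (f \o @cons_cV R n) (measurableT_comp mf mc)
  (fun p => f0 _)).
Qed.

Lemma ge0_integral_consr n (f : 'cV[R]_n.+1 -> \bar R) :
  measurable_fun setT f -> (forall v, 0 <= f v) ->
  \int[leb n.+1]_v f v = \int[leb n]_v \int[mu]_x f (cons_cV (x, v)).
Proof.
move=> mf f0; have mc := @measurable_cons_cV R n.
rewrite [LHS](@ge0_integral_pushforward _ _ _ _ _ _ mc)//.
rewrite preimage_setT.
exact: (@fubini_tonelli2 _ _ _ _ R mu (leb n) (f \o @cons_cV R n) (measurableT_comp mf mc)
  (fun p => f0 _)).
Qed.

Lemma ge0_integral_translate n (b : 'cV[R]_n) (f : 'cV[R]_n -> \bar R) :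
  measurable_fun setT f -> (forall v, 0 <= f v) ->
  \int[leb n]_v f (v + b)%R = \int[leb n]_v f v.
Proof.
elim: n b f => [|n ih] b f mf f0.
  by apply: eq_integral => v _; congr f; rewrite [LHS]flatmx0 [RHS]flatmx0.
have mc := @measurable_cons_cV R n.
have mfb : measurable_fun setT (fun v : 'cV[R]_n.+1 => f (v + b)%R).
  apply: (measurableT_comp mf); have := measurable_mulmx 1%:M b.
  by under eq_fun do rewrite mul1mx.
pose b0 := b ord0 ord0; pose b' : 'cV[R]_n := dsubmx (b : 'cV[R]_(1 + n)).
have consb x v : (cons_cV (x, v) + b = cons_cV (x + b0, v + b'))%R.
  apply/colP => i; rewrite mxE; have [j ->|->] := unliftP ord0 i.
    rewrite !cons_cVS /= !mxE; congr (_ + b _ _)%R; exact: val_inj.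
  by rewrite !cons_cV0.
rewrite (ge0_integral_cons mfb (fun v => f0 _)) (ge0_integral_cons mf f0).
under eq_integral do under eq_integral do rewrite consb.
pose g (x : measurableTypeR R) : \bar R := \int[leb n]_v f (cons_cV (x, v)).
have fc : measurable_fun setT (fun p : measurableTypeR R * 'cV[R]_n => f (cons_cV p)).
  exact: measurableT_comp.
have mfx (x : measurableTypeR R) : measurable_fun setT (fun v => f (cons_cV (x, v))).
  exact: (measurableT_comp fc (measurable_pair1 _)).
have e (x : measurableTypeR R) : \int[leb n]_v f (cons_cV ((x + b0)%R : measurableTypeR R, v + b')%R) = g (x + b0)%R.
  exact: (ih b' (fun v => f (cons_cV ((x + b0)%R : measurableTypeR R, v)))).
under eq_integral do rewrite e.
have mg : measurable_fun setT g.
  by apply: measurable_ge0_integral => [|x v]; [exact: fc|exact: f0].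
have g0 x : 0 <= g x by exact: integral_ge0.
have := @ge0_integral_affine1 R 1 b0 g (oner_neq0 _) mg g0.
rewrite normr1 invr1 mul1e => <-.
by apply: eq_integral => x _; rewrite /affine1 mul1r.
Qed.

(** A property of the matrix rather than a lemma, to be propagated through
    matrix products. *)
Definition linear_cv n (M : 'M[R]_n) : Prop :=
  forall f : 'cV[R]_n -> \bar R, measurable_fun setT f -> (forall v, 0 <= f v) ->
  \int[leb n]_v f (M *m v) = (`|\det M|^-1)%:E * \int[leb n]_v f v.

Lemma measurable_mulmx0 m n (M : 'M[R]_(m, n)) : measurable_fun setT (mulmx M : 'cV[R]_n -> 'cV[R]_m).
Proof.
by have := measurable_mulmx M 0; under eq_fun do rewrite addr0.
Qed.

Lemma linear_cvM n (M N : 'M[R]_n) :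
  linear_cv M -> linear_cv N -> linear_cv (M *m N).
Proof.
move=> hM hN f mf f0.
under eq_integral do rewrite -mulmxA.
rewrite (hN (fun v => f (M *m v)))//; last first.
  exact: (measurableT_comp mf (measurable_mulmx0 M)).
by rewrite hM// muleA -EFinM det_mulmx normrM invfM mulrC.
Qed.

Lemma block_mul_cons n (a : R) (b : 'rV[R]_n) (c : 'cV[R]_n) (D : 'M[R]_n)
    (x : measurableTypeR R) v :
  (block_mx a%:M b c D : 'M[R]_n.+1) *m cons_cV (x, v) =
  cons_cV (a * x + (b *m v) ord0 ord0 : measurableTypeR R, x *: c + D *m v)%R.
Proof.
apply: (etrans (@mul_block_col _ 1 n 1 n 1 a%:M b c D (x : R)%:M v)).
rewrite -scalar_mxM mul_mx_scalar; congr (@col_mx _ 1 n 1 _ _).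
by rewrite raddfD /= -mx11_scalar.
Qed.

Lemma linear_cv_upper n a (b : 'rV[R]_n) (D : 'M[R]_n) : (a != 0)%R -> linear_cv D ->
  linear_cv (block_mx a%:M b 0 D : 'M[R]_n.+1).
Proof.
move=> a0 hD f mf f0; have mc := @measurable_cons_cV R n.
have mfM := measurableT_comp mf (@measurable_mulmx0 _ _ (block_mx a%:M b 0 D : 'M[R]_n.+1)).
rewrite ge0_integral_consr//.
have fc : measurable_fun setT (fun p : measurableTypeR R * 'cV[R]_n => f (cons_cV p)).
  exact: measurableT_comp.
have mfv v : measurable_fun setT (fun x : measurableTypeR R => f (cons_cV (x, v))).
  exact: (measurableT_comp fc (measurable_pair2 _)).
pose g (v : 'cV[R]_n) : \bar R := \int[mu]_x f (cons_cV (x, v)).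
have e v : \int[mu]_x f ((block_mx a%:M b 0 D : 'M[R]_n.+1) *m cons_cV (x, v)) =
    (`|a|^-1)%:E * g (D *m v).
  under eq_integral do rewrite block_mul_cons scaler0 add0r.
  exact: (@ge0_integral_affine1 R a _ (fun x => f (cons_cV (x, D *m v)))).
under eq_integral do rewrite e.
have mg : measurable_fun setT g.
  apply: (@measurable_ge0_integral _ _ _ _ R mu (fun v x => f (cons_cV (x, v)))).
    exact: (measurableT_comp fc (measurable_fun_pair measurable_snd measurable_fst)).
  by move=> *; exact: f0.
have g0 v : 0 <= g v by exact: integral_ge0.
rewrite ge0_integralZl_EFin//; last first.
  exact: (measurableT_comp mg (measurable_mulmx0 D)).
rewrite hD// ge0_integral_consr// muleA -EFinM.
have -> : (\det (block_mx a%:M b 0 D : 'M[R]_n.+1) = a * \det D)%R.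
  by apply: (etrans (@det_ublock _ 1 n _ _ _)); rewrite det_scalar1.
by rewrite normrM invfM.
Qed.

Lemma linear_cv_lower n (c : 'cV[R]_n) :
  linear_cv (block_mx 1%:M 0 c 1%:M : 'M[R]_n.+1).
Proof.
move=> f mf f0; have mc := @measurable_cons_cV R n.
have mfM := measurableT_comp mf (@measurable_mulmx0 _ _ (block_mx 1%:M 0 c 1%:M : 'M[R]_n.+1)).
rewrite ge0_integral_cons//.
have fc : measurable_fun setT (fun p : measurableTypeR R * 'cV[R]_n => f (cons_cV p)).
  exact: measurableT_comp.
have mfx (x : measurableTypeR R) : measurable_fun setT (fun v => f (cons_cV (x, v))).
  exact: (measurableT_comp fc (measurable_pair1 _)).
have e (x : measurableTypeR R) : \int[leb n]_v f ((block_mx 1%:M 0 c 1%:M : 'M[R]_n.+1) *m cons_cV (x, v)) =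
    \int[leb n]_v f (cons_cV (x, v)).
  under eq_integral do rewrite block_mul_cons mul0mx mxE addr0 mul1r mul1mx addrC.
  exact: (ge0_integral_translate (x *: c) (mfx x)).
under eq_integral do rewrite e.
rewrite -ge0_integral_cons// (_ : \det _ = 1)%R ?normr1 ?invr1 ?mul1e//.
by apply: (etrans (@det_lblock _ 1 n _ _ _)); rewrite !det1 mulr1.
Qed.

(** Block Gaussian elimination writes an invertible matrix as a product of block
    triangular ones, once a shear has made its corner entry nonzero. *)
Lemma linear_cv_unitmx n (M : 'M[R]_n) : M \in unitmx -> linear_cv M.
Proof.
elim: n M => [|n ih] M Mu.
  move=> f mf f0; rewrite det_mx00 normr1 invr1 mul1e.
  by apply: eq_integral => v _; congr f; rewrite [LHS]flatmx0 [RHS]flatmx0.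
have corner (N : 'M[R]_(1 + n)) : (N ord0 ord0 != 0)%R -> N \in unitmx -> linear_cv N.
  move=> a0 Nu; set a := N ord0 ord0 in a0.
  have ulN : ulsubmx N = a%:M.
    by rewrite [LHS]mx11_scalar !mxE; congr (N _ _)%:M; exact: val_inj.
  pose D := (drsubmx N - a^-1 *: (dlsubmx N *m ursubmx N))%R.
  have eN : N = block_mx 1%:M 0 (a^-1 *: dlsubmx N) 1%:M *m
      block_mx a%:M (ursubmx N) 0 D.
    rewrite mulmx_block !mul1mx !mul0mx !addr0 -scalemxAl mul_mx_scalar.
    rewrite scalerA mulVf// scale1r /D -scalemxAl addrC subrK -ulN submxK//.
  rewrite eN; apply: linear_cvM; first exact: linear_cv_lower.
  apply: linear_cv_upper => //; apply: ih.
  move: Nu; rewrite eN unitmx_mul => /andP[_].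
  by rewrite !unitmxE det_ublock unitrM => /andP[].
have [a0|a0] := eqVneq ((M : 'M[R]_(1 + n)) ord0 ord0) 0%R; last exact: corner.
have [i Mi0] : exists i : 'I_n, (dlsubmx (M : 'M[R]_(1 + n)) i ord0 != 0)%R.
  apply/existsP; apply: contraT; rewrite negb_exists => /forallP h.
  have dl0 : dlsubmx (M : 'M[R]_(1 + n)) = 0%R.
    by apply/colP => i; have := h i; rewrite negbK mxE => /eqP ->; rewrite mxE.
  have ul0 : ulsubmx (M : 'M[R]_(1 + n)) = 0%R.
    rewrite [LHS]mx11_scalar !mxE -[RHS](raddf0 (@scalar_mx _ 1)) -a0.
    by congr (M _ _)%:M; exact: val_inj.
  move: Mu; rewrite -[M](@submxK _ 1 n 1 n) ul0 dl0 unitmxE (@det_ublock _ 1 n) det0.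
  by rewrite mul0r unitr0.
pose T (s : R) : 'M[R]_(1 + n) := block_mx 1%:M (s *: delta_mx ord0 i) 0 1%:M.
have TT : T (-1)%R *m T 1%R = 1%:M.
  rewrite mulmx_block !mul1mx !mul0mx !mulmx1 !mulmx0 addr0 add0r add0r.
  by rewrite scaleN1r scale1r subrr -scalar_mx_block.
have hT s : linear_cv (T s).
  apply: linear_cv_upper; first exact: oner_neq0.
  by move=> f mf f0; rewrite det1 normr1 invr1 mul1e;
    apply: eq_integral => v _; rewrite mul1mx.
have eM : (M : 'M[R]_(1 + n)) = T (-1)%R *m (T 1%R *m M).
  by rewrite mulmxA TT mul1mx.
have : linear_cv (T 1%R *m (M : 'M[R]_(1 + n))).
  apply: corner; last by rewrite unitmx_mul Mu andbT; case/mulmx1_unit: TT.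
  rewrite -[M](@submxK _ 1 n 1 n) mulmx_block.
  rewrite (_ : ord0 = @lshift 1 n ord0); last exact: val_inj.
  rewrite block_mxEul mul1mx scale1r -rowE !mxE.
  rewrite (_ : (M : 'M[R]_(1 + n)) (lshift n _) _ = 0)%R ?add0r//; first by move: Mi0; rewrite !mxE.
  by rewrite -a0; congr (M _ _); exact: val_inj.
by move=> h; rewrite eM; apply: linear_cvM => //; exact: hT.
Qed.

Theorem ge0_integral_affine n (M : 'M[R]_n) (b : 'cV[R]_n) (f : 'cV[R]_n -> \bar R) :
  M \in unitmx -> measurable_fun setT f -> (forall v, 0 <= f v) ->
  \int[leb n]_v f (M *m v + b)%R = (`|\det M|^-1)%:E * \int[leb n]_v f v.
Proof.
move=> Mu mf f0; rewrite (linear_cv_unitmx Mu (f := fun v => f (v + b)%R))//.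
  by rewrite ge0_integral_translate.
apply: (measurableT_comp mf); have := measurable_mulmx 1%:M b.
by under eq_fun do rewrite mul1mx.
Qed.

End change_of_variables.

(** * Continuous functions on column vectors *)

Section continuous_arithmetic.
Context {R : realType} {T : topologicalType}.
Implicit Types f g : T -> R.

Lemma continuous_add f g :
  continuous f -> continuous g -> continuous (fun x => f x + g x).
Proof. by move=> cf cg x; apply: cvgD; [exact: cf|exact: cg]. Qed.

Lemma continuous_mul f g :
  continuous f -> continuous g -> continuous (fun x => f x * g x).
Proof. by move=> cf cg x; apply: cvgM; [exact: cf|exact: cg]. Qed.

Lemma continuous_opp f : continuous f -> continuous (fun x => - f x).
Proof. by move=> cf x; apply: cvgN; exact: cf. Qed.

End continuous_arithmetic.

Lemma cvg_sum_seq (R : realType) (T : Type) (F : set_system T) (FF : Filter F) (I : Type)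
    (s : seq I) (f : I -> T -> R) (l : I -> R) :
  (forall i, f i x @[x --> F] --> l i) ->
  \sum_(i <- s) f i x @[x --> F] --> \sum_(i <- s) l i.
Proof.
move=> fl; elim: s => [|a s ih].
  by under eq_fun do rewrite big_nil; rewrite big_nil; exact: cvg_cst.
by under eq_fun do rewrite big_cons; rewrite big_cons; exact: cvgD.
Qed.

Lemma continuous_pairl (U V : topologicalType) (x : U) : continuous (fun y : V => (x, y)).
Proof. by move=> y; apply: cvg_pair; [exact: cvg_cst|exact: cvg_id]. Qed.

Lemma continuous_pairr (U V : topologicalType) (y : V) : continuous (fun x : U => (x, y)).
Proof. by move=> x; apply: cvg_pair; [exact: cvg_id|exact: cvg_cst]. Qed.


Section continuous_functions.
Context {R : realType}.
Local Notation leb n := (@lebesgue_cV R n).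

Lemma ball_cVE n (x y : 'cV[R]_n) (e : R) : 0 < e ->
  ball x e y <-> forall i, `|x i ord0 - y i ord0| < e.
Proof.
move=> e0; split=> [[_ h] i|h]; first exact: h.
by split=> // i j; rewrite ord1; exact: h.
Qed.

(** Every open set is a union of balls with rational data. *)
Lemma open_measurable_cV n (U : set 'cV[R]_n) : open U -> measurable U.
Proof.
move=> oU.
pose B (p : 'cV[rat]_n * rat) : set 'cV[R]_n :=
  [set v | forall i, `|ratr (p.1 i ord0) - v i ord0| < ratr p.2].
have mB p : measurable (B p).
  rewrite [X in measurable X](_ : _ = \bigcap_(i in [set: 'I_n])
      (fun v : 'cV[R]_n => v i ord0) @^-1` ball (ratr (p.1 i ord0) : R) (ratr p.2)).
    apply: fin_bigcap_measurable => // i _.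
    rewrite -[X in measurable X]setTI; apply: measurable_coord => //.
    by rewrite -ball_normE; exact: measurable_ball.
  by apply/seteqP; split => v /= h i; [move=> _; exact: h|exact: h i I].
pose F (k : nat) : set 'cV[R]_n :=
  if unpickle k is Some p then (if `[< B p `<=` U >] then B p else set0) else set0.
have -> : U = \bigcup_k F k.
  apply/seteqP; split=> [x Ux|x [k _]]; last first.
    by rewrite /F; case: unpickle => // p; case: asboolP => // h; exact: h.
  have /nbhs_ballP[e /= e0 xeU] : nbhs x U by exact: open_nbhs_nbhs.
  have [r] := @rat_in_itvoo R 0 (e / 2) (divr_gt0 e0 (ltr0n _ 2)).
  rewrite in_itv /= => /andP[r0 re].
  have /choice[q hq] : forall i, exists q : rat, `|ratr q - x i ord0| < ratr r.
    move=> i; have [|q] := @rat_in_itvoo R (x i ord0 - ratr r) (x i ord0 + ratr r).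
      by rewrite ltrD2l gtrN.
    by rewrite in_itv /= => h; exists q; rewrite ltr_distl.
  pose p : 'cV[rat]_n * rat := (\col_i q i, r).
  exists (pickle p) => //; rewrite /F pickleK; case: asboolP => [_ i|].
    by rewrite /= mxE; exact: hq.
  case=> y By; apply: xeU; apply/ball_cVE => // i.
  have := By i; rewrite /= mxE => By'; have := hq i; rewrite distrC => hq'.
  rewrite (splitr e) -(subrK (ratr (q i)) (x i ord0)) -addrA.
  by rewrite (le_lt_trans (ler_normD _ _))// ltrD// (lt_trans _ re).
apply: bigcupT_measurable => k; rewrite /F; case: unpickle => // p.
by case: asboolP.
Qed.

Lemma open_continuous_measurable_cV n (D : set 'cV[R]_n) (f : 'cV[R]_n -> R) :
  open D -> (forall u, D u -> {for u, continuous f}) -> measurable_fun D f.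
Proof.
move=> oD cf mD; apply: (measurability _ (RGenOpens.measurableE R)) => //.
move=> _ [_ [a [b ->] <-]]; apply: open_measurable_cV.
rewrite openE => u [Du fu]; apply: filterI; first exact: open_nbhs_nbhs.
apply: cf => //; apply: open_nbhs_nbhs; split=> //; exact: interval_open.
Qed.

Lemma continuous_measurable_cV n (f : 'cV[R]_n -> R) :
  continuous f -> measurable_fun setT f.
Proof.
move=> cf; apply: (@open_continuous_measurable_cV n [set: 'cV[R]_n]) => //.
- exact: openT.
- by move=> u _; exact: cf.
Qed.

(** Time is added as a zeroth coordinate by [cons_cV], which brings space-time
    back to the case of column vectors. *)
Lemma open_continuous_measurable_time n (D : set R) (g : R -> 'cV[R]_n -> R) :
  open D ->
  (forall t u, D t -> {for (t, u), continuous (fun p : R * 'cV[R]_n => g p.1 p.2)}) ->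
  measurable_fun (D `*` setT) (fun p : measurableTypeR R * 'cV[R]_n => g p.1 p.2).
Proof.
move=> oD cg.
pose D' : set 'cV[R]_n.+1 := [set v | D ((uncons_cV v).1)].
have u1 (v : 'cV[R]_n.+1) : (uncons_cV v).1 = v ord0 ord0.
  by rewrite -{2}(uncons_cVK v) cons_cV0.
have u2 (v : 'cV[R]_n.+1) i : (uncons_cV v).2 i ord0 = v (lift ord0 i) ord0.
  by rewrite -{2}(uncons_cVK v) cons_cVS.
have c1 : continuous (fun v : 'cV[R]_n.+1 => (uncons_cV v).1 : R).
  by under eq_fun do rewrite u1; exact: coord_continuous.
have oD' : open D' by apply: open_comp => // v _; exact: c1.
have cG v : D' v ->
    {for v, continuous (fun v => g (uncons_cV v).1 (uncons_cV v).2)}.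
  move=> D'v.
  apply: (@continuous_comp _ _ _ (fun w => ((uncons_cV w).1 : R, (uncons_cV w).2))
    (fun p : R * 'cV[R]_n => g p.1 p.2)); last exact: cg.
  have c2 : continuous (fun w : 'cV[R]_n.+1 => (uncons_cV w).2).
    move=> x A /nbhs_ballP[e /= e0 eA].
    apply: (filterS _ (nbhsx_ballx x e e0)) => w /(ball_cVE _ _ e0) h.
    by apply: eA; apply/ball_cVE => // i; rewrite !u2; exact: h.
  exact: (cvg_pair (c1 v) (c2 v)).
have mG := open_continuous_measurable_cV oD' cG.
have mDT : measurable (D `*` setT : set (measurableTypeR R * 'cV[R]_n)).
  by apply: measurableX => //; exact: open_measurable.
have e : (fun p : measurableTypeR R * 'cV[R]_n => g p.1 p.2) =
    (fun v => g (uncons_cV v).1 (uncons_cV v).2) \o @cons_cV R n.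
  by apply/funext => p; rewrite [in RHS]/comp cons_cVK.
rewrite e; apply: (measurable_comp _ _ mG).
- exact: open_measurable_cV.
- by move=> _ [p [Dp _] <-]; rewrite /D' /mkset u1 cons_cV0.
- by apply: measurable_funTS; exact: measurable_cons_cV.
Qed.

(** A positive value persists on a box, and boxes have positive measure. *)
Lemma continuous_ge0_integral_eq0 n (f : 'cV[R]_n -> R) :
  continuous f -> (forall u, 0 <= f u) ->
  (\int[leb n]_u (f u)%:E = 0)%E -> forall u, f u = 0.
Proof.
move=> cf f0 If u; apply/eqP; rewrite eq_le f0 andbT leNgt; apply/negP => fu.
have /nbhs_ballP[e /= e0 ef] : nbhs u [set v | f u / 2 < f v].
  have : f v @[v --> u] --> f u by exact: cf.
  by move/cvgr_gt; apply; rewrite ltr_pdivrMr// ltr_pMr// ltr1n.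
pose J i : set R := `](u i ord0 - e), (u i ord0 + e)[%classic.
pose B := [set v : 'cV[R]_n | forall i, J i (v i ord0)].
have mI i : measurable (J i) by exact: measurable_itv.
have Be v : B v -> f u / 2 <= f v.
  move=> Bv; apply: ltW; apply: ef; apply/ball_cVE => // i.
  by have := Bv i; rewrite /J /= in_itv /= distrC ltr_distl.
have mB : measurable B.
  rewrite [X in measurable X](_ : _ = \bigcap_(i in [set: 'I_n])
      (fun v : 'cV[R]_n => v i ord0) @^-1` J i).
    apply: fin_bigcap_measurable => // i _.
    by rewrite -[X in measurable X]setTI; exact: measurable_coord.
  by apply/seteqP; split => v /= h i; [move=> _; exact: h|exact: h i I].
have B0 : (0 < leb n B)%E.
  rewrite lebesgue_cV_box//; elim/big_rec: _ => [|i x _ x0]; first exact: lte01.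
  rewrite mule_gt0// /J lebesgue_measure_itv/= lte_fin ltrD2l gtrN// -EFinB lte_fin.
  by rewrite opprB addrC addrA subrK addr_gt0.
have mf := continuous_measurable_cV cf.
have : (\int[leb n]_(v in B) (f u / 2)%:E <= \int[leb n]_v (f v)%:E)%E.
  apply: (@le_trans _ _ (\int[leb n]_(v in B) (f v)%:E)%E).
    apply: ge0_le_integral => //.
    - by move=> v _; rewrite lee_fin divr_ge0.
    - by apply/measurable_EFinP; exact: measurable_funTS.
  apply: (ge0_subset_integral (leb n) mB measurableT) => //.
  - exact/measurable_EFinP.
  - by move=> v _; rewrite lee_fin.
rewrite If (integral_cst _ mB (f u / 2)%:E) leNgt => /negP; apply.
by rewrite mule_gt0// lte_fin divr_gt0.
Qed.

End continuous_functions.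

(** * Integration by parts *)

Section directional_derivatives.
Context {R : realType} {n : nat}.
Implicit Types (f g : 'cV[R]_n -> R) (u v : 'cV[R]_n).

(** The derivative along [v] is the derivative of the restriction to a line. *)
Lemma is_derive_line f u v (s df : R) :
  is_derive (u + s *: v) v f df <->
  is_derive s (1 : R) (fun h : R => f (u + h *: v)) df.
Proof.
have e : (fun h : R => h^-1 *: ((f \o shift (u + s *: v)) (h *: v) - f (u + s *: v))) =
    (fun h : R => h^-1 *: (((fun h => f (u + h *: v)) \o shift s) (h *: (1 : R)) -
       f (u + s *: v))).
  apply/funext => h; congr (_ *: (f _ - _)).
  by rewrite /= [h%:A]mulr1 scalerDl addrCA.
split=> -[df1 df2]; split.
- by rewrite /derivable -e.
- by rewrite /derive -e.
- by rewrite /derivable e.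
- by rewrite /derive e.
Qed.

Lemma is_derive_coord_line f u v (df : R) :
  is_derive u v f df <-> is_derive (0 : R) (1 : R) (fun h : R => f (u + h *: v)) df.
Proof. by rewrite -{1}(addr0 u) -(scale0r v) is_derive_line. Qed.

End directional_derivatives.

Section integration_by_parts.
Context {R : realType} {n : nat}.
Local Notation leb := (@lebesgue_cV R n).
Local Notation mu := (@lebesgue_measure R).
Implicit Types f g : 'cV[R]_n -> R.

Lemma integral_translate (b : 'cV[R]_n) (f : 'cV[R]_n -> \bar R) :
  measurable_fun setT f ->
  (\int[leb]_v f (v + b)%R = \int[leb]_v f v)%E.
Proof.
move=> mf; rewrite [LHS]integralE [RHS]integralE.
rewrite -(ge0_integral_translate b (measurable_funepos mf)); last first.
  by move=> v; exact: funepos_ge0.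
rewrite -(ge0_integral_translate b (measurable_funeneg mf))//.
by congr (_ - _)%E; apply: eq_integral => v _;
    [exact: (congr1 (@^~ v) (funepos_comp f (fun v => v + b)))|
     exact: (congr1 (@^~ v) (funeneg_comp f (fun v => v + b)))].
Qed.

(** Translation invariance gives [int (g (u + e) - g u) du = 0]; writing the
    difference as the integral of the derivative along the segment and using
    invariance again, this is [int g']. *)
Lemma integral_derive_eq0 (e : 'cV[R]_n) g g' :
  (forall u, is_derive u e g (g' u)) -> continuous g' ->
  leb.-integrable setT (EFin \o g) -> leb.-integrable setT (EFin \o g') ->
  (\int[leb]_u (g' u)%:E = 0)%E.
Proof.
move=> dg cg' ig ig'.
have mu01 : mu `[0%R, 1%R]%classic = 1%E.
  by rewrite lebesgue_measure_itv/= lte_fin ltr01 -EFinB subr0.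
have Iind : (\int[mu]_x (\1_(`[0%R, 1%R]%classic) (x : R))%:E = 1)%E.
  by rewrite -mu01 -[in RHS](setIT `[0%R, 1%R]%classic); exact: integral_indic.
have mg' : measurable_fun setT g' by exact: continuous_measurable_cV.
pose F (p : 'cV[R]_n * measurableTypeR R) : \bar R :=
  (\1_(`[0%R, 1%R]%classic) (p.2 : R) * g' (p.1 + (p.2 : R) *: e))%:E.
have mF : measurable_fun setT F.
  apply/measurable_EFinP; apply: measurable_funM.
    by apply: (measurableT_comp _ measurable_snd); exact: measurable_indic.
  apply: (measurableT_comp mg'); apply: measurable_fun_cVP => i.
  under eq_fun do rewrite !mxE.
  apply: measurable_funD.
    exact: (measurableT_comp (measurable_coord i) measurable_fst).
  by apply: measurable_funM => //; exact: measurable_snd.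
have iF : (leb \x mu)%E.-integrable setT F.
  apply: (integrable21ltyP leb mu mF).2.
  have e1 (s : measurableTypeR R) : (\int[leb]_u `|F (u, s)| =
     (\1_(`[0%R, 1%R]%classic) (s : R))%:E * \int[leb]_u `|(g' u)%:E|)%E.
    under eq_integral do rewrite /F /= normrM EFinM.
    have ms : measurable_fun setT (fun u : 'cV[R]_n => (`|g' (u + (s : R) *: e)|)%:E).
      apply/measurable_EFinP; apply: measurableT_comp => //.
      apply: (measurableT_comp mg'); have := measurable_mulmx 1%:M ((s : R) *: e).
      by under eq_fun do rewrite mul1mx.
    rewrite ge0_integralZl_EFin//.
    rewrite ger0_norm//; congr (_ * _)%E.
    apply: (@integral_translate _ (fun u => `|g' u|%:E)).
    by apply/measurable_EFinP; exact: measurableT_comp.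
  under eq_integral do rewrite e1.
  have mI : measurable_fun setT (fun x : measurableTypeR R => (\1_(`[0%R, 1%R]%classic) (x : R))%:E : \bar R).
    by apply/measurable_EFinP; exact: measurable_indic.
  rewrite ge0_integralZr//; last by apply: integral_ge0 => u _; exact: abse_ge0.
  rewrite Iind mul1e.
  by have /integrableP[] := ig'.
have := Fubini iF.
have -> : (\int[leb]_x \int[mu]_y F (x, y) = 0)%E.
  have e1 u : (\int[mu]_s F (u, s) = (g (u + e))%:E - (g u)%:E)%E.
    have -> : (\int[mu]_s F (u, s) = \int[mu]_(s in `[0%R, 1%R]) (g' (u + s *: e))%:E)%E.
      rewrite [RHS]integral_mkcond; apply: eq_integral => s _.
      rewrite /F /patch /= indicE; case: ifP => _; by rewrite ?mul1r ?mul0r.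
    have cl : continuous (fun s : R => u + s *: e).
      move=> s; apply: cvgD; first exact: cvg_cst.
      by apply: cvgZ; [exact: cvg_id|exact: cvg_cst].
    have dl (s : R) : is_derive s (1 : R) (fun s : R => g (u + s *: e)) (g' (u + s *: e)).
      by apply/is_derive_line; exact: dg.
    have cgl : continuous (fun s : R => g (u + s *: e)).
      move=> s; apply: differentiable_continuous; apply/derivable1_diffP.
      exact: (@ex_derive _ _ _ _ _ _ _ (dl s)).
    rewrite (@continuous_FTC2 _ (fun s => g' (u + s *: e)) (fun s => g (u + s *: e)))//.
    - by rewrite scale1r scale0r addr0.
    - apply: continuous_subspaceT => s; apply: continuous_comp; [exact: cl|exact: cg'].
    - split.
      + by move=> s _; exact: (@ex_derive _ _ _ _ _ _ _ (dl s)).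
      + by apply: cvg_at_right_filter; exact: cgl.
      + by apply: cvg_at_left_filter; exact: cgl.
    - by move=> s _; rewrite derive1E; exact: (@derive_val _ _ _ _ _ _ _ (dl s)).
  under eq_integral do rewrite e1.
  have mg : measurable_fun setT (fun u => (g u)%:E) by have /integrableP[] := ig.
  have igt : leb.-integrable setT (fun u => (g (u + e))%:E).
    apply/integrableP; split.
      apply: (measurableT_comp mg); have := measurable_mulmx 1%:M e.
      by under eq_fun do rewrite mul1mx.
    rewrite (@integral_translate e (fun u => `|(g u)%:E|)%E); first by have /integrableP[] := ig.
    exact: measurableT_comp.
  rewrite integralB//.
  rewrite (integral_translate e mg) subee//; exact: integrable_fin_num.
have e2 (s : measurableTypeR R) : (\int[leb]_u F (u, s) =
     (\1_(`[0%R, 1%R]%classic) (s : R))%:E * \int[leb]_u (g' u)%:E)%E.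
  rewrite -(@integral_translate ((s : R) *: e) (EFin \o g')); last first.
    exact/measurable_EFinP.
  rewrite -integralZl//; apply/integrableP; split.
    apply/measurable_EFinP; apply: (measurableT_comp mg').
    have := measurable_mulmx 1%:M ((s : R) *: e).
    by under eq_fun do rewrite mul1mx.
  rewrite (@integral_translate _ (fun u => `|g' u|%:E)); first by have /integrableP[] := ig'.
  by apply/measurable_EFinP; exact: measurableT_comp.
have cE : (\int[leb]_u (g' u)%:E = (fine (\int[leb]_u (g' u)%:E))%:E)%E.
  by rewrite fineK//; exact: integrable_fin_num.
under [X in _ = X -> _]eq_integral do rewrite e2 cE.
rewrite integralZr//; last first.
  apply/integrableP; split; first by apply/measurable_EFinP; exact: measurable_indic.
  under eq_integral do rewrite /= ger0_norm//.
  by rewrite Iind ltry.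
rewrite Iind mul1e -cE.
by move=> ->.
Qed.

Theorem integral_by_parts (e : 'cV[R]_n) f f' g g' :
  (forall u, is_derive u e f (f' u)) -> (forall u, is_derive u e g (g' u)) ->
  continuous f -> continuous f' -> continuous g -> continuous g' ->
  leb.-integrable setT (fun u => (f u * g u)%:E) ->
  leb.-integrable setT (fun u => (f' u * g u)%:E) ->
  leb.-integrable setT (fun u => (f u * g' u)%:E) ->
  \int[leb]_u (f' u * g u) = - \int[leb]_u (f u * g' u).
Proof.
move=> df dg cf cf' cg cg' ifg if'g ifg'.
have d u : is_derive u e (f * g) (f u * g' u + f' u * g u).
  have h := is_deriveM (df u) (dg u); apply: (is_derive_eq h).
  by rewrite /GRing.scale /= [g u * _]mulrC.
have c : continuous (fun u => f u * g' u + f' u * g u).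
  by apply: continuous_add; apply: continuous_mul.
have i : leb.-integrable setT (EFin \o (fun u => f u * g' u + f' u * g u)).
  rewrite (_ : _ \o _ = (fun u => (f u * g' u)%:E + (f' u * g u)%:E)%E)//.
  exact: integrableD.
have := integral_derive_eq0 d c ifg i.
move/(congr1 fine); rewrite -/(Rintegral leb setT _) RintegralD//.
by move/eqP; rewrite addrC addr_eq0 => /eqP.
Qed.

End integration_by_parts.

(** * Cutoffs and integrability *)

Section derivative_criterion.
Context {R : realType}.

Lemma is_derive_eps (f : R -> R) (x d : R) :
  (forall eps, 0 < eps -> exists2 del, 0 < del &
    forall h, `|h| < del -> `|f (x + h) - f x - h * d| <= eps * `|h|) ->
  is_derive x (1 : R) f d.
Proof.
move=> H.
have c : (fun h : R => h^-1 *: ((f \o shift x) (h *: (1 : R)) - f x)) @ 0^' --> d.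
  apply/cvgrPdist_le => e e0; have [del d0 hd] := H e e0.
  near=> h.
  have h0 : h != 0 by near: h; exact: nbhs_dnbhs_neq.
  have hlt : `|h| < del by near: h; exact: dnbhs0_lt.
  rewrite /= [h%:A]mulr1 /GRing.scale /= addrC.
  rewrite (_ : h + x = x + h); last exact: addrC.
  have h1 : 0 < `|h| by rewrite normr_gt0.
  rewrite -(ler_pM2r h1) -normrM -normrN.
  have -> : - ((- (h^-1 * (f (x + h) - f x)) + d) * h) = f (x + h) - f x - h * d.
    by field.
  exact: hd.
split; first by apply/cvg_ex; exists d.
exact: cvg_lim.
Unshelve. all: by end_near. Qed.

Lemma is_derive_quadratic (f : R -> R) (x d K : R) :
  (forall h, `|f (x + h) - f x - h * d| <= K * h ^+ 2) -> is_derive x (1 : R) f d.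
Proof.
move=> H; apply: is_derive_eps => eps eps0.
have K1 : 0 < `|K| + 1 by rewrite ltr_pwDr.
exists (eps / (`|K| + 1)); first exact: divr_gt0.
move=> h hlt; apply: (le_trans (H h)).
rewrite -(real_normK (num_real h)) expr2 mulrA ler_wpM2r//.
apply: (@le_trans _ _ ((`|K| + 1) * `|h|)).
  by rewrite ler_wpM2r// (le_trans (ler_norm K))// lerDl.
by rewrite mulrC -ler_pdivlMr// ltW.
Qed.

Lemma max0_continuous : continuous (fun x : R => Num.max 0 x).
Proof.
by move=> x; apply: continuous_max; [exact: cvg_cst|exact: cvg_id].
Qed.

End derivative_criterion.

Section space_functions.
Context {R : realType} {n : nat}.
Local Notation leb := (@lebesgue_cV R n).
Implicit Types (f g : 'cV[R]_n -> R) (u : 'cV[R]_n).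

Lemma coord_cV_continuous i : continuous (fun u => u i ord0 : R).
Proof. exact: coord_continuous. Qed.

Lemma continuous_sum (T : topologicalType) (I : Type) (r : seq I) (F : I -> T -> R) :
  (forall i, continuous (F i)) -> continuous (fun x => \sum_(i <- r) F i x).
Proof.
move=> cF x; apply: cvg_sum_seq => i; exact: cF.
Qed.

Lemma continuous_enorm_sqr : continuous (fun u => enorm u ^+ 2).
Proof.
under eq_fun do rewrite enorm_sqr; apply: continuous_sum => i.
by under eq_fun do rewrite expr2; apply: continuous_mul; exact: coord_cV_continuous.
Qed.

Lemma continuous_enorm : continuous (@enorm R n).
Proof.
rewrite (_ : @enorm R n = Num.sqrt \o (fun u => enorm u ^+ 2)); last first.
  by apply/funext => u /=; rewrite sqrtr_sqr ger0_norm// enorm_ge0.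
move=> u; apply: continuous_comp; first exact: continuous_enorm_sqr.
exact: sqrt_continuous.
Qed.

Lemma coord_le_enorm u i : `|u i ord0| <= enorm u.
Proof.
rewrite -(@ler_pXn2r _ 2) ?nnegrE ?enorm_ge0// enorm_sqr real_normK ?num_real//.
rewrite (bigD1 i)//= lerDl sumr_ge0// => j _; exact: sqr_ge0.
Qed.

(** A cube of columns is compact as the transpose of a cube of rows. *)
Lemma continuous_bounded_box (s t N : R) (g : R -> 'cV[R]_n -> R) :
  (forall tau u, s <= tau <= t ->
    {for (tau, u), continuous (fun p : R * 'cV[R]_n => g p.1 p.2)}) ->
  exists K : R, forall tau u, s <= tau <= t -> enorm u <= N -> `|g tau u| <= K.
Proof.
move=> cg.
pose B : set 'rV[R]_n := [set v | forall i, `[- N, N]%classic (v ord0 i)].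
have cB : compact B by apply: (@rV_compact _ _ (fun=> `[- N, N]%classic)) => _; exact: segment_compact.
pose tr (v : 'rV[R]_n) : 'cV[R]_n := v^T.
have ctr : continuous tr.
  move=> x A /nbhs_ballP[e /= e0 eA].
  apply: (filterS _ (nbhsx_ballx x e e0)) => w [_ h].
  by apply: eA; split=> // i j; rewrite !mxE; exact: h.
have cK : compact (`[s, t]%classic `*` (tr @` B)).
  apply: compact_setX; first exact: segment_compact.
  by apply: continuous_compact => //; exact: continuous_subspaceT.
have : compact ((fun p : R * 'cV[R]_n => g p.1 p.2) @` (`[s, t]%classic `*` (tr @` B))).
  apply: continuous_compact => //.
  apply: continuous_in_subspaceT => -[tau u] /= /set_mem[/= st _]; apply: cg.
  by move: st; rewrite in_itv.
move=> /compact_bounded[M [_ hM]]; exists (M + 1) => tau u st uN.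
apply: (hM (M + 1)); first by rewrite ltrDl.
exists (tau, u) => //=; split => /=; first by rewrite in_itv.
exists u^T; last by rewrite /tr trmxK.
move=> i /=; rewrite in_itv /= mxE -ler_norml; exact: (le_trans (coord_le_enorm _ _)).
Qed.

Lemma continuous_bounded_ball (N : R) f : continuous f ->
  exists K : R, forall u, enorm u <= N -> `|f u| <= K.
Proof.
move=> cf; have [tau u _|K hK] := @continuous_bounded_box 0 0 N (fun _ => f).
  by apply: (@continuous_comp _ _ _ snd f); [exact: cvg_snd|exact: cf].
by exists K => u; apply: (hK 0 u); rewrite lexx.
Qed.

Lemma measurable_enorm_ball (N : R) : measurable [set u : 'cV[R]_n | enorm u <= N].
Proof.
have := continuous_measurable_cV continuous_enorm measurableT (measurable_itv `]-oo, N]).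
by rewrite setTI (_ : _ @^-1` _ = [set u : 'cV[R]_n | enorm u <= N]).
Qed.

Lemma ball_finite_measure (N : R) : (leb [set u | (enorm u <= N)%R] < +oo)%E.
Proof.
pose A (i : 'I_n) : set R := `[- N, N]%classic.
have mA i : measurable (A i) by exact: measurable_itv.
apply: (@le_lt_trans _ _ (leb [set u | forall i, A i (u i ord0)])).
  apply: le_measure; rewrite ?inE.
  - exact: measurable_enorm_ball.
  - rewrite [X in measurable X](_ : _ = \bigcap_(i in [set: 'I_n])
      (fun v : 'cV[R]_n => v i ord0) @^-1` A i).
      apply: fin_bigcap_measurable => // i _.
      by rewrite -[X in measurable X]setTI; exact: measurable_coord.
    by apply/seteqP; split => v /= h i; [move=> _; exact: h|exact: h i I].
  - move=> u /= uN i; rewrite /A /= in_itv /= -ler_norml.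
    exact: (le_trans (coord_le_enorm _ _)).
have [c cE] : exists c : R, lebesgue_measure (`[- N, N]%classic : set R) = c%:E.
  rewrite lebesgue_measure_itv/=; case: ifP => _; last by exists 0.
  by exists (N - - N).
suff [r ->] : exists r : R, leb [set u | forall i, A i (u i ord0)] = r%:E.
  exact: ltry.
rewrite lebesgue_cV_box//; elim/big_rec : _ => [|i _ _ [r ->]]; first by exists 1.
by exists (c * r); rewrite /A cE.
Qed.

Lemma integrable_compact_support (N : R) f : continuous f ->
  (forall u, N < enorm u -> f u = 0) -> leb.-integrable setT (EFin \o f).
Proof.
move=> cf f0; have [K hK] := continuous_bounded_ball N cf.
have mB := measurable_enorm_ball N.
have mf : measurable_fun setT (EFin \o f).
  by apply/measurable_EFinP; exact: continuous_measurable_cV.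
apply/integrableP; split=> //.
apply: (@le_lt_trans _ _ (\int[leb]_(u in [set u : 'cV[R]_n | (enorm u <= N)%R]) `|K|%:E)%E).
  rewrite [leRHS]integral_mkcond; apply: ge0_le_integral => //.
  - exact: measurableT_comp.
  - by apply/(measurable_restrictT _ mB); exact: measurable_cst.
  - move=> u _; have [uN|uN] := leP (enorm u) N.
      by rewrite /patch mem_set//= lee_fin (le_trans (hK _ uN))// ler_norm.
    by rewrite /patch memNset /= ?f0 ?normr0// leNgt uN.
by rewrite integral_cst// lte_mul_pinfty// ball_finite_measure.
Qed.

End space_functions.

Section cutoff.
Context {R : realType} {n : nat}.
Implicit Types (u : 'cV[R]_n) (N : R).

(** A compactly supported [C^1] function, equal to [1] in the limit
    [N -> oo], whose gradient decays so fast that its product with [1 + |u|]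
    is bounded uniformly in [N]. *)
Definition cutoff N u : R := Num.max 0 (1 - enorm u ^+ 2 / N ^+ 2) ^+ 2.

Definition dcutoff N (i : 'I_n) u : R :=
  - (4 / N ^+ 2) * Num.max 0 (1 - enorm u ^+ 2 / N ^+ 2) * u i ord0.

Let pos_part_sqr_derive (x : R) :
  is_derive x (1 : R) (fun x : R => Num.max 0 x ^+ 2) (2 * Num.max 0 x).
Proof.
apply: (@is_derive_quadratic _ _ _ _ 1) => h.
by rewrite !maxEle; case: (leP 0 (x + h)) => a; case: (leP 0 x) => b; rewrite ler_norml; apply/andP;
  split; nra.
Qed.

Lemma cutoff_ge0 N u : 0 <= cutoff N u. Proof. exact: sqr_ge0. Qed.

Lemma cutoff_le1 N u : cutoff N u <= 1.
Proof.
rewrite /cutoff; apply: exprn_ile1; first by rewrite le_max lexx.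
by rewrite ge_max ler01 gerBl divr_ge0// sqr_ge0.
Qed.

Lemma cutoff_eq0 N u : 0 < N -> N < enorm u -> cutoff N u = 0.
Proof.
move=> N0 Nu; rewrite /cutoff (max_idPl _) ?expr0n// subr_le0.
by rewrite ler_pdivlMr ?exprn_gt0// mul1r ler_pXn2r ?nnegrE ?enorm_ge0// ltW.
Qed.

Lemma dcutoff_eq0 N i u : 0 < N -> N < enorm u -> dcutoff N i u = 0.
Proof.
move=> N0 Nu; rewrite /dcutoff (max_idPl _) ?mulr0 ?mul0r// subr_le0.
by rewrite ler_pdivlMr ?exprn_gt0// mul1r ler_pXn2r ?nnegrE ?enorm_ge0// ltW.
Qed.

Lemma dcutoff_bound N i u : 1 <= N -> (1 + enorm u) * `|dcutoff N i u| <= 8.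
Proof.
move=> N1; have N0 : 0 < N by lra.
have [Nu|uN] := ltP N (enorm u); first by rewrite dcutoff_eq0// normr0 mulr0.
rewrite /dcutoff !normrM normrN [`|4 / _|]ger0_norm ?divr_ge0 ?sqr_ge0//.
set m := Num.max _ _; have m1 : `|m| <= 1.
  by rewrite ger0_norm /m ?le_max ?lexx// ge_max ler01 gerBl divr_ge0 ?sqr_ge0.
have := coord_le_enorm u i; have := enorm_ge0 u; move: (enorm u) uN => e eN e0 ue.
apply: (@le_trans _ _ ((1 + N) * (4 / N ^+ 2 * 1 * N))).
  apply: ler_pM; [by lra|by rewrite !mulr_ge0// invr_ge0 sqr_ge0|by lra|].
  apply: ler_pM => //; last exact: le_trans eN.
    by rewrite !mulr_ge0// invr_ge0 sqr_ge0.
  by rewrite ler_wpM2l// divr_ge0 ?sqr_ge0.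
rewrite (_ : _ * _ = 4 * ((1 + N) / N)); last by field; lra.
suff : (1 + N) / N <= 2 by lra.
by rewrite ler_pdivrMr//; lra.
Qed.

Lemma is_derive_cutoff N i u :
  is_derive u (basis_vec i) (cutoff N) (dcutoff N i u).
Proof.
apply/is_derive_coord_line.
pose c := enorm u ^+ 2 / N ^+ 2.
have e h : enorm (u + h *: basis_vec i) ^+ 2 =
    enorm u ^+ 2 + h * (2 * u i ord0) + h ^+ 2.
  rewrite !enorm_sqr (bigD1 i)//= [in RHS](bigD1 i)//= !mxE eqxx mulr1.
  rewrite (eq_bigr (fun j => u j ord0 ^+ 2)); last first.
    by move=> j ji; rewrite !mxE (negbTE ji) mulr0 addr0.
  ring.
pose p (h : R) := 1 - (enorm u ^+ 2 + h * (2 * u i ord0) + h ^+ 2) / N ^+ 2.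
have dp : is_derive (0 : R) (1 : R) p (- (2 * u i ord0) / N ^+ 2).
  apply: (@is_derive_quadratic _ _ _ _ (`|N ^-2|)) => h.
  rewrite (_ : _ - _ - _ = - (h ^+ 2 * N ^-2)); last by rewrite /p; ring.
  by rewrite normrN normrM mulrC (ger0_norm (sqr_ge0 h)).
have := @is_derive1_comp _ (fun x : R => Num.max 0 x ^+ 2) p 0 _ _
  (pos_part_sqr_derive (p 0)) dp.
rewrite (_ : _ \o p = (fun h => cutoff N (u + h *: basis_vec i))); last first.
  by apply/funext => h; rewrite /cutoff e.
rewrite (_ : _ * _ = dcutoff N i u)//.
rewrite /dcutoff /p mul0r !addr0 expr0n addr0 /=; ring.
Qed.

Lemma continuous_cutoff_base N :
  continuous (fun u : 'cV[R]_n => Num.max 0 (1 - enorm u ^+ 2 / N ^+ 2)).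
Proof.
move=> u; apply: (@continuous_comp _ _ _
  (fun u : 'cV[R]_n => 1 - enorm u ^+ 2 / N ^+ 2)); last exact: max0_continuous.
apply: continuous_add; first exact: cst_continuous.
apply: continuous_opp; apply: continuous_mul; last exact: cst_continuous.
exact: continuous_enorm_sqr.
Qed.

Lemma continuous_cutoff N : continuous (@cutoff N).
Proof.
rewrite (_ : @cutoff N = fun u => Num.max 0 (1 - enorm u ^+ 2 / N ^+ 2) *
  Num.max 0 (1 - enorm u ^+ 2 / N ^+ 2)); last first.
  by apply/funext => u; rewrite /cutoff expr2.
by apply: continuous_mul; exact: continuous_cutoff_base.
Qed.

Lemma continuous_dcutoff N i : continuous (@dcutoff N i).
Proof.
apply: continuous_mul; last exact: coord_cV_continuous.
apply: continuous_mul; last exact: continuous_cutoff_base.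
exact: cst_continuous.
Qed.

Lemma cvg_invn_sqr (a : R) : a / (m.+1%:R ^+ 2) @[m --> \oo] --> (0 : R).
Proof.
rewrite -(mulr0 a); apply: cvgM; first exact: cvg_cst.
under eq_fun do rewrite expr2 invfM.
by rewrite -(mulr0 0); apply: cvgM; exact: cvg_harmonic.
Qed.

Lemma cvg_cutoff_base u :
  Num.max 0 (1 - enorm u ^+ 2 / m.+1%:R ^+ 2) @[m --> \oo] --> (1 : R).
Proof.
have h : 1 - enorm u ^+ 2 / m.+1%:R ^+ 2 @[m --> \oo] --> (1 - 0 : R).
  by apply: cvgB; [exact: cvg_cst|exact: cvg_invn_sqr].
have : Num.max 0 (1 - enorm u ^+ 2 / m.+1%:R ^+ 2) @[m --> \oo] --> Num.max 0 (1 - 0 : R).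
  by apply: (cvg_comp _ _ h); exact: max0_continuous.
by rewrite subr0 (max_idPr _).
Qed.

Lemma cvg_cutoff u : cutoff m.+1%:R u @[m --> \oo] --> (1 : R).
Proof.
pose X m : R := Num.max 0 (1 - enorm u ^+ 2 / m.+1%:R ^+ 2).
have h : X m * X m @[m --> \oo] --> (1 * 1 : R) by apply: cvgM; exact: cvg_cutoff_base.
by move: h; rewrite mulr1.
Qed.

Lemma cvg_dcutoff i u : dcutoff m.+1%:R i u @[m --> \oo] --> (0 : R).
Proof.
pose X m : R := Num.max 0 (1 - enorm u ^+ 2 / m.+1%:R ^+ 2).
have h : - (4 / m.+1%:R ^+ 2) * X m * u i ord0 @[m --> \oo] --> (- 0 * 1 * u i ord0 : R).
  apply: cvgM; last exact: cvg_cst.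
  apply: cvgM; last exact: cvg_cutoff_base.
  by apply: cvgN; exact: cvg_invn_sqr.
by move: h; rewrite oppr0 !mul0r.
Qed.

End cutoff.

(** * The flux tested against functions of the position *)

Section real_integrals.
Context d (T : measurableType d) (R : realType) (mu : {measure set T -> \bar R}).

Lemma Rintegral_sum (I : Type) (s : seq I) (f : I -> T -> R) :
  (forall i, mu.-integrable setT (EFin \o f i)) ->
  mu.-integrable setT (EFin \o (fun x => \sum_(i <- s) f i x)) /\
  \int[mu]_x (\sum_(i <- s) f i x) = \sum_(i <- s) \int[mu]_x f i x.
Proof.
move=> fi; elim: s => [|a s [ih1 ih2]].
  under eq_fun do rewrite big_nil; split; first exact: integrable0.
  by rewrite big_nil /Rintegral integral0_eq.
have e : (fun x => \sum_(i <- a :: s) f i x) = (fun x => f a x + \sum_(i <- s) f i x).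
  by apply/funext => x; rewrite big_cons.
rewrite e; split; last by rewrite big_cons -ih2 -RintegralD.
exact: (integrableD measurableT (fi a) ih1).
Qed.

Lemma integrable_le (f g : T -> R) : measurable_fun setT f ->
  (forall x, `|f x| <= g x) -> mu.-integrable setT (EFin \o g) ->
  mu.-integrable setT (EFin \o f).
Proof.
move=> mf fg ig; apply: (le_integrable measurableT _ _ ig).
  exact/measurable_EFinP.
by move=> x _ /=; rewrite lee_fin (le_trans (fg x))// ler_norm.
Qed.

Lemma integrable_cstM (k : R) (f : T -> R) : mu.-integrable setT (EFin \o f) ->
  mu.-integrable setT (EFin \o (fun x => k * f x)).
Proof.
move=> fi; rewrite (_ : _ \o _ = (fun x => k%:E * (EFin \o f) x)%E)//.
exact: integrableZl.
Qed.

Lemma integrable_add (f g : T -> R) : mu.-integrable setT (EFin \o f) ->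
  mu.-integrable setT (EFin \o g) -> mu.-integrable setT (EFin \o (fun x => f x + g x)).
Proof.
move=> fi gi; rewrite (_ : _ \o _ = (fun x => (EFin \o f) x + (EFin \o g) x)%E)//.
exact: integrableD.
Qed.

Lemma integrable_sub (f g : T -> R) : mu.-integrable setT (EFin \o f) ->
  mu.-integrable setT (EFin \o g) -> mu.-integrable setT (EFin \o (fun x => f x - g x)).
Proof.
move=> fi gi; rewrite (_ : _ \o _ = (fun x => (EFin \o f) x - (EFin \o g) x)%E)//.
exact: integrableB.
Qed.

Lemma integrable_measurable (f : T -> R) : mu.-integrable setT (EFin \o f) ->
  measurable_fun setT f.
Proof. by move=> /integrableP[/measurable_EFinP]. Qed.

Lemma Rintegral_dominated (f_ : nat -> T -> R) (f g : T -> R) :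
  (forall m, measurable_fun setT (f_ m)) ->
  (forall x, f_ m x @[m --> \oo] --> f x) ->
  (forall m x, `|f_ m x| <= g x) -> mu.-integrable setT (EFin \o g) ->
  mu.-integrable setT (EFin \o f) /\
  (\int[mu]_x f_ m x) @[m --> \oo] --> \int[mu]_x f x.
Proof.
move=> mf_ cf fg ig.
have mf : measurable_fun setT f.
  by apply: (measurable_fun_cvg mf_) => x _; exact: cf.
have [] := @dominated_convergence _ _ _ mu setT measurableT
  (fun m => EFin \o f_ m) (EFin \o f) (EFin \o g).
- by move=> m; exact/measurable_EFinP.
- exact/measurable_EFinP.
- by apply: aeW => x _; apply: cvg_EFin; [exact: nearW|exact: cf].
- by [].
- by apply: aeW => x m _ /=; rewrite lee_fin.
move=> fi _ c; split=> //.
apply: fine_cvg; rewrite fineK//; exact: integrable_fin_num.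
Qed.

Lemma Rintegral_abs_le (f g : T -> R) : measurable_fun setT f ->
  (forall x, `|f x| <= g x) -> mu.-integrable setT (EFin \o g) ->
  `|\int[mu]_x f x| <= \int[mu]_x g x.
Proof.
move=> mf fg ig; have fi := integrable_le mf fg ig.
apply: (le_trans (le_normr_Rintegral measurableT fi)).
apply: le_Rintegral => //.
by apply: (integrable_le _ _ ig) => [|x]; [exact: measurableT_comp|rewrite normr_id].
Qed.

End real_integrals.

Section fixed_time.
Context {R : realType} {n : nat}.
Local Notation leb := (@lebesgue_cV R n).
Variables (r : 'cV[R]_n -> R) (r1 : 'I_n -> 'cV[R]_n -> R).
Variable r2 : 'I_n -> 'I_n -> 'cV[R]_n -> R.
Hypothesis r_cont : continuous r.
Hypothesis r1_cont : forall j, continuous (r1 j).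
Hypothesis r2_cont : forall i j, continuous (r2 i j).
Hypothesis r_derive : forall i u, is_derive u (basis_vec i) r (r1 i u).
Hypothesis r1_derive : forall i j u, is_derive u (basis_vec i) (r1 j) (r2 i j u).
Variables (C B : 'M[R]_n) (m0 : 'cV[R]_n).

(** [r], [r1] and [r2] stand for a density and its derivatives at a fixed time,
    [C] for its covariance. When the potential has gradient [B (u - m0)], the
    equation reads [d_t r = div flux]. *)
Definition drift (i : 'I_n) (u : 'cV[R]_n) : R := (C *m (B *m (u - m0))) i ord0.

Definition flux i u : R := r u * drift i u + \sum_j C i j * r1 j u.

Definition dflux i u : R :=
  (r1 i u * drift i u + r u * (C *m B) i i) + \sum_j C i j * r2 i j u.

Lemma driftE i u : drift i u = \sum_k (C *m B) i k * (u k ord0 - m0 k ord0).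
Proof.
by rewrite /drift mulmxA mxE; apply: eq_bigr => k _; rewrite !mxE.
Qed.

Lemma continuous_drift i : continuous (drift i).
Proof.
rewrite (_ : drift i = fun u => \sum_k (C *m B) i k * (u k ord0 - m0 k ord0)); last first.
  by apply/funext => u; rewrite driftE.
apply: continuous_sum => k.
apply: continuous_mul; first exact: cst_continuous.
by apply: continuous_add; [exact: coord_cV_continuous|exact: cst_continuous].
Qed.

Lemma drift_line i u h v : drift i (u + h *: v) = drift i u + h * (C *m B *m v) i ord0.
Proof. rewrite /drift addrAC !mulmxDr mxE; congr (_ + _).
by rewrite -!scalemxAr mulmxA mxE. Qed.

Lemma is_derive_drift i u : is_derive u (basis_vec i) (drift i) ((C *m B) i i).
Proof.
apply/is_derive_coord_line; apply: (@is_derive_quadratic _ _ _ _ 0) => h.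
rewrite add0r !drift_line mul0r addr0 mul0r.
rewrite (_ : (C *m B *m basis_vec i) i ord0 = (C *m B) i i); last first.
  rewrite mxE (bigD1 i)//= big1 => [|k ki]; rewrite !mxE ?eqxx ?mulr1 ?addr0//.
  by rewrite (negbTE ki) mulr0.
by rewrite [X in `|X|](_ : _ = 0) ?normr0//; ring.
Qed.

Lemma continuous_flux i : continuous (flux i).
Proof.
apply: continuous_add; first by apply: continuous_mul => //; exact: continuous_drift.
apply: continuous_sum => j; apply: continuous_mul => //; exact: cst_continuous.
Qed.

Lemma continuous_dflux i : continuous (dflux i).
Proof.
apply: continuous_add.
  apply: continuous_add; first by apply: continuous_mul => //; exact: continuous_drift.
  by apply: continuous_mul => //; exact: cst_continuous.
apply: continuous_sum => j; apply: continuous_mul => //; exact: cst_continuous.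
Qed.

Lemma is_derive_flux i u : is_derive u (basis_vec i) (flux i) (dflux i u).
Proof.
have h1 := is_deriveM (r_derive i u) (is_derive_drift i u).
have h2 : is_derive u (basis_vec i) (\sum_(j < n) (fun v => C i j * r1 j v))
    (\sum_(j < n) C i j * r2 i j u).
  by apply: is_derive_sum => j; exact: (is_deriveZ (C i j) (r1_derive i j u)).
have h := is_deriveD h1 h2.
rewrite (_ : flux i = r * drift i + \sum_(j < n) (fun v => C i j * r1 j v)); last first.
  apply/funext => v; rewrite /flux /GRing.add /= /GRing.mul /=; congr (_ + _).
  by elim/big_rec2 : _ => // j x y _ ->.
apply: (is_derive_eq h); rewrite /dflux; congr (_ + _).
by rewrite /GRing.scale /= addrC; congr (_ + _); exact: mulrC.
Qed.

(** Compact support removes every condition at infinity. *)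
Lemma divergence_test (N : R) (phi : 'cV[R]_n -> R) (dphi : 'I_n -> 'cV[R]_n -> R) :
  continuous phi -> (forall i, continuous (dphi i)) ->
  (forall i u, is_derive u (basis_vec i) phi (dphi i u)) ->
  (forall u, N < enorm u -> phi u = 0) ->
  (forall i u, N < enorm u -> dphi i u = 0) ->
  \int[leb]_u ((\sum_i dflux i u) * phi u) =
  - \int[leb]_u (\sum_i flux i u * dphi i u).
Proof.
move=> cphi cdphi dp p0 dp0.
have i1 i : leb.-integrable setT (EFin \o (fun u => dflux i u * phi u)).
  apply: (@integrable_compact_support _ _ N).
    by apply: continuous_mul => //; exact: continuous_dflux.
  by move=> u /p0 ->; rewrite mulr0.
have i2 i : leb.-integrable setT (EFin \o (fun u => flux i u * dphi i u)).
  apply: (@integrable_compact_support _ _ N).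
    by apply: continuous_mul => //; exact: continuous_flux.
  by move=> u /dp0 ->; rewrite mulr0.
rewrite (_ : (fun u => _ * phi u) = (fun u => \sum_i dflux i u * phi u)); last first.
  by apply/funext => u; rewrite mulr_suml.
rewrite (Rintegral_sum _ i1).2 (Rintegral_sum _ i2).2 -sumrN; apply: eq_bigr => i _.
apply: (integral_by_parts (is_derive_flux i) (dp i)) => //.
- exact: continuous_flux.
- exact: continuous_dflux.
- apply: (@integrable_compact_support _ _ N).
    by apply: continuous_mul => //; exact: continuous_flux.
  by move=> u /p0 ->; rewrite mulr0.
- exact: i1.
- exact: i2.
Qed.

Variables (gn : 'cV[R]_n -> R) (Kb Mc K : R).
Hypothesis Kb_ge0 : 0 <= Kb.
Hypothesis Mc_ge0 : 0 <= Mc.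
Hypothesis gn_ge0 : forall u, 0 <= gn u.
Hypothesis r_ge0 : forall u, 0 <= r u.
Hypothesis r1_le : forall j u, `|r1 j u| <= gn u.
Hypothesis C_le : forall i j, `|C i j| <= Mc.
Hypothesis drift_le : forall i u, `|drift i u| <= Kb * (1 + enorm u).
Hypothesis r_int : leb.-integrable setT (EFin \o (fun u => (1 + enorm u) ^+ 2 * r u)).
Hypothesis gn_int : leb.-integrable setT (EFin \o (fun u => (1 + enorm u) * gn u)).

(* [psi] stands for a test function at the time considered, [psit] for its time
   derivative, [p] for its gradient and [H] for its Hessian. *)
Variables (psi psit : 'cV[R]_n -> R) (p : 'I_n -> 'cV[R]_n -> R).
Variable H : 'I_n -> 'I_n -> 'cV[R]_n -> R.
Hypothesis psi_cont : continuous psi.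
Hypothesis psit_cont : continuous psit.
Hypothesis p_cont : forall i, continuous (p i).
Hypothesis H_cont : forall i j, continuous (H i j).
Hypothesis psi_derive : forall i u, is_derive u (basis_vec i) psi (p i u).
Hypothesis p_derive : forall i j u, is_derive u (basis_vec j) (p i) (H i j u).
Hypothesis psi_le : forall u, `|psi u| <= K * (1 + enorm u) ^+ 2.
Hypothesis psit_le : forall u, `|psit u| <= K * (1 + enorm u) ^+ 2.
Hypothesis p_le : forall i u, `|p i u| <= K * (1 + enorm u).
Hypothesis H_le : forall i j u, `|H i j u| <= K * (1 + enorm u) ^+ 2.

(** What the density is paired with once all derivatives have been moved onto the
    test function: its time derivative plus the adjoint of the Fokker-Planck
    operator. *)
Definition generator (u : 'cV[R]_n) : R :=
  psit u - \sum_i drift i u * p i u + \sum_i \sum_j C i j * H i j u.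

Definition dominating (u : 'cV[R]_n) : R :=
  (1 + enorm u) ^+ 2 * r u + (1 + enorm u) * gn u.

Definition dominating_cst : R := K * (1 + 9 * n%:R * Kb + 9 * n%:R ^+ 2 * Mc).

Let e1 (u : 'cV[R]_n) : 1 <= 1 + enorm u.
Proof. by rewrite lerDl enorm_ge0. Qed.

Let K_ge0 : 0 <= K.
Proof.
have := psi_le 0; have := normr_ge0 (psi 0) => a b; have := le_trans a b.
by rewrite pmulr_lge0// exprn_gt0// (lt_le_trans ltr01 (e1 0)).
Qed.

Lemma integrable_dominating : leb.-integrable setT (EFin \o dominating).
Proof. exact: integrable_add. Qed.

Definition cut_flux (N : R) u : R :=
  r u * (psit u * cutoff N u)
  - \sum_i flux i u * (p i u * cutoff N u + psi u * dcutoff N i u).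

(** Uniform in [N], because the gradient of the cutoff is absorbed by one factor
    [1 + |u|]. This bound dominates the passage to the limit both in space and
    in time. *)
Lemma cut_flux_le N u : 1 <= N -> `|cut_flux N u| <= dominating_cst * dominating u.
Proof.
move=> N1; rewrite /cut_flux /dominating_cst /dominating.
have c0 := cutoff_ge0 N u; have c1 := cutoff_le1 N u.
have re := r_ge0 u; set e := 1 + enorm u.
have e_ge1 : 1 <= e := e1 u.
have t i : `|p i u * cutoff N u + psi u * dcutoff N i u| <= 9 * K * e.
  apply: (le_trans (ler_normD _ _)); rewrite (normrM (p i u)) (normrM (psi u)).
  have h1 : `|p i u| * `|cutoff N u| <= K * e * 1.
    by apply: ler_pM => //; rewrite ger0_norm.
  have h2 : `|psi u| * `|dcutoff N i u| <= K * e * 8.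
    apply: (@le_trans _ _ (K * e ^+ 2 * `|dcutoff N i u|)).
      by rewrite ler_wpM2r//; exact: psi_le.
    rewrite expr2 -!mulrA ler_wpM2l// mulrA [e * e]mulrC -mulrA ler_wpM2l//; first lra.
    exact: dcutoff_bound.
  lra.
have fl i : `|flux i u| <= r u * (Kb * e) + n%:R * (Mc * gn u).
  rewrite /flux; apply: (le_trans (ler_normD _ _)); apply: lerD.
    by rewrite normrM (ger0_norm re) ler_wpM2l//; exact: drift_le.
  apply: (le_trans (ler_norm_sum _ _ _)).
  rewrite (_ : n%:R * _ = \sum_(j < n) Mc * gn u); last first.
    by rewrite sumr_const card_ord mulr_natl.
  apply: ler_sum => j _; rewrite normrM; apply: ler_pM => //.
apply: (le_trans (ler_normB _ _)).
have a1 : `|r u * (psit u * cutoff N u)| <= K * (e ^+ 2 * r u).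
  rewrite normrM (ger0_norm re) normrM mulrC.
  rewrite (_ : K * _ = K * e ^+ 2 * 1 * r u); last by ring.
  by rewrite ler_wpM2r//; apply: ler_pM => //; rewrite ger0_norm.
have a2 : `|\sum_i flux i u * (p i u * cutoff N u + psi u * dcutoff N i u)| <=
    n%:R * ((r u * (Kb * e) + n%:R * (Mc * gn u)) * (9 * K * e)).
  apply: (le_trans (ler_norm_sum _ _ _)).
  rewrite (_ : n%:R * _ = \sum_(j < n) ((r u * (Kb * e) + n%:R * (Mc * gn u)) * (9 * K * e))); last first.
    by rewrite sumr_const card_ord mulr_natl.
  by apply: ler_sum => j _; rewrite normrM; apply: ler_pM.
apply: (le_trans (lerD a1 a2)).
set N' : R := n%:R; have N'0 : 0 <= N' by rewrite ler0n.
rewrite -subr_ge0 (_ : _ - _ = K * (e * gn u * (1 + 9 * N' * Kb) + 9 * N' ^+ 2 * Mc * (e ^+ 2 * r u))); last by ring.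
have e0 : 0 <= e by lra.
by rewrite mulr_ge0// addr_ge0// !mulr_ge0// ?addr_ge0 ?mulr_ge0 ?sqr_ge0.
Qed.

Lemma measurable_cut_flux N : measurable_fun setT (cut_flux N).
Proof.
apply: continuous_measurable_cV; rewrite /cut_flux; apply: continuous_add.
  by do 2 apply: continuous_mul => //; exact: continuous_cutoff.
apply: continuous_opp; apply: continuous_sum => i.
apply: continuous_mul; first exact: continuous_flux.
apply: continuous_add; apply: continuous_mul => //; first exact: continuous_cutoff.
exact: continuous_dcutoff.
Qed.

Lemma integral_cut_flux N : 0 < N ->
  \int[leb]_u ((\sum_i dflux i u * psi u + r u * psit u) * cutoff N u) =
  \int[leb]_u cut_flux N u.
Proof.
move=> N0.
have dp i u : is_derive u (basis_vec i) (psi * @cutoff R n N)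
    (p i u * cutoff N u + psi u * dcutoff N i u).
  have h := is_deriveM (psi_derive i u) (is_derive_cutoff N i u).
  by apply: (is_derive_eq h); rewrite /GRing.scale /= addrC [X in X + _]mulrC.
have ct := @continuous_cutoff R n N; have cdt i := @continuous_dcutoff R n N i.
have cJ := continuous_flux; have cdJ := continuous_dflux.
have D := @divergence_test N (fun u => psi u * cutoff N u)
  (fun i u => p i u * cutoff N u + psi u * dcutoff N i u)
  (continuous_mul psi_cont ct)
  (fun i => continuous_add (continuous_mul (@p_cont i) ct) (continuous_mul psi_cont (cdt i)))
  dp.
have i1 : leb.-integrable setT (EFin \o (fun u => r u * (psit u * cutoff N u))).
  apply: (@integrable_compact_support _ _ N).
    by do 2 apply: continuous_mul => //.
  by move=> u Nu; rewrite cutoff_eq0// !mulr0.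
have i2 : leb.-integrable setT (EFin \o (fun u => (\sum_i dflux i u) * (psi u * cutoff N u))).
  apply: (@integrable_compact_support _ _ N).
    apply: continuous_mul; first by apply: continuous_sum => i; exact: cdJ.
    exact: continuous_mul.
  by move=> u Nu; rewrite cutoff_eq0// !mulr0.
have i3 : leb.-integrable setT (EFin \o (fun u => \sum_i flux i u *
    (p i u * cutoff N u + psi u * dcutoff N i u))).
  apply: (@integrable_compact_support _ _ N).
    apply: continuous_sum => i; apply: continuous_mul; first exact: cJ.
    by apply: continuous_add; exact: continuous_mul.
  move=> u Nu; apply: big1 => i _.
  by rewrite cutoff_eq0// dcutoff_eq0// !mulr0 addr0 mulr0.
rewrite /cut_flux RintegralB// -D; last 2 first.
- by move=> u Nu; rewrite cutoff_eq0// mulr0.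
- by move=> i u Nu; rewrite cutoff_eq0// dcutoff_eq0// !mulr0 addr0.
rewrite addrC -RintegralD//; congr (Rintegral _ _ _); apply/funext => u.
by rewrite -mulr_suml; ring.
Qed.

(** The second integration by parts takes place without cutoff: every term is
    integrable, by the moment of [r] and the decay of its gradient. *)
Lemma integral_generator :
  \int[leb]_u (r u * psit u - \sum_i flux i u * p i u) =
  \int[leb]_u (r u * generator u).
Proof.
have cb := continuous_drift.
have e_ge0 (u : 'cV[R]_n) : 0 <= 1 + enorm u by rewrite (le_trans ler01 (e1 u)).
have dom (f : 'cV[R]_n -> R) k : continuous f ->
    (forall u, `|f u| <= k * ((1 + enorm u) ^+ 2 * r u)) -> leb.-integrable setT (EFin \o f).
  move=> cf fk; apply: (integrable_le _ fk); first exact: continuous_measurable_cV.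
  exact: integrable_cstM.
have i1 : leb.-integrable setT (EFin \o (fun u => r u * psit u)).
  apply: (dom _ K); first exact: continuous_mul.
  move=> u; rewrite normrM (ger0_norm (r_ge0 u)) mulrA mulrC ler_wpM2r//; exact: psit_le.
have i2 i : leb.-integrable setT (EFin \o (fun u => r u * (drift i u * p i u))).
  apply: (dom _ (Kb * K)); first by apply: continuous_mul => //; exact: continuous_mul.
  move=> u; rewrite normrM (ger0_norm (r_ge0 u)) mulrA mulrC ler_wpM2r// normrM.
  rewrite (_ : _ * _ ^+ 2 = Kb * (1 + enorm u) * (K * (1 + enorm u))); last by ring.
  by apply: ler_pM.
have i3 i j : leb.-integrable setT (EFin \o (fun u => r u * H i j u)).
  apply: (dom _ K); first exact: continuous_mul.
  move=> u; rewrite normrM (ger0_norm (r_ge0 u)) mulrA mulrC ler_wpM2r//; exact: H_le.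
have i4 i j : leb.-integrable setT (EFin \o (fun u => r1 j u * p i u)).
  apply: (integrable_le (g := fun u => K * ((1 + enorm u) * gn u))).
  - by apply: continuous_measurable_cV; exact: continuous_mul.
  - move=> u; rewrite normrM mulrC mulrA; apply: ler_pM => //.
  - exact: integrable_cstM.
have i5 i : leb.-integrable setT (EFin \o (fun u => r u * p i u)).
  apply: (dom _ K); first exact: continuous_mul.
  move=> u; rewrite normrM (ger0_norm (r_ge0 u)) mulrA mulrC ler_wpM2r//.
  apply: (le_trans (p_le i u)); rewrite ler_wpM2l// expr2 ler_peMr//.
have ibp i j : \int[leb]_u (r1 j u * p i u) = - \int[leb]_u (r u * H i j u).
  by apply: (integral_by_parts (r_derive j) (p_derive i j)) => //; [exact: i5|exact: i4|exact: i3].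
have s4 i : leb.-integrable setT (EFin \o (fun u => \sum_j C i j * (r1 j u * p i u))).
  by apply: (Rintegral_sum _ _).1 => j; exact: integrable_cstM.
have s3 i : leb.-integrable setT (EFin \o (fun u => \sum_j C i j * (r u * H i j u))).
  by apply: (Rintegral_sum _ _).1 => j; exact: integrable_cstM.
have E i : \int[leb]_u (flux i u * p i u) =
    \int[leb]_u (r u * (drift i u * p i u) - \sum_j C i j * (r u * H i j u)).
  rewrite (_ : (fun u => flux i u * p i u) =
    (fun u => r u * (drift i u * p i u) + \sum_j C i j * (r1 j u * p i u))); last first.
    apply/funext => u; rewrite /flux mulrDl mulrA; congr (_ + _).
    by rewrite mulr_suml; apply: eq_bigr => j _; rewrite mulrA.
  rewrite RintegralD// RintegralB//; congr (_ + _).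
  rewrite (Rintegral_sum _ (fun j => integrable_cstM _ (i4 i j))).2.
  rewrite (Rintegral_sum _ (fun j => integrable_cstM _ (i3 i j))).2 -sumrN.
  apply: eq_bigr => j _; rewrite RintegralZl// [in RHS]RintegralZl//.
  by rewrite ibp mulrN.
have i6 i : leb.-integrable setT (EFin \o (fun u => flux i u * p i u)).
  rewrite (_ : (fun u => flux i u * p i u) =
    (fun u => r u * (drift i u * p i u) + \sum_j C i j * (r1 j u * p i u))); last first.
    apply/funext => u; rewrite /flux mulrDl mulrA; congr (_ + _).
    by rewrite mulr_suml; apply: eq_bigr => j _; rewrite mulrA.
  exact: integrable_add.
have i7 i : leb.-integrable setT (EFin \o (fun u =>
    r u * (drift i u * p i u) - \sum_j C i j * (r u * H i j u))).
  exact: integrable_sub.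
rewrite RintegralB//; last exact: (Rintegral_sum _ i6).1.
rewrite (Rintegral_sum _ i6).2 (eq_bigr _ (fun i _ => E i)) -(Rintegral_sum _ i7).2.
rewrite -RintegralB//; last exact: (Rintegral_sum _ i7).1.
congr (Rintegral _ _ _); apply/funext => u; rewrite /generator.
rewrite sumrB opprB -mulr_sumr mulrDr mulrBr addrA [in RHS]addrAC; congr (_ + _).
congr (_ + _); rewrite mulr_sumr; apply: eq_bigr => i _; rewrite mulr_sumr; apply: eq_bigr => j _; ring.
Qed.

Lemma integral_cut_flux_cvg :
  (\int[leb]_u cut_flux m.+1%:R u) @[m --> \oo] --> \int[leb]_u (r u * generator u).
Proof.
rewrite -integral_generator.
apply: (Rintegral_dominated (g := fun u => dominating_cst * dominating u) _ _ _ _).2.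
- by move=> m; exact: measurable_cut_flux.
- move=> u; rewrite /cut_flux; apply: cvgB.
    rewrite -{2}(mulr1 (psit u)); apply: cvgM; first exact: cvg_cst.
    by apply: cvgM; [exact: cvg_cst|exact: cvg_cutoff].
  apply: cvg_sum_seq => i; apply: cvgM; first exact: cvg_cst.
  have h : p i u * cutoff m.+1%:R u + psi u * dcutoff m.+1%:R i u @[m --> \oo]
      --> p i u * 1 + psi u * 0.
    apply: cvgD; apply: cvgM; first exact: cvg_cst.
    - exact: cvg_cutoff.
    - exact: cvg_cst.
    - exact: cvg_dcutoff.
  by move: h; rewrite mulr1 mulr0 addr0.
- by move=> m u; apply: cut_flux_le; rewrite ler1n.
- by apply: integrable_cstM; exact: integrable_dominating.
Qed.

End fixed_time.

(** * Test functions of space and time *)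

Section moments_of_densities.
Context {R : realType} {n : nat}.
Local Notation leb := (@lebesgue_cV R n).

Lemma weight_sqr_le (e : R) : (1 + e) ^+ 2 <= 2 + 2 * e ^+ 2.
Proof. by rewrite -subr_ge0 (_ : _ - _ = (1 - e) ^+ 2) ?sqr_ge0//; ring. Qed.

Lemma measurable_enorm : measurable_fun setT (@enorm R n).
Proof. by apply: continuous_measurable_cV; exact: continuous_enorm. Qed.

Lemma continuous_weight : continuous (fun u : 'cV[R]_n => 1 + enorm u).
Proof. by apply: continuous_add; [exact: cst_continuous|exact: continuous_enorm]. Qed.

Lemma continuous_weight_sqr : continuous (fun u : 'cV[R]_n => (1 + enorm u) ^+ 2).
Proof.
rewrite (_ : (fun u => _) = fun u : 'cV[R]_n => (1 + enorm u) * (1 + enorm u)).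
  by apply: continuous_mul; exact: continuous_weight.
by apply/funext => u; rewrite expr2.
Qed.

Lemma integral_weight_sqr (f : 'cV[R]_n -> R) (M : R) : prob_density f ->
  (second_moment f <= M%:E)%E ->
  (\int[leb]_u ((1 + enorm u) ^+ 2 * f u)%:E <= (2 + 2 * M)%:E)%E.
Proof.
move=> [mf f0 f1] fM; have me := measurable_enorm.
have m2 : measurable_fun setT (fun u : 'cV[R]_n => (enorm u ^+ 2 * f u)%:E).
  apply/measurable_EFinP; apply: measurable_funM => //.
  exact: measurable_funX.
apply: (@le_trans _ _ (\int[leb]_u (2%:E * (f u)%:E + 2%:E * (enorm u ^+ 2 * f u)%:E))%E).
  apply: ge0_le_integral => //.
  - by move=> u _; rewrite lee_fin mulr_ge0// sqr_ge0.
  - apply/measurable_EFinP; apply: measurable_funM => //.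
    by apply: measurable_funX; apply: measurable_funD.
  - by apply: emeasurable_funD; apply: measurable_funeM => //; exact/measurable_EFinP.
  - move=> u _; rewrite -!EFinM -EFinD lee_fin mulrA -mulrDl ler_wpM2r//.
    exact: weight_sqr_le.
rewrite ge0_integralD//; last 4 first.
- by move=> u _; rewrite -EFinM lee_fin mulr_ge0.
- by apply: measurable_funeM; exact/measurable_EFinP.
- by move=> u _; rewrite -EFinM lee_fin; apply: mulr_ge0 => //; rewrite mulr_ge0 ?sqr_ge0.
- exact: measurable_funeM.
have p1 u : [set: 'cV[R]_n] u -> (0 <= (f u)%:E)%E by rewrite lee_fin.
have p2 u : [set: 'cV[R]_n] u -> (0 <= (enorm u ^+ 2 * f u)%:E)%E.
  by rewrite lee_fin mulr_ge0// sqr_ge0.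
have mfE : measurable_fun setT (fun u => (f u)%:E) by exact/measurable_EFinP.
rewrite !ge0_integralZl_EFin//.
rewrite f1 mule1 [in leRHS]EFinD; apply: leeD => //.
by rewrite [in leRHS]EFinM; apply: lee_wpmul2l.
Qed.

Lemma integrable_weight_sqr (f : 'cV[R]_n -> R) : prob_density f ->
  (second_moment f < +oo)%E ->
  leb.-integrable setT (EFin \o (fun u => (1 + enorm u) ^+ 2 * f u)).
Proof.
move=> df fM; have [mf f0 f1] := df.
have S0 : (0 <= second_moment f)%E.
  by apply: integral_ge0 => u _; rewrite lee_fin mulr_ge0// sqr_ge0.
have [M SM] : exists M : R, second_moment f = M%:E.
  by exists (fine (second_moment f)); rewrite fineK// ge0_fin_numE.
apply/integrableP; split.
  apply/measurable_EFinP; apply: measurable_funM => //.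
  by apply: measurable_funX; apply: measurable_funD => //; exact: measurable_enorm.
rewrite (eq_integral (fun u => ((1 + enorm u) ^+ 2 * f u)%:E)); last first.
  by move=> u _; rewrite /= ger0_norm// mulr_ge0// sqr_ge0.
apply: (le_lt_trans (integral_weight_sqr df _)); last exact: (ltry (2 + 2 * M)).
by rewrite SM.
Qed.

End moments_of_densities.

Section weak_formulation.
Context {R : realType} {n : nat}.
Local Notation leb := (@lebesgue_cV R n).
Local Notation mu := (@lebesgue_measure R).
Variables (rho : R -> 'cV[R]_n -> R) (C : R -> 'M[R]_n) (B : 'M[R]_n) (m0 : 'cV[R]_n).
Variables (T M Mc : R).
Hypothesis T_gt0 : 0 < T.
Hypothesis rho_reg : classical_regularity rho.
Hypothesis rho_dens : forall t, 0 <= t -> prob_density (rho t).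
Hypothesis rho_mom : forall t, 0 <= t <= T -> (second_moment (rho t) <= M%:E)%E.
Hypothesis rho_grad : (\int[mu]_(t in `]0%R, T[%classic) \int[leb]_u
     ((1 + enorm u) * enorm (gradient (rho t) u))%:E < +oo)%E.
Hypothesis Mc_ge0 : 0 <= Mc.
Hypothesis C_le : forall t i j, 0 < t < T -> `|C t i j| <= Mc.
Local Notation "'drho' t" := (fun j => partial j (rho t)) (at level 10, t at level 8).
Local Notation "'ddrho' t" := (fun i j => partial i (partial j (rho t))) (at level 10, t at level 8).
Hypothesis rho_eq : forall t u, 0 < t -> time_derivative rho t u =
  \sum_i dflux (rho t) (drho t) (ddrho t) (C t) B m0 i u.

Definition drift_cst : R :=
  n%:R * (Mc * \sum_i \sum_j `|B i j|) * (1 + enorm m0).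

Lemma drift_cst_ge0 : 0 <= drift_cst.
Proof.
have e := enorm_ge0 m0.
by rewrite !mulr_ge0 ?addr_ge0// sumr_ge0// => i _; exact: sumr_ge0.
Qed.

Lemma drift_le_cst t i u : 0 < t < T -> `|drift (C t) B m0 i u| <= drift_cst * (1 + enorm u).
Proof.
move=> tT; rewrite driftE; apply: (le_trans (ler_norm_sum _ _ _)).
have -> : drift_cst * (1 + enorm u) = \sum_(k < n)
    (Mc * \sum_i \sum_j `|B i j|) * ((1 + enorm m0) * (1 + enorm u)).
  by rewrite sumr_const card_ord -mulr_natl /drift_cst; ring.
apply: ler_sum => k _; rewrite normrM; apply: ler_pM => //.
  rewrite mxE; apply: (le_trans (ler_norm_sum _ _ _)); rewrite mulr_sumr.
  apply: ler_sum => j _; rewrite normrM; apply: ler_pM => //; first exact: C_le.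
  by rewrite (bigD1 k)//= lerDl sumr_ge0.
apply: (le_trans (ler_normB _ _)).
have := coord_le_enorm u k; have := coord_le_enorm m0 k.
have := enorm_ge0 u; have := enorm_ge0 m0; nra.
Qed.

Let spacetime_continuous (f : R -> 'cV[R]_n -> R) : Prop := forall t u, 0 < t < T ->
  {for (t, u), continuous (fun p : R * 'cV[R]_n => f p.1 p.2)}.

Lemma slice_continuous (f : R -> 'cV[R]_n -> R) t :
  (forall u, {for (t, u), continuous (fun p : R * 'cV[R]_n => f p.1 p.2)}) ->
  continuous (f t).
Proof.
move=> cf u; apply: (@continuous_comp _ _ _ (fun v => (t, v))
  (fun p : R * 'cV[R]_n => f p.1 p.2)); last exact: cf.
exact: continuous_pairl.
Qed.

Lemma slice_continuous_time (f : R -> 'cV[R]_n -> R) t u :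
  {for (t, u), continuous (fun p : R * 'cV[R]_n => f p.1 p.2)} ->
  {for t, continuous (fun tau => f tau u)}.
Proof.
move=> cf; apply: (@continuous_comp _ _ _ (fun v => (v, u))
  (fun p : R * 'cV[R]_n => f p.1 p.2)); last exact: cf.
exact: continuous_pairr.
Qed.

Lemma rho_derive t i u : 0 < t ->
  is_derive u (basis_vec i) (rho t) (partial i (rho t) u).
Proof. by move=> t0; have [_ _ /(_ i)[h _] _] := rho_reg u t0; exact: derivableP. Qed.

Lemma drho_derive t i j u : 0 < t ->
  is_derive u (basis_vec i) (partial j (rho t)) (partial i (partial j (rho t)) u).
Proof. by move=> t0; have [_ _ _ /(_ i j)[h _]] := rho_reg u t0; exact: derivableP. Qed.

Lemma rho_continuous t : 0 < t -> continuous (rho t).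
Proof. by move=> t0; apply: slice_continuous => u; have [] := rho_reg u t0. Qed.

Lemma drho_continuous t j : 0 < t -> continuous (partial j (rho t)).
Proof.
move=> t0; apply: (slice_continuous (f := fun t => partial j (rho t))) => u.
by have [_ _ /(_ j)[]] := rho_reg u t0.
Qed.

Lemma ddrho_continuous t i j : 0 < t -> continuous (partial i (partial j (rho t))).
Proof.
move=> t0; apply: (slice_continuous (f := fun t => partial i (partial j (rho t)))) => u.
by have [_ _ _ /(_ i j)[]] := rho_reg u t0.
Qed.

Lemma rho_ge0 t u : 0 <= t -> 0 <= rho t u.
Proof. by move=> /rho_dens[_ h _]; exact: h. Qed.

Definition grad_norm t u : R := enorm (gradient (rho t) u).

Lemma drho_le_grad_norm t j u : `|partial j (rho t) u| <= grad_norm t u.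
Proof. by apply: le_trans (coord_le_enorm _ j); rewrite mxE. Qed.

(** Regularity is available at positive times only; the extension by zero makes
    functions on that strip measurable in the pair of variables. *)
Definition window (f : R -> 'cV[R]_n -> R) (p : measurableTypeR R * 'cV[R]_n) : R :=
  if 0 < (p.1 : R) < T then f p.1 p.2 else 0.

Lemma measurable_window (f : R -> 'cV[R]_n -> R) : spacetime_continuous f ->
  measurable_fun setT (window f).
Proof.
move=> cf.
rewrite (_ : window f = (fun p : measurableTypeR R * 'cV[R]_n => f p.1 p.2) \_
    (`]0, T[%classic `*` setT)); last first.
  apply/funext => p; rewrite /window /patch; case: ifPn => tT.
    by rewrite mem_set//; split => //=; rewrite in_itv.
  by rewrite memNset//= => -[/= h _]; move: tT; move: h; rewrite in_itv => ->.
have mQ : measurable (`]0, T[%classic `*` setT : set (measurableTypeR R * 'cV[R]_n)).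
  by apply: measurableX; [exact: (measurable_itv `]0, T[)|exact: measurableT].
apply: (measurable_restrictT _ mQ).1.
apply: open_continuous_measurable_time; first exact: interval_open.
by move=> t u; rewrite /= in_itv; exact: cf.
Qed.

Lemma window_ge0 (f : R -> 'cV[R]_n -> R) p :
  (forall t u, 0 < t < T -> 0 <= f t u) -> 0 <= window f p.
Proof. by move=> f0; rewrite /window; case: ifPn => // tT; exact: f0. Qed.

Lemma grad_norm_spacetime_continuous :
  spacetime_continuous (fun t u => (1 + enorm u) * grad_norm t u).
Proof.
move=> t u tT; have t0 : 0 < t by case/andP: tT.
apply: cvgM.
  apply: (@continuous_comp _ _ _ snd (fun u : 'cV[R]_n => 1 + enorm u)).
    exact: cvg_snd.
  exact: continuous_weight.
rewrite /grad_norm /enorm.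
apply: (@continuous_comp _ _ _
  (fun p : R * 'cV[R]_n => \sum_i gradient (rho p.1) p.2 i ord0 ^+ 2) Num.sqrt); last first.
  exact: sqrt_continuous.
have -> : (fun p : R * 'cV[R]_n => \sum_i gradient (rho p.1) p.2 i ord0 ^+ 2) =
    (fun p => \sum_i partial i (rho p.1) p.2 * partial i (rho p.1) p.2).
  by apply/funext => p; apply: eq_bigr => i _; rewrite mxE expr2.
apply: cvg_sum_seq => i; have [_ _ /(_ i)[_ h] _] := rho_reg u t0.
by apply: cvgM; exact: h.
Qed.

Lemma measurable_grad_norm t : 0 < t < T ->
  measurable_fun setT (fun u => ((1 + enorm u) * grad_norm t u)%:E).
Proof.
move=> tT; apply/measurable_EFinP; apply: continuous_measurable_cV.
apply: (slice_continuous (f := fun t u => (1 + enorm u) * grad_norm t u) (t := t)) => u.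
exact: grad_norm_spacetime_continuous.
Qed.

(** Integrable in time, hence finite at almost every time but possibly not at
    all times: limits of the truncated rates hold almost everywhere. *)
Definition grad_integral (t : measurableTypeR R) : \bar R :=
  (\int[leb]_u (window (fun t u => (1 + enorm u) * grad_norm t u) (t, u))%:E)%E.

Lemma grad_integralE t : 0 < t < T ->
  grad_integral t = (\int[leb]_u ((1 + enorm u) * grad_norm t u)%:E)%E.
Proof. by move=> tT; apply: eq_integral => u _; rewrite /window tT. Qed.

Let measurable_window_integral (f : R -> 'cV[R]_n -> R) : spacetime_continuous f ->
  (forall t u, 0 < t < T -> 0 <= f t u) ->
  measurable_fun setT (fun t : measurableTypeR R => \int[leb]_u (window f (t, u))%:E)%E.
Proof.
move=> cf f0; apply: (@measurable_ge0_integral _ _ _ _ R leb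
  (fun (t : measurableTypeR R) u => (window f (t, u))%:E)).
  apply/measurable_EFinP; rewrite [X in measurable_fun _ X](_ : _ = window f).
    exact: measurable_window.
  by apply/funext => -[].
by move=> t u; rewrite lee_fin window_ge0.
Qed.

Lemma measurable_grad_integral : measurable_fun setT grad_integral.
Proof.
apply: measurable_window_integral; first exact: grad_norm_spacetime_continuous.
by move=> t u _; rewrite mulr_ge0 ?addr_ge0 ?enorm_ge0.
Qed.

Lemma integral_grad_integral : (\int[mu]_(t in `]0%R, T[%classic) grad_integral t < +oo)%E.
Proof.
apply: le_lt_trans rho_grad; rewrite le_eqVlt; apply/orP; left; apply/eqP.
by apply: eq_integral => t; rewrite inE /= in_itv /= => tT; rewrite grad_integralE.
Qed.

Variables (psi psit : R -> 'cV[R]_n -> R) (p : 'I_n -> R -> 'cV[R]_n -> R).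
Variable H : 'I_n -> 'I_n -> R -> 'cV[R]_n -> R.
Hypothesis psi_cont : spacetime_continuous psi.
Hypothesis psit_cont : spacetime_continuous psit.
Hypothesis p_cont : forall i, spacetime_continuous (p i).
Hypothesis H_cont : forall i j, spacetime_continuous (H i j).
Hypothesis psi_derive_time : forall t u, 0 < t < T ->
  is_derive t (1 : R) (fun t => psi t u) (psit t u).
Hypothesis psi_derive : forall t i u, 0 < t < T ->
  is_derive u (basis_vec i) (psi t) (p i t u).
Hypothesis p_derive : forall t i j u, 0 < t < T ->
  is_derive u (basis_vec j) (p i t) (H i j t u).
Variables (s t K : R).
Hypothesis s_gt0 : 0 < s.
Hypothesis s_lt_t : s < t.
Hypothesis t_lt_T : t < T.
Hypothesis psi_le : forall tau u, s <= tau <= t -> `|psi tau u| <= K * (1 + enorm u) ^+ 2.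
Hypothesis psit_le : forall tau u, s <= tau <= t -> `|psit tau u| <= K * (1 + enorm u) ^+ 2.
Hypothesis p_le : forall tau i u, s <= tau <= t -> `|p i tau u| <= K * (1 + enorm u).
Hypothesis H_le : forall tau i j u, s <= tau <= t ->
  `|H i j tau u| <= K * (1 + enorm u) ^+ 2.

Let inT tau : s <= tau <= t -> 0 < tau < T.
Proof. by move=> /andP[a b]; rewrite (lt_le_trans s_gt0 a) (le_lt_trans b t_lt_T). Qed.

Definition tested tau : R := \int[leb]_u (rho tau u * psi tau u).

Definition tested_rate tau : R := \int[leb]_u (rho tau u *
  generator (C tau) B m0 (psit tau) (p^~ tau) (fun i j => H i j tau) u).

Let g tau u : R := time_derivative rho tau u * psi tau u + rho tau u * psit tau u.

Let g_cont : spacetime_continuous g.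
Proof.
move=> tau u tT; have [t0 _] := andP tT; have [c1 [_ c2] _ _] := rho_reg u t0.
by apply: cvgD; apply: cvgM; [exact: c2|exact: psi_cont|exact: c1|exact: psit_cont].
Qed.

Let cut_rate N tau : R := \int[leb]_u cut_flux (rho tau) (drho tau) (C tau) B m0
  (psi tau) (psit tau) (p^~ tau) N u.

Let cut_tested N tau : R := \int[leb]_u (rho tau u * psi tau u * cutoff N u).

Let gE tau u : 0 < tau -> g tau u = \sum_i dflux (rho tau) (drho tau) (ddrho tau) (C tau) B m0 i u *
  psi tau u + rho tau u * psit tau u.
Proof. by move=> t0; rewrite /g rho_eq// mulr_suml. Qed.

Let cut_rateE N tau : 0 < N -> s <= tau <= t ->
  \int[leb]_u (g tau u * cutoff N u) = cut_rate N tau.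
Proof.
move=> N0 /inT tT; have [t0 _] := andP tT.
transitivity (\int[leb]_u ((\sum_i dflux (rho tau) (drho tau) (ddrho tau) (C tau) B m0 i u *
    psi tau u + rho tau u * psit tau u) * cutoff N u)).
  by congr (Rintegral _ _ _); apply/funext => u; rewrite gE.
apply: integral_cut_flux => //.
- exact: rho_continuous.
- by move=> j; exact: drho_continuous.
- by move=> i j; exact: ddrho_continuous.
- by move=> i u; exact: rho_derive.
- by move=> i j u; exact: drho_derive.
- by apply: slice_continuous => u; exact: psi_cont.
- by apply: slice_continuous => u; exact: psit_cont.
- by move=> i; apply: (slice_continuous (f := p i)) => u; exact: p_cont.
- by move=> i u; exact: psi_derive.
Qed.

Let ftc u : (\int[mu]_(tau in `[s, t]) (g tau u)%:E =
  (rho t u * psi t u - rho s u * psi s u)%:E)%E.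
Proof.
have st tau : tau \in `[s, t] -> 0 < tau < T by rewrite in_itv; exact: inT.
have d tau : 0 < tau < T ->
    is_derive tau (1 : R) (fun tau => rho tau u * psi tau u) (g tau u).
  move=> tT; have [t0 _] := andP tT; have [_ [/derivableP d1 _] _ _] := rho_reg u t0.
  have h := is_deriveM d1 (psi_derive_time u tT).
  apply: (is_derive_eq h); rewrite /g /time_derivative derive1E /GRing.scale /=.
  by rewrite addrC [psi tau u * _]mulrC.
have c tau : 0 < tau < T -> {for tau, continuous (fun tau => rho tau u * psi tau u)}.
  move=> tT; apply: differentiable_continuous; apply/derivable1_diffP.
  exact: (@ex_derive _ _ _ _ _ _ _ (d tau tT)).
rewrite (@continuous_FTC2 _ (fun tau => g tau u) (fun tau => rho tau u * psi tau u))//.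
- apply: continuous_in_subspaceT => tau /set_mem /= h.
  by apply: (slice_continuous_time (f := g)); apply: g_cont; exact: st.
- split.
  + by move=> tau /subset_itv_oo_cc h; exact: (@ex_derive _ _ _ _ _ _ _ (d tau (st _ h))).
  + by apply: cvg_at_right_filter; apply: c; apply: inT; rewrite lexx ltW.
  + by apply: cvg_at_left_filter; apply: c; apply: inT; rewrite lexx ltW.
- move=> tau /subset_itv_oo_cc h.
  by rewrite derive1E; exact: (@derive_val _ _ _ _ _ _ _ (d tau (st _ h))).
Qed.

Let ind : measurableTypeR R -> R := \1_(`[s, t]%classic).

Let indE tau : ind tau = if s <= tau <= t then 1 else 0.
Proof.
rewrite /ind indicE; case: ifPn => h; first by rewrite mem_set//= in_itv.
by rewrite memNset//= in_itv; apply/negP.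
Qed.

Let F N (q : measurableTypeR R * 'cV[R]_n) : \bar R :=
  (ind q.1 * (window g q * cutoff N q.2))%:E.

Let mI : measurable_fun setT ind.
Proof. by apply: measurable_indic; exact: (measurable_itv `[s, t]). Qed.

Let integral_ind : (\int[mu]_tau (ind tau)%:E = (t - s)%:E)%E.
Proof.
have -> : (t - s)%:E = mu `[s, t]%classic.
  by rewrite lebesgue_measure_itv/= lte_fin s_lt_t.
by rewrite -[in RHS](setIT `[s, t]%classic); apply: integral_indic => //; exact: (measurable_itv `[s, t]).
Qed.

Let ind_integrable : mu.-integrable setT (EFin \o ind).
Proof.
apply/integrableP; split; first exact/measurable_EFinP.
under eq_integral do rewrite /= ger0_norm//.
by rewrite integral_ind ltry.
Qed.

Let mF N : measurable_fun setT (F N).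
Proof.
apply/measurable_EFinP; apply: measurable_funM.
  exact: (measurableT_comp mI measurable_fst).
apply: measurable_funM; first by apply: measurable_window; exact: g_cont.
apply: (measurableT_comp _ measurable_snd); apply: continuous_measurable_cV.
exact: continuous_cutoff.
Qed.

Let FE N tau u : F N (tau, u) = (ind tau * (g tau u * cutoff N u))%:E.
Proof.
rewrite /F /= indE; case: ifPn => [/inT tT|_]; last by rewrite !mul0r.
by rewrite /window tT.
Qed.

Let iF N : 0 < N -> (mu \x leb)%E.-integrable setT (F N).
Proof.
move=> N0; apply: (integrable12ltyP mu leb (mF N)).2.
have [K' hK'] : exists K' : R, forall tau u, s <= tau <= t -> enorm u <= N -> `|g tau u| <= K'.
  by apply: continuous_bounded_box => tau u /inT; exact: g_cont.
have mB := @measurable_enorm_ball R n N.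
apply: (@le_lt_trans _ _ (\int[mu]_(tau in setT) ((ind tau)%:E *
    (`|K'|%:E * leb [set u : 'cV[R]_n | (enorm u <= N)%R])))%E).
  apply: ge0_le_integral => //.
  - by move=> tau _; exact: integral_ge0.
  - apply: (@measurable_ge0_integral _ _ _ _ R leb (fun (tau : measurableTypeR R) u => `|F N (tau, u)|)%E).
      apply: measurableT_comp => //; rewrite [X in measurable_fun _ X](_ : _ = F N)//.
    by move=> *; exact: abse_ge0.
  - by apply: emeasurable_funM; [exact/measurable_EFinP|exact: measurable_cst].
  - move=> tau _; rewrite indE; case: ifPn => [tau_in|/negbTE tau_out]; last first.
      rewrite mul0e integral0_eq// => u _.
      by rewrite FE indE tau_out mul0r abse0.
    rewrite mul1e -integral_cst// [leRHS]integral_mkcond; apply: ge0_le_integral => //.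
    + apply: measurableT_comp => //; apply: (measurableT_comp (mF N)).
      exact: measurable_pair1.
    + by apply/(measurable_restrictT _ mB); exact: measurable_cst.
    + move=> u _; rewrite FE indE tau_in /= mul1r.
      have [uN|uN] := leP (enorm u) N; last first.
        by rewrite cutoff_eq0// mulr0 normr0 /patch memNset//= leNgt uN.
      rewrite /patch mem_set//= lee_fin normrM.
      rewrite (ger0_norm (cutoff_ge0 N u)) -[leRHS]mulr1.
      apply: ler_pM => //; [exact: cutoff_ge0| |exact: cutoff_le1].
      by apply: (le_trans (hK' _ _ tau_in uN)); exact: ler_norm.
have fB : (leb [set u : 'cV[R]_n | (enorm u <= N)%R]) \is a fin_num.
  by rewrite ge0_fin_numE// ball_finite_measure.
rewrite -(fineK fB) -EFinM integralZr// integral_ind; exact: ltry.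
Qed.

Let rho_psi_cont tau : s <= tau <= t -> continuous (fun u => rho tau u * psi tau u).
Proof.
move=> /inT tT; have [t0 _] := andP tT; apply: continuous_mul; first exact: rho_continuous.
by apply: slice_continuous => u; exact: psi_cont.
Qed.

Let cut_integrable N tau : 0 < N -> s <= tau <= t ->
  leb.-integrable setT (EFin \o (fun u => rho tau u * psi tau u * cutoff N u)).
Proof.
move=> N0 st; apply: (@integrable_compact_support _ _ N).
  by apply: continuous_mul; [exact: rho_psi_cont|exact: continuous_cutoff].
by move=> u Nu; rewrite cutoff_eq0// mulr0.
Qed.

Let FI N tau : 0 < N -> (\int[leb]_u F N (tau, u) =
  (ind tau * cut_rate N tau)%:E)%E.
Proof.
move=> N0; under eq_integral do rewrite FE.
rewrite indE; case: ifPn => [st|_]; last first.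
  by rewrite mul0r integral0_eq// => u _; rewrite mul0r.
rewrite mul1r -cut_rateE// /Rintegral.
under eq_integral do rewrite mul1r.
rewrite fineK//; apply: integrable_fin_num => //.
have tT := inT st.
apply: (@integrable_compact_support _ _ N (fun u => g tau u * cutoff N u)).
  apply: continuous_mul; last exact: continuous_cutoff.
  by apply: slice_continuous => u; exact: g_cont.
by move=> u Nu; rewrite cutoff_eq0// mulr0.
Qed.

Let cut_rate_integrable N : 0 < N ->
  mu.-integrable setT (EFin \o (fun tau : measurableTypeR R =>
    ind tau * cut_rate N tau)).
Proof.
move=> N0; have := integrable_fubini_F (iF N0).
rewrite (_ : fubini_F _ _ = (EFin \o (fun tau : measurableTypeR R =>
    ind tau * cut_rate N tau)))//.
by apply/funext => tau; rewrite /fubini_F FI.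
Qed.

(* Fubini exchanges the time integral of [g], which telescopes pointwise, and the
   space integral, which is the truncated rate. *)
Let cut_balance N : 0 < N -> cut_tested N t - cut_tested N s =
  \int[mu]_tau (ind tau * cut_rate N tau).
Proof.
move=> N0; have ss : s <= s <= t by rewrite lexx ltW.
have tt : s <= t <= t by rewrite lexx ltW.
rewrite /cut_tested -RintegralB//; [|exact: cut_integrable|exact: cut_integrable].
have := Fubini (iF N0).
under eq_integral do rewrite FI//.
rewrite /Rintegral => ->; congr fine; apply: eq_integral => u _.
under [RHS]eq_integral do rewrite FE.
have ig : mu.-integrable `[s, t]%classic (fun tau => (g tau u)%:E).
  apply: continuous_compact_integrable; first exact: segment_compact.
  apply: continuous_in_subspaceT => tau /set_mem /=; rewrite in_itv => /= h.
  by apply: (slice_continuous_time (f := g)); apply: g_cont; exact: inT.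
rewrite -mulrBl EFinM -ftc -integralZr// [LHS]integral_mkcond.
apply: eq_integral => tau _; rewrite indE /patch; case: ifPn => [/set_mem|/negP h].
  by rewrite /= in_itv /= => ->; rewrite mul1r EFinM.
case: ifPn => [st|_]; last by rewrite mul0r.
by exfalso; apply: h; rewrite mem_set//= in_itv.
Qed.

Let tested_cvg tau : s <= tau <= t -> cut_tested m.+1%:R tau @[m --> \oo] --> tested tau.
Proof.
move=> st; have [t0 tT] := andP (inT st).
have dens := rho_dens (ltW t0).
have r0 u : 0 <= rho tau u by apply: rho_ge0; exact: ltW.
apply: (Rintegral_dominated (g := fun u => K * ((1 + enorm u) ^+ 2 * rho tau u)) _ _ _ _).2.
- move=> m; apply: continuous_measurable_cV.
  by apply: continuous_mul; [exact: rho_psi_cont|exact: continuous_cutoff].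
- move=> u; rewrite -{2}(mulr1 (rho tau u * psi tau u)).
  by apply: cvgM; [exact: cvg_cst|exact: cvg_cutoff].
- move=> m u; rewrite normrM (ger0_norm (cutoff_ge0 _ _)) normrM (ger0_norm (r0 u)).
  rewrite mulrA [X in _ <= X]mulrC -[leRHS]mulr1.
  apply: ler_pM => //; [by rewrite mulr_ge0|exact: cutoff_ge0| |exact: cutoff_le1].
  by rewrite ler_wpM2l//; exact: psi_le.
- apply: integrable_cstM; apply: integrable_weight_sqr => //.
  by apply: (le_lt_trans (rho_mom _)); [rewrite !ltW|exact: ltry].
Qed.

Let kdom : R := dominating_cst drift_cst Mc K (n := n).

Let kdom_ge0 : 0 <= kdom.
Proof.
have ss : s <= s <= t by rewrite lexx ltW.
have K0 : 0 <= K.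
  have := psi_le 0 ss; have := normr_ge0 (psi s 0) => a b; have := le_trans a b.
  have e := enorm_ge0 (0 : 'cV[R]_n).
  by rewrite pmulr_lge0// exprn_gt0// ltr_pwDl.
have := drift_cst_ge0 => b0.
apply: mulr_ge0 => //; apply: addr_ge0.
  by apply: addr_ge0 => //; apply: mulr_ge0 => //; exact: mulr_ge0.
by apply: mulr_ge0 => //; apply: mulr_ge0 => //; exact: sqr_ge0.
Qed.

Let cut_rate_le N tau : 1 <= N -> s <= tau <= t ->
  (`|cut_rate N tau|%:E <= kdom%:E * ((2 + 2 * M)%:E + grad_integral tau))%E.
Proof.
move=> N1 st; have tT := inT st; have [t0 tT'] := andP tT.
have N0 : 0 < N by rewrite (lt_le_trans ltr01).
have dens := rho_dens (ltW t0).
have r0 u : 0 <= rho tau u by apply: rho_ge0; exact: ltW.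
have c1 := rho_continuous t0; have c2 j := @drho_continuous tau j t0.
have c3 : continuous (psi tau) by apply: slice_continuous => u; exact: psi_cont.
have c4 : continuous (psit tau) by apply: slice_continuous => u; exact: psit_cont.
have c5 i : continuous (p i tau).
  by apply: (slice_continuous (f := p i)) => u; exact: p_cont.
set cf := cut_flux (rho tau) (drho tau) (C tau) B m0 (psi tau) (psit tau) (p^~ tau) N.
have mcf : measurable_fun setT cf by exact: measurable_cut_flux.
have cfle u : `|cf u| <= kdom * dominating (rho tau) (grad_norm tau) u.
  apply: cut_flux_le => //.
  - exact: drift_cst_ge0.
  - by move=> v; exact: enorm_ge0.
  - by move=> j v; exact: drho_le_grad_norm.
  - by move=> i j; exact: C_le.
  - by move=> i v; exact: drift_le_cst.
  - by move=> v; exact: psi_le.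
  - by move=> v; exact: psit_le.
  - by move=> i v; exact: p_le.
have mw : measurable_fun setT (fun u => ((1 + enorm u) ^+ 2 * rho tau u)%:E).
  apply/measurable_EFinP; apply: continuous_measurable_cV.
  by apply: continuous_mul => //; exact: continuous_weight_sqr.
have mg := measurable_grad_norm tT.
have e0 (u : 'cV[R]_n) : 0 <= 1 + enorm u by rewrite addr_ge0// enorm_ge0.
have w0 u : (0 <= ((1 + enorm u) ^+ 2 * rho tau u)%:E)%E by rewrite lee_fin mulr_ge0 ?sqr_ge0.
have g0 u : (0 <= ((1 + enorm u) * grad_norm tau u)%:E)%E by rewrite lee_fin mulr_ge0 ?enorm_ge0.
apply: (@le_trans _ _ (\int[leb]_u `|(cf u)%:E|)%E).
  rewrite /cut_rate -/cf /Rintegral.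
  have h : (`|\int[leb]_u (cf u)%:E| <= \int[leb]_u `|(cf u)%:E|)%E.
    by apply: le_abse_integral => //; exact/measurable_EFinP.
  by apply: le_trans h; case: (\int[leb]_u (cf u)%:E)%E => [x||]//=; rewrite normr0 leey.
apply: (@le_trans _ _ (\int[leb]_u (kdom%:E * (((1 + enorm u) ^+ 2 * rho tau u)%:E +
    ((1 + enorm u) * grad_norm tau u)%:E)))%E).
  apply: ge0_le_integral => //.
  - by apply: measurableT_comp => //; exact/measurable_EFinP.
  - by apply: measurable_funeM; exact: emeasurable_funD.
  - by move=> u _; rewrite -EFinD -EFinM lee_fin; exact: cfle.
rewrite ge0_integralZl_EFin//; last 2 first.
- by move=> u _; exact: adde_ge0.
- exact: emeasurable_funD.
rewrite ge0_integralD//; apply: lee_wpmul2l; first by rewrite lee_fin.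
apply: leeD; last by rewrite grad_integralE.
apply: integral_weight_sqr => //; apply: rho_mom; by rewrite !ltW.
Qed.

(* The amount by which the truncated rate violates the bound on the limit rate;
   its integral tends to [0] by dominated convergence. *)
Let excess c eps N tau : R := ind tau * Num.max 0 (`|cut_rate N tau - c| - eps).

Let measurable_cut_rate N : 0 < N -> measurable_fun setT (fun tau : measurableTypeR R => ind tau * cut_rate N tau).
Proof. by move=> N0; exact: (integrable_measurable (cut_rate_integrable N0)). Qed.

Let measurable_excess c eps N : 0 < N -> measurable_fun setT (excess c eps N).
Proof.
move=> N0; rewrite (_ : excess c eps N =
  fun tau => ind tau * Num.max 0 (`|ind tau * cut_rate N tau - c| - eps)).
  apply: measurable_funM => //; apply: measurable_maxr => //.
  apply: measurable_funB => //; apply: measurableT_comp => //.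
  by apply: measurable_funB => //; exact: measurable_cut_rate.
apply/funext => tau; rewrite /excess indE; case: ifPn => _; last by rewrite !mul0r.
by rewrite !mul1r.
Qed.

Let grad_integrable : mu.-integrable setT grad_integral.
Proof.
apply/integrableP; split; first exact: measurable_grad_integral.
apply: le_lt_trans integral_grad_integral; rewrite [leRHS]integral_mkcond.
rewrite le_eqVlt; apply/orP; left; apply/eqP; apply: eq_integral => tau _.
rewrite gee0_abs; last first.
  by apply: integral_ge0 => u _; rewrite lee_fin window_ge0// => *; rewrite mulr_ge0 ?addr_ge0 ?enorm_ge0.
rewrite /patch; case: ifPn => // /negP h; rewrite /grad_integral integral0_eq// => u _.
by rewrite /window; case: ifPn => // hh; exfalso; apply: h; rewrite mem_set//= in_itv.
Qed.

Let excess_cvg c eps tau : 0 <= eps -> s <= tau <= t -> `|tested_rate tau - c| <= eps ->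
  (grad_integral tau < +oo)%E -> excess c eps m.+1%:R tau @[m --> \oo] --> (0 : R).
Proof.
move=> eps0 st rc fin; rewrite /excess indE st.
have tT := inT st; have [t0 tT'] := andP tT.
have e0 (u : 'cV[R]_n) : 0 <= 1 + enorm u by rewrite addr_ge0// enorm_ge0.
have mg := measurable_grad_norm tT.
have cr : cut_rate m.+1%:R tau @[m --> \oo] --> tested_rate tau.
  apply: (@integral_cut_flux_cvg R n (rho tau) (drho tau) _ _ _ _ _ _ (grad_norm tau) drift_cst Mc K).
  - exact: rho_continuous.
  - by move=> j; exact: drho_continuous.
  - by move=> i u; exact: rho_derive.
  - exact: drift_cst_ge0.
  - exact: Mc_ge0.
  - by move=> u; exact: enorm_ge0.
  - by move=> u; apply: rho_ge0; exact: ltW.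
  - by move=> j u; exact: drho_le_grad_norm.
  - by move=> i j; exact: C_le.
  - by move=> i u; exact: drift_le_cst.
  - apply: integrable_weight_sqr; first exact: rho_dens (ltW t0).
    by apply: (le_lt_trans (rho_mom _)); [rewrite !ltW|exact: ltry].
  - apply/integrableP; split=> //; move: fin; rewrite grad_integralE//.
    apply: le_lt_trans; rewrite le_eqVlt; apply/orP; left; apply/eqP.
    by apply: eq_integral => u _; rewrite gee0_abs// lee_fin mulr_ge0 ?enorm_ge0.
  - by apply: slice_continuous => u; exact: psi_cont.
  - by apply: slice_continuous => u; exact: psit_cont.
  - by move=> i; apply: (slice_continuous (f := p i)) => u; exact: p_cont.
  - by move=> i j; apply: (slice_continuous (f := H i j)) => u; exact: H_cont.
  - by move=> i j u; exact: p_derive.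
  - by move=> u; exact: psi_le.
  - by move=> u; exact: psit_le.
  - by move=> i u; exact: p_le.
  - by move=> i j u; exact: H_le.
have h : `|cut_rate m.+1%:R tau - c| - eps @[m --> \oo] --> `|tested_rate tau - c| - eps.
  apply: cvgB; last exact: cvg_cst.
  by apply: cvg_norm; apply: cvgB => //; exact: cvg_cst.
have : 1 * Num.max 0 (`|cut_rate m.+1%:R tau - c| - eps) @[m --> \oo] -->
    1 * Num.max 0 (`|tested_rate tau - c| - eps).
  apply: cvgM; first exact: cvg_cst.
  by apply: (cvg_comp _ _ h); exact: max0_continuous.
by rewrite (max_idPl _) ?mulr0// subr_le0.
Qed.

Let excess_integral_cvg c eps : 0 <= eps ->
  (forall tau, s <= tau <= t -> `|tested_rate tau - c| <= eps) ->
  (forall m, mu.-integrable setT (EFin \o excess c eps m.+1%:R)) /\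
  \int[mu]_tau excess c eps m.+1%:R tau @[m --> \oo] --> (0 : R).
Proof.
move=> eps0 rc.
pose gd (tau : measurableTypeR R) : \bar R := ((kdom * (2 + 2 * M) + `|c|)%:E * (ind tau)%:E +
  kdom%:E * grad_integral tau)%E.
have igd : mu.-integrable setT gd by apply: integrableD => //; exact: integrableZl.
have grad0 tau : (0 <= grad_integral tau)%E.
  by apply: integral_ge0 => u _; rewrite lee_fin window_ge0// => *;
    rewrite mulr_ge0 ?addr_ge0 ?enorm_ge0.
have M0 : 0 <= 2 + 2 * M.
  rewrite -lee_fin; apply: le_trans (integral_weight_sqr (rho_dens (lexx _)) (rho_mom _)).
    by apply: integral_ge0 => u _; rewrite lee_fin mulr_ge0 ?sqr_ge0 ?rho_ge0.
  by rewrite lexx ltW.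
have bd m (tau : measurableTypeR R) : (`|(EFin \o excess c eps m.+1%:R) tau| <= gd tau)%E.
  rewrite /= /excess /gd indE; case: ifPn => [st|_]; last first.
    by rewrite mul0r normr0 mule0 add0e mule_ge0// lee_fin.
  rewrite mul1r mule1 ger0_norm ?le_max ?lexx//.
  apply: (@le_trans _ _ (`|cut_rate m.+1%:R tau|%:E + `|c|%:E)%E).
    rewrite -EFinD lee_fin ge_max addr_ge0//=.
    have := ler_normB (cut_rate m.+1%:R tau) c; lra.
  apply: (le_trans (leeD2r _ (cut_rate_le _ st))); first by rewrite ler1n.
  by rewrite ge0_muleDr// ?lee_fin// -EFinM -addeA [(_ * _ + `|c|%:E)%E]addeC addeA -EFinD.
have mex m : measurable_fun setT (EFin \o excess c eps m.+1%:R).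
  by apply/measurable_EFinP; apply: measurable_excess; rewrite ltr0n.
have iex m : mu.-integrable setT (EFin \o excess c eps m.+1%:R).
  apply: (le_integrable measurableT _ _ igd) => // tau _.
  by apply: (le_trans (bd m tau)); exact: lee_abs.
have ecvg : {ae mu, forall tau, setT tau ->
    (EFin \o excess c eps m.+1%:R) tau @[m --> \oo] --> 0%E}.
  have := integrable_ae measurableT grad_integrable.
  apply: filterS => tau /(_ I) fin _.
  have [st|st] := boolP (s <= tau <= t); last first.
    rewrite (_ : (fun m => _) = cst 0%E); first exact: cvg_cst.
    by apply/funext => m; rewrite /= /excess indE (negbTE st) mul0r.
  apply: cvg_EFin; first exact: nearW.
  by apply: (excess_cvg eps0 st (rc _ st)); move: fin; rewrite ge0_fin_numE.
have [_ _ cvg0] := @dominated_convergence _ _ _ mu setT measurableT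
  (fun m => EFin \o excess c eps m.+1%:R) (cst 0%E) gd mex
  (measurable_cst _) ecvg igd (aeW _ (fun tau m _ => bd m tau)).
split=> //; apply: fine_cvg.
by move: cvg0; rewrite integral_cst// mul0e.
Qed.

(** The balance of [tested] between two times, with the right-hand side of the
    equation transferred to the test function. Only a bound on the rate is
    asked, so that no regularity in time of the coefficients has to be known
    beforehand. With [eps = 0] it gives conservation laws, with small [eps]
    derivatives. *)
Theorem tested_increment c eps : 0 <= eps ->
  (forall tau, s <= tau <= t -> `|tested_rate tau - c| <= eps) ->
  `|tested t - tested s - c * (t - s)| <= eps * (t - s).
Proof.
move=> eps0 rc; have [iex ex0] := excess_integral_cvg eps0 rc.
have ss : s <= s <= t by rewrite lexx ltW.
have tt : s <= t <= t by rewrite lexx ltW.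
have Iind k : \int[mu]_tau (k * ind tau) = k * (t - s).
  by rewrite RintegralZl// /Rintegral integral_ind.
have l1 : `|cut_tested m.+1%:R t - cut_tested m.+1%:R s - c * (t - s)| @[m --> \oo] -->
    `|tested t - tested s - c * (t - s)|.
  apply: cvg_norm; apply: cvgB; last exact: cvg_cst.
  by apply: cvgB; exact: tested_cvg.
have l2 : eps * (t - s) + \int[mu]_tau excess c eps m.+1%:R tau @[m --> \oo] -->
    eps * (t - s) + 0.
  by apply: cvgD => //; exact: cvg_cst.
rewrite -[leRHS]addr0; apply: (ler_cvg_to l1 l2); apply: nearW => m.
have N0 : 0 < m.+1%:R :> R by rewrite ltr0n.
have icr := cut_rate_integrable N0.
rewrite cut_balance// -!Iind -RintegralB//; last exact: integrable_cstM.
rewrite -RintegralD//; last exact: integrable_cstM.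
apply: Rintegral_abs_le.
- apply: measurable_funB; first exact: (integrable_measurable icr).
  exact: measurable_funM.
- move=> tau; rewrite /excess indE; case: ifPn => _; last by rewrite !mulr0 !mul0r subr0 normr0 addr0.
  by rewrite !mulr1 !mul1r -lerBlDl le_max lexx orbT.
- by apply: integrable_add => //; exact: integrable_cstM.
Qed.

End weak_formulation.

(** * Increment bounds and differential equations *)

Section ordinary_differential_equations.
Context {R : realType}.
Variables X r : R -> R.
(* An integral form of [X' = r] that makes sense for an arbitrary [r]. It first
   gives continuity of [X]; if [r] is a function of such quantities it is then
   continuous, and [X] is differentiable. *)
Hypothesis increment : forall s t c eps, 0 < s -> s < t -> 0 <= eps ->
  (forall tau, s <= tau <= t -> `|r tau - c| <= eps) ->
  `|X t - X s - c * (t - s)| <= eps * (t - s).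

Lemma increment_continuous :
  (forall T, 0 < T -> exists K, forall tau, 0 < tau < T -> `|r tau| <= K) ->
  forall t, 0 < t -> {for t, continuous X}.
Proof.
move=> rb t t0; have [K hK] := rb (t + 1) (addr_gt0 t0 ltr01).
have K0 : 0 <= K by apply: (le_trans (normr_ge0 (r t))); apply: hK; rewrite t0 ltrDl ltr01.
have lip a b : 0 < a -> a <= b -> b < t + 1 -> `|X b - X a| <= K * (b - a).
  move=> a0 ab bt; have [->|nab] := eqVneq a b; first by rewrite !subrr normr0 mulr0.
  have := @increment a b 0 K a0 _ K0; rewrite mul0r subr0; apply.
    by rewrite lt_neqAle nab.
  by move=> tau /andP[h1 h2]; rewrite subr0 hK// (lt_le_trans a0 h1) (le_lt_trans h2 bt).
apply/cvgrPdist_le => e e0; near=> tau.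
have tau0 : 0 < tau by near: tau; exact: lt_nbhsr.
have taut : tau < t + 1 by near: tau; apply: lt_nbhsl; rewrite ltrDl.
have h : `|t - tau| <= e / (K + 1).
  near: tau; have hid : x @[x --> t] --> t by exact: cvg_id.
  by move/cvgrPdist_le : hid; apply; rewrite divr_gt0// ltr_wpDl.
have h2 : K * `|t - tau| <= e.
  apply: (@le_trans _ _ ((K + 1) * `|t - tau|)); first by rewrite ler_wpM2r// lerDl.
  by rewrite mulrC -ler_pdivlMr// ltr_wpDl.
apply: le_trans h2; have [tt|tt] := leP tau t.
  by rewrite [`|t - tau|]ger0_norm ?subr_ge0//; apply: lip => //; rewrite ltrDl.
have tt' := ltW tt; rewrite distrC [`|t - tau|]distrC [`|tau - t|]ger0_norm ?subr_ge0//.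
exact: lip.
Unshelve. all: by end_near. Qed.

Lemma increment_derive t : 0 < t -> {for t, continuous r} -> is_derive t (1 : R) X (r t).
Proof.
move=> t0 cr; apply: is_derive_eps => eps eps0.
have /nbhs_ballP[del /= del0 hdel] : nbhs t [set tau | `|r t - r tau| <= eps].
  by move/cvgrPdist_le : cr; apply.
exists (Num.min del t); first by rewrite lt_min del0.
move=> h; rewrite lt_min => /andP[hd ht].
have [->|h0] := eqVneq h 0; first by rewrite addr0 subrr mul0r subr0 normr0 mulr0.
have near_t tau : `|t - tau| < del -> `|r tau - r t| <= eps.
  by move=> b; rewrite distrC; apply: hdel.
have [hp|hn|h00] := ltgtP h 0; last by rewrite h00 eqxx in h0.
- have th : 0 < t + h by move: ht; rewrite ltr0_norm// => ht; rewrite -(opprK h) subr_gt0.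
  have := @increment (t + h) t (r t) eps th _ (ltW eps0).
  rewrite (_ : t - (t + h) = - h); last by ring.
  rewrite (ltr0_norm hp) => inc; rewrite (_ : X _ - _ - _ = - (X t - X (t + h) - r t * - h)); last by ring.
  rewrite normrN; apply: inc; first by rewrite gtrDl.
  move=> tau /andP[a b]; apply: near_t; rewrite ger0_norm ?subr_ge0//.
  by move: hd; rewrite ltr0_norm// => hd; lra.
- have := @increment t (t + h) (r t) eps t0 _ (ltW eps0).
  rewrite (_ : t + h - t = h); last by ring.
  rewrite (gtr0_norm hn) => inc; rewrite [h * _]mulrC; apply: inc; first by rewrite ltrDl.
  move=> tau /andP[a b]; apply: near_t; rewrite distrC ger0_norm ?subr_ge0//.
  by move: hd; rewrite gtr0_norm// => hd; lra.
Qed.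

End ordinary_differential_equations.

Section gronwall.
Context {R : realType}.

Lemma exp_weight_ndecr (g g' : R -> R) (T k a b : R) :
  (forall t, 0 < t < T -> is_derive t (1 : R) g (g' t)) ->
  (forall t, 0 < t < T -> 0 <= g' t + k * g t) ->
  0 < a -> a <= b -> b < T -> g a * expR (k * a) <= g b * expR (k * b).
Proof.
move=> dg pos a0 ab bT.
have dexp x : 0 < x < T ->
    is_derive x (1 : R) (fun x => g x * expR (k * x)) ((g' x + k * g x) * expR (k * x)).
  move=> xT.
  have d1 : is_derive x (1 : R) (fun x : R => k * x) k.
    by apply: (@is_derive_quadratic _ _ _ _ 0) => h;
      rewrite mul0r [X in `|X|](_ : _ = 0) ?normr0//; ring.
  have d2 : is_derive x (1 : R) (fun x => expR (k * x)) (expR (k * x) * k).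
    exact: (is_derive1_comp (is_derive_expR (k * x)) d1).
  have d3 := is_deriveM (dg x xT) d2; apply: (is_derive_eq d3).
  by rewrite /GRing.scale /=; ring.
have inT x : a <= x <= b -> 0 < x < T.
  by move=> /andP[h1 h2]; rewrite (lt_le_trans a0 h1) (le_lt_trans h2 bT).
apply: (@ger0_derive1_ndecr _ (fun x => g x * expR (k * x)) a b) => //.
- move=> x; rewrite in_itv /= => /andP[/ltW h1 /ltW h2].
  by apply: (@ex_derive _ _ _ _ _ _ _ (dexp x _)); apply: inT; rewrite h1.
- move=> x; rewrite in_itv /= => /andP[/ltW h1 /ltW h2].
  have xT : 0 < x < T by apply: inT; rewrite h1.
  by rewrite derive1E (@derive_val _ _ _ _ _ _ _ (dexp x xT)) mulr_ge0 ?pos ?expR_ge0.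
- apply: continuous_in_subspaceT => x /set_mem /=; rewrite in_itv /= => xab.
  apply: differentiable_continuous; apply/derivable1_diffP.
  exact: (@ex_derive _ _ _ _ _ _ _ (dexp x (inT x xab))).
Qed.

(** If [|f'| <= kappa f] then [f e^(kappa t)] is nondecreasing and
    [f e^(- kappa t)] nonincreasing, so that a zero of [f >= 0] propagates in
    both directions. *)
Lemma gronwall_eq0 (f f' : R -> R) (T kappa t0 : R) :
  (forall t, 0 < t < T -> is_derive t (1 : R) f (f' t)) ->
  (forall t, 0 < t < T -> `|f' t| <= kappa * f t) ->
  (forall t, 0 <= f t) -> 0 < t0 < T -> f t0 = 0 ->
  forall t, 0 < t < T -> f t = 0.
Proof.
move=> df f'le f0 t0T ft0 t tT.
have dNf x : 0 < x < T -> is_derive x (1 : R) (fun x => - f x) (- f' x).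
  by move=> xT; have h := df x xT; exact: (@is_deriveN _ _ _ f x 1 (f' x) h).
have kpos x : 0 < x < T -> 0 <= f' x + kappa * f x.
  by move=> xT; have := f'le x xT; rewrite ler_norml => /andP[]; lra.
have kneg x : 0 < x < T -> 0 <= - f' x + - kappa * - f x.
  by move=> xT; have := f'le x xT; rewrite ler_norml => /andP[]; lra.
apply/eqP; rewrite eq_le f0 andbT.
have [/andP[a1 a2] /andP[b1 b2]] := (t0T, tT).
have [tt|tt] := leP t t0.
  have := exp_weight_ndecr df kpos b1 tt a2; rewrite ft0 mul0r.
  by rewrite pmulr_lle0// expR_gt0.
have := exp_weight_ndecr dNf kneg a1 (ltW tt) b2; rewrite ft0 oppr0 mul0r.
by rewrite mulNr oppr_ge0 pmulr_lle0// expR_gt0.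
Qed.

End gronwall.

(** * Coordinates that normalize the potential *)

Section normalizing_coordinates.
Context {R : realType} {n : nat}.
Variables (L : 'M[R]_n) (m0 : 'cV[R]_n).

(** If [L^T L] is the Hessian of a quadratic potential with minimizer [m0], the
    potential is half the sum of the squares of these coordinates, up to a
    constant. *)
Definition wcoord (u : 'cV[R]_n) (i : 'I_n) : R := (L *m (u - m0)) i ord0.

Lemma wcoordE u i : wcoord u i = \sum_k L i k * (u k ord0 - m0 k ord0).
Proof. by rewrite /wcoord mxE; apply: eq_bigr => k _; rewrite !mxE. Qed.

Lemma wcoord_line u h v i : wcoord (u + h *: v) i = wcoord u i + h * (L *m v) i ord0.
Proof. by rewrite /wcoord addrAC mulmxDr -scalemxAr [LHS]mxE [X in _ + X]mxE. Qed.

Lemma mul_basis_vec i k : (L *m basis_vec k) i ord0 = L i k.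
Proof.
rewrite mxE (bigD1 k)//= big1 => [|j jk]; rewrite !mxE ?eqxx ?mulr1 ?addr0//.
by rewrite (negbTE jk) mulr0.
Qed.

Lemma is_derive_wcoord i k u :
  is_derive u (basis_vec k) (fun u => wcoord u i) (L i k).
Proof.
apply/is_derive_coord_line; apply: (@is_derive_quadratic _ _ _ _ 0) => h.
rewrite add0r !wcoord_line mul_basis_vec [X in `|X|](_ : _ = 0); last by ring.
by rewrite normr0 mul0r.
Qed.

Lemma continuous_wcoord i : continuous (fun u => wcoord u i).
Proof.
rewrite (_ : (fun u => _) = fun u : 'cV[R]_n => \sum_k L i k * (u k ord0 - m0 k ord0)); last first.
  by apply/funext => u; exact: wcoordE.
apply: continuous_sum => k; apply: continuous_mul; first exact: cst_continuous.
by apply: continuous_add; [exact: coord_cV_continuous|exact: cst_continuous].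
Qed.

Definition wcoord_cst : R := (\sum_i \sum_k `|L i k|) * (1 + enorm m0).

Lemma wcoord_cst_ge0 : 0 <= wcoord_cst.
Proof.
have e := enorm_ge0 m0; apply: mulr_ge0; last lra.
by apply: sumr_ge0 => i _; exact: sumr_ge0.
Qed.

Lemma wcoord_le u i : `|wcoord u i| <= wcoord_cst * (1 + enorm u).
Proof.
rewrite wcoordE; apply: (le_trans (ler_norm_sum _ _ _)).
have e0 := enorm_ge0 m0; have e := enorm_ge0 u.
have hk (k : 'I_n) : `|L i k * (u k ord0 - m0 k ord0)| <=
    `|L i k| * ((1 + enorm m0) * (1 + enorm u)).
  rewrite normrM ler_wpM2l//; apply: (le_trans (ler_normB _ _)).
  by have := coord_le_enorm u k; have := coord_le_enorm m0 k; nra.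
apply: (le_trans (ler_sum _ (fun k _ => hk k))); rewrite -mulr_suml.
rewrite /wcoord_cst -mulrA ler_wpM2r ?mulr_ge0 ?addr_ge0//.
by rewrite [leRHS](bigD1 i)//= lerDl sumr_ge0// => j _; exact: sumr_ge0.
Qed.

(** The generator in the new coordinates, where the drift is [- W x]. The same
    matrix [W] acts as drift and as diffusion: this is the preconditioning by the
    covariance. *)
Definition wgenerator (W : 'M[R]_n) (psit : R) (q : 'I_n -> R) (G : 'I_n -> 'I_n -> R)
    (x : 'I_n -> R) : R :=
  psit - \sum_a (\sum_b W a b * x b) * q a + \sum_a \sum_b W a b * G a b.

Lemma congr_mxE (C : 'M[R]_n) a b :
  (L *m C *m L^T) a b = \sum_k \sum_l C k l * (L a k * L b l).
Proof.
rewrite mxE exchange_big /=; apply: eq_bigr => l _; rewrite !mxE mulr_suml.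
by apply: eq_bigr => k _; ring.
Qed.

(** The chain rule, for a test function with gradient [q] and Hessian [G] in the
    new coordinates. *)
Lemma generatorE (C : 'M[R]_n) (psit : 'cV[R]_n -> R) (q : 'I_n -> 'cV[R]_n -> R)
    (G : 'I_n -> 'I_n -> 'cV[R]_n -> R) u :
  generator C (L^T *m L) m0 psit (fun k u => \sum_a q a u * L a k)
    (fun k l u => \sum_a \sum_b G a b u * (L a k * L b l)) u =
  wgenerator (L *m C *m L^T) (psit u) (q^~ u) (fun a b => G a b u) (wcoord u).
Proof.
rewrite /generator /wgenerator; congr (_ - _ + _).
  rewrite (eq_bigr (fun k => \sum_a q a u * (L a k * drift C (L^T *m L) m0 k u))).
    rewrite exchange_big /=; apply: eq_bigr => a _.
    rewrite -mulr_sumr mulrC; congr (_ * _).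
    have -> : \sum_k L a k * drift C (L^T *m L) m0 k u =
        (L *m (C *m (L^T *m L *m (u - m0)))) a ord0 by rewrite mxE.
    transitivity ((L *m C *m L^T *m (L *m (u - m0))) a ord0); last by rewrite mxE.
    by rewrite !mulmxA.
  by move=> k _; rewrite mulr_sumr; apply: eq_bigr => a _; ring.
under [RHS]eq_bigr => a _ do under eq_bigr => b _ do
  (rewrite congr_mxE mulr_suml; under eq_bigr => k _ do rewrite mulr_suml).
transitivity (\sum_k \sum_l \sum_a \sum_b C k l * (L a k * L b l) * G a b u).
  apply: eq_bigr => k _; apply: eq_bigr => l _; rewrite mulr_sumr.
  by apply: eq_bigr => a _; rewrite mulr_sumr; apply: eq_bigr => b _; ring.
transitivity (\sum_k \sum_a \sum_b \sum_l C k l * (L a k * L b l) * G a b u).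
  apply: eq_bigr => k _; rewrite [LHS]exchange_big /=.
  by apply: eq_bigr => a _; rewrite [LHS]exchange_big.
rewrite [LHS]exchange_big /=; apply: eq_bigr => a _.
by rewrite [LHS]exchange_big.
Qed.

End normalizing_coordinates.

Section expectation.
Context {R : realType} {n : nat}.
Local Notation leb := (@lebesgue_cV R n).

Definition linear_growth (g : 'cV[R]_n -> R) : Prop :=
  continuous g /\ exists K, forall u, `|g u| <= K * (1 + enorm u).

Definition quadratic_growth (g : 'cV[R]_n -> R) : Prop :=
  continuous g /\ exists K, forall u, `|g u| <= K * (1 + enorm u) ^+ 2.

Lemma linear_growth_cst c : linear_growth (fun _ => c).
Proof.
split; first exact: cst_continuous.
by exists `|c| => u; rewrite ler_peMr// lerDl enorm_ge0.
Qed.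

Lemma linear_growth_coord i : linear_growth (fun u : 'cV[R]_n => u i ord0).
Proof.
split; first exact: coord_cV_continuous.
by exists 1 => u; rewrite mul1r; apply: (le_trans (coord_le_enorm u i)); rewrite lerDr.
Qed.

Lemma linear_growth_wcoord L m0 i : linear_growth (fun u => wcoord L m0 u i).
Proof.
split; first exact: continuous_wcoord.
by exists (wcoord_cst L m0) => u; exact: wcoord_le.
Qed.

Lemma linear_growthD g h : linear_growth g -> linear_growth h ->
  linear_growth (fun u => g u + h u).
Proof.
move=> [cg [K gK]] [ch [K' hK]]; split; first exact: continuous_add.
exists (K + K') => u; rewrite mulrDl; apply: (le_trans (ler_normD _ _)).
exact: lerD.
Qed.

Lemma quadratic_growthM g h : linear_growth g -> linear_growth h ->
  quadratic_growth (fun u => g u * h u).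
Proof.
move=> [cg [K gK]] [ch [K' hK]]; split; first exact: continuous_mul.
exists (K * K') => u; rewrite normrM expr2 mulrACA; exact: ler_pM.
Qed.

Lemma linear_quadratic_growth g : linear_growth g -> quadratic_growth g.
Proof.
move=> gg; have := quadratic_growthM gg (linear_growth_cst 1).
by under eq_fun do rewrite mulr1.
Qed.

Lemma quadratic_growthD g h : quadratic_growth g -> quadratic_growth h ->
  quadratic_growth (fun u => g u + h u).
Proof.
move=> [cg [K gK]] [ch [K' hK]]; split; first exact: continuous_add.
exists (K + K') => u; rewrite mulrDl; apply: (le_trans (ler_normD _ _)).
exact: lerD.
Qed.

Lemma quadratic_growthZ c g : quadratic_growth g -> quadratic_growth (fun u => c * g u).
Proof.
move=> [cg [K gK]]; split; first by apply: continuous_mul => //; exact: cst_continuous.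
by exists (`|c| * K) => u; rewrite normrM -mulrA ler_wpM2l.
Qed.

Lemma quadratic_growth_sum (I : Type) (s : seq I) (g : I -> 'cV[R]_n -> R) :
  (forall i, quadratic_growth (g i)) -> quadratic_growth (fun u => \sum_(i <- s) g i u).
Proof.
move=> gg; elim: s => [|i s ih].
  under eq_fun do rewrite big_nil.
  by apply: linear_quadratic_growth; exact: linear_growth_cst.
by under eq_fun do rewrite big_cons; exact: quadratic_growthD.
Qed.

Variable f : 'cV[R]_n -> R.
Hypothesis f_density : prob_density f.
Hypothesis f_moment : (second_moment f < +oo)%E.

Definition expect (g : 'cV[R]_n -> R) : R := \int[leb]_u (f u * g u).

Lemma expect_integrable g : quadratic_growth g ->
  leb.-integrable setT (EFin \o (fun u => f u * g u)).
Proof.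
move=> [cg [K gK]]; have [mf f0 _] := f_density.
apply: (integrable_le (g := fun u => K * ((1 + enorm u) ^+ 2 * f u))).
- by apply: measurable_funM => //; exact: continuous_measurable_cV.
- by move=> u; rewrite normrM (ger0_norm (f0 u)) mulrC mulrA ler_wpM2r.
- by apply: integrable_cstM; exact: integrable_weight_sqr.
Qed.

Lemma expect_cst c : expect (fun _ => c) = c.
Proof.
have [mf f0 f1] := f_density; rewrite /expect.
rewrite (_ : (fun u => _) = fun u => c * f u); last by apply/funext => u; rewrite mulrC.
rewrite RintegralZl//; first by rewrite /Rintegral f1 mulr1.
apply/integrableP; split; first exact/measurable_EFinP.
under eq_integral do rewrite gee0_abs ?lee_fin//.
by rewrite f1 ltry.
Qed.

Lemma expectD g h : quadratic_growth g -> quadratic_growth h ->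
  expect (fun u => g u + h u) = expect g + expect h.
Proof.
move=> gg gh; rewrite /expect -RintegralD//; [|exact: expect_integrable..].
by congr Rintegral; apply/funext => u; rewrite mulrDr.
Qed.

Lemma expectZ c g : quadratic_growth g -> expect (fun u => c * g u) = c * expect g.
Proof.
move=> gg; rewrite /expect -RintegralZl//; last exact: expect_integrable.
by congr Rintegral; apply/funext => u; ring.
Qed.

Lemma expect_sum (I : Type) (s : seq I) (g : I -> 'cV[R]_n -> R) :
  (forall i, quadratic_growth (g i)) ->
  expect (fun u => \sum_(i <- s) g i u) = \sum_(i <- s) expect (g i).
Proof.
move=> gg; elim: s => [|i s ih].
  under eq_fun do rewrite big_nil.
  by rewrite big_nil expect_cst.
under eq_fun do rewrite big_cons.
by rewrite expectD// ?ih ?big_cons//; exact: quadratic_growth_sum.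
Qed.

Lemma expect_le g K M : quadratic_growth g -> (forall u, `|g u| <= K * (1 + enorm u) ^+ 2) ->
  0 <= K -> (second_moment f <= M%:E)%E -> `|expect g| <= K * (2 + 2 * M).
Proof.
move=> gg gK K0 fM; have [mf f0 _] := f_density.
have iw := integrable_weight_sqr f_density f_moment.
apply: (@le_trans _ _ (\int[leb]_u (K * ((1 + enorm u) ^+ 2 * f u)))).
  apply: Rintegral_abs_le.
  - exact: (integrable_measurable (expect_integrable gg)).
  - by move=> u; rewrite normrM (ger0_norm (f0 u)) mulrC mulrA ler_wpM2r.
  - exact: integrable_cstM.
rewrite RintegralZl// ler_wpM2l// /Rintegral -lee_fin fineK.
  exact: integral_weight_sqr.
exact: integrable_fin_num.
Qed.

Lemma meanE i : mean f i ord0 = expect (fun u : 'cV[R]_n => u i ord0).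
Proof. by rewrite mxE; congr Rintegral; apply/funext => u; rewrite mulrC. Qed.

Lemma covariance_expect i j : Defs.covariance f i j =
  expect (fun u : 'cV[R]_n => (u i ord0 - mean f i ord0) * (u j ord0 - mean f j ord0)).
Proof.
rewrite mxE; congr Rintegral; apply/funext => u.
by rewrite ![(u - _) _ _]mxE ![(- mean f) _ _]mxE mulrC.
Qed.

Let lg_centered i : linear_growth (fun u : 'cV[R]_n => u i ord0 - mean f i ord0).
Proof. by apply: linear_growthD; [exact: linear_growth_coord|exact: linear_growth_cst]. Qed.

Lemma covariance_sym : (Defs.covariance f)^T = Defs.covariance f.
Proof.
apply/matrixP => i j; rewrite mxE !covariance_expect; congr expect.
by apply/funext => u; rewrite mulrC.
Qed.

Lemma covariance_bound M i j : (second_moment f <= M%:E)%E ->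
  `|Defs.covariance f i j| <= (3 + 2 * M) ^+ 2 * (2 + 2 * M).
Proof.
move=> fM; have M0 : 0 <= M.
  rewrite -lee_fin; apply: le_trans fM.
  by apply: integral_ge0 => u _; have [_ f0 _] := f_density; rewrite lee_fin mulr_ge0 ?sqr_ge0.
have e1 (u : 'cV[R]_n) : 1 <= 1 + enorm u by rewrite lerDl enorm_ge0.
have mb k : `|mean f k ord0| <= 2 + 2 * M.
  rewrite meanE -[leRHS]mul1r; apply: expect_le => //.
    by apply: linear_quadratic_growth; exact: linear_growth_coord.
  move=> u; rewrite mul1r; apply: (le_trans (coord_le_enorm u k)).
  by have := enorm_ge0 u; nra.
have cb k (u : 'cV[R]_n) : `|u k ord0 - mean f k ord0| <= (3 + 2 * M) * (1 + enorm u).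
  apply: (le_trans (ler_normB _ _)).
  by have := mb k; have := coord_le_enorm u k; have := enorm_ge0 u; nra.
rewrite covariance_expect; apply: expect_le => //.
- exact: quadratic_growthM.
- by move=> u; rewrite normrM -exprMn expr2; apply: ler_pM.
- exact: sqr_ge0.
Qed.

(** The covariance in the new coordinates, through raw moments: these are
    expectations of fixed functions and can be used as test functions. *)
Lemma wcovarianceE L m0 i j : (L *m Defs.covariance f *m L^T) i j =
  expect (fun u => wcoord L m0 u i * wcoord L m0 u j) -
  expect (fun u => wcoord L m0 u i) * expect (fun u => wcoord L m0 u j).
Proof.
have lw := linear_growth_wcoord L m0.
set a := fun i => expect (fun u => wcoord L m0 u i).
have aE k : a k = wcoord L m0 (mean f) k.
  rewrite /a wcoordE.
  rewrite (_ : (fun u => _) = fun u : 'cV[R]_n => \sum_l L k l * (u l ord0 + - m0 l ord0)); last first.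
    by apply/funext => u; rewrite wcoordE.
  rewrite expect_sum => [|l]; last first.
    apply: quadratic_growthZ; apply: linear_quadratic_growth.
    by apply: linear_growthD; [exact: linear_growth_coord|exact: linear_growth_cst].
  apply: eq_bigr => l _; rewrite expectZ; last first.
    apply: linear_quadratic_growth.
    by apply: linear_growthD; [exact: linear_growth_coord|exact: linear_growth_cst].
  rewrite (@expectD (fun u : 'cV[R]_n => u l ord0) (fun _ => - m0 l ord0)) ?expect_cst ?meanE//.
    by apply: linear_quadratic_growth; exact: linear_growth_coord.
  by apply: linear_quadratic_growth; exact: linear_growth_cst.
have cE (u : 'cV[R]_n) k : wcoord L m0 u k - a k = \sum_l L k l * (u l ord0 - mean f l ord0).
  rewrite aE !wcoordE -sumrB; apply: eq_bigr => l _; ring.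
rewrite congr_mxE.
transitivity (expect (fun u => (wcoord L m0 u i - a i) * (wcoord L m0 u j - a j))).
  rewrite (_ : (fun u => _) = fun u : 'cV[R]_n => \sum_k \sum_l (L i k * L j l) *
      ((u k ord0 - mean f k ord0) * (u l ord0 - mean f l ord0))); last first.
    apply/funext => u; rewrite !cE mulr_suml; apply: eq_bigr => k _.
    by rewrite mulr_sumr; apply: eq_bigr => l _; ring.
  rewrite expect_sum => [|k]; last first.
    by apply: quadratic_growth_sum => l; apply: quadratic_growthZ; exact: quadratic_growthM.
  apply: eq_bigr => k _; rewrite expect_sum => [|l]; last first.
    by apply: quadratic_growthZ; exact: quadratic_growthM.
  apply: eq_bigr => l _; rewrite expectZ; last exact: quadratic_growthM.
  by rewrite covariance_expect mulrC.
rewrite (_ : (fun u => _) = fun u => wcoord L m0 u i * wcoord L m0 u j +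
   (- a j * wcoord L m0 u i + (- a i * wcoord L m0 u j + a i * a j))); last first.
  by apply/funext => u; ring.
have q1 k : quadratic_growth (fun u => wcoord L m0 u k) by exact: linear_quadratic_growth.
have q2 k c : quadratic_growth (fun u => c * wcoord L m0 u k) by exact: quadratic_growthZ.
have q3 c : quadratic_growth (fun _ => c).
  by apply: linear_quadratic_growth; exact: linear_growth_cst.
rewrite expectD; [|exact: quadratic_growthM|by do 2![apply: quadratic_growthD => //]].
rewrite expectD; [|by []|exact: quadratic_growthD].
rewrite expectD// !expectZ// expect_cst -/(a i) -/(a j); ring.
Qed.

End expectation.

(** * The equation tested in normalizing coordinates *)

Section derivative_rules.
Context {R : realType} {V : normedModType R}.
Implicit Types (f g : V -> R) (u v : V).

Lemma is_derive_sum_fun (I : Type) (s : seq I) (F : I -> V -> R) (dF : I -> R) u v :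
  (forall i, is_derive u v (F i) (dF i)) ->
  is_derive u v (fun w => \sum_(i <- s) F i w) (\sum_(i <- s) dF i).
Proof.
move=> h; elim: s => [|i s ih].
  rewrite big_nil (_ : (fun w => _) = cst 0); first exact: is_derive_cst.
  by apply/funext => w; rewrite big_nil.
rewrite big_cons (_ : (fun w => _) = F i + fun w => \sum_(i <- s) F i w).
  exact: is_deriveD.
by apply/funext => w; rewrite big_cons.
Qed.

Lemma is_derive_mul f g u v df dg : is_derive u v f df -> is_derive u v g dg ->
  is_derive u v (fun w => f w * g w) (df * g u + f u * dg).
Proof.
move=> hf hg; have h := is_deriveM hf hg; apply: (is_derive_eq h).
by rewrite /GRing.scale /= addrC [_ * df]mulrC.
Qed.

Lemma is_derive_add f g u v df dg : is_derive u v f df -> is_derive u v g dg ->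
  is_derive u v (fun w => f w + g w) (df + dg).
Proof. by move=> hf hg; exact: (is_deriveD hf hg). Qed.

Lemma is_derive_mulr f u v df (c : R) : is_derive u v f df ->
  is_derive u v (fun w => f w * c) (df * c).
Proof.
move=> hf; have h := is_derive_mul hf (is_derive_cst c u v); apply: (is_derive_eq h).
by rewrite mulr0 addr0.
Qed.

Lemma is_derive_mull f u v df (c : R) : is_derive u v f df ->
  is_derive u v (fun w => c * f w) (c * df).
Proof.
move=> hf; have h := is_derive_mul (is_derive_cst c u v) hf; apply: (is_derive_eq h).
by rewrite mul0r add0r.
Qed.

End derivative_rules.

Section solution.
Context {R : realType} {n : nat}.
Local Notation leb := (@lebesgue_cV R n).
Variables (Phi : 'cV[R]_n -> R) (rho0 : 'cV[R]_n -> R) (rho : R -> 'cV[R]_n -> R).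
Variables (L : 'M[R]_n) (m0 : 'cV[R]_n) (c0 : R).
Hypothesis PhiE : forall u, Phi u = 2^-1 * (\sum_a wcoord L m0 u a ^+ 2) + c0.
Hypothesis sol : fp_solution Phi rho0 rho.

Definition wcov t : 'M[R]_n := L *m Defs.covariance (rho t) *m L^T.
Local Notation w := (wcoord L m0).

Lemma is_derive_potential u i :
  is_derive u (basis_vec i) Phi ((L^T *m L *m (u - m0)) i ord0).
Proof.
rewrite (_ : Phi = fun u => 2^-1 * (\sum_a w u a * w u a) + c0); last first.
  by apply/funext => v; rewrite PhiE; under eq_bigr do rewrite expr2.
have d1 a : is_derive u (basis_vec i) (fun u => w u a * w u a) (L a i * w u a + w u a * L a i).
  by apply: is_derive_mul; exact: is_derive_wcoord.
have d2 := is_derive_mull 2^-1 (is_derive_sum_fun (index_enum 'I_n) d1).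
have d3 := is_derive_add d2 (is_derive_cst c0 u (basis_vec i)).
apply: (is_derive_eq d3); rewrite addr0 -mulmxA mxE mulr_sumr.
by apply: eq_bigr => a _; rewrite mxE -/(w u a); field.
Qed.

Lemma gradient_potential u : gradient Phi u = L^T *m L *m (u - m0).
Proof.
apply/matrixP => i j; rewrite mxE ord1 /partial.
exact: (@derive_val _ _ _ _ _ _ _ (is_derive_potential u i)).
Qed.

Lemma solution_dflux t u : 0 < t -> time_derivative rho t u =
  \sum_i dflux (rho t) (fun j => partial j (rho t))
    (fun i j => partial i (partial j (rho t))) (Defs.covariance (rho t)) (L^T *m L) m0 i u.
Proof.
move=> t0; rewrite (fp_eq sol u t0) /divergence /frobenius -big_split /=.
apply: eq_bigr => i _; rewrite /dflux; congr (_ + _); last first.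
  by apply: eq_bigr => j _; rewrite [X in _ * X]mxE.
set C := Defs.covariance (rho t).
rewrite (_ : (fun v => _) = fun v => rho t v * drift C (L^T *m L) m0 i v); last first.
  by apply/funext => v; rewrite gradient_potential mxE.
have d := is_derive_mul (rho_derive (fp_regular sol) i u t0) (is_derive_drift C (L^T *m L) m0 i u).
by rewrite {1}/partial (@derive_val _ _ _ _ _ _ _ d).
Qed.

Lemma solution_density t : 0 <= t -> prob_density (rho t).
Proof. exact: fp_density sol t. Qed.

Lemma solution_moment T : 0 < T -> exists2 M, 0 <= M &
  forall t, 0 <= t <= T -> (second_moment (rho t) <= M%:E)%E.
Proof.
move=> T0; have [[M hM] _] := fp_decay sol T0; exists M => //.
rewrite -lee_fin; apply: le_trans (hM 0 _); last by rewrite lexx ltW.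
apply: integral_ge0 => u _; have [_ f0 _] := solution_density (lexx 0).
by rewrite lee_fin mulr_ge0 ?sqr_ge0.
Qed.

Section increment.
Variables (T : R) (psi psit : R -> 'cV[R]_n -> R) (q : 'I_n -> R -> 'cV[R]_n -> R).
Variable G : 'I_n -> 'I_n -> R -> 'cV[R]_n -> R.
Let spacetime_continuous (f : R -> 'cV[R]_n -> R) : Prop := forall t u, 0 < t < T ->
  {for (t, u), continuous (fun p : R * 'cV[R]_n => f p.1 p.2)}.
Hypothesis psi_cont : spacetime_continuous psi.
Hypothesis psit_cont : spacetime_continuous psit.
Hypothesis q_cont : forall a, spacetime_continuous (q a).
Hypothesis G_cont : forall a b, spacetime_continuous (G a b).
Hypothesis psi_derive_time : forall t u, 0 < t < T ->
  is_derive t (1 : R) (fun t => psi t u) (psit t u).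
Hypothesis psi_derive : forall t k u, 0 < t < T ->
  is_derive u (basis_vec k) (psi t) (\sum_a q a t u * L a k).
Hypothesis q_derive : forall t a k u, 0 < t < T ->
  is_derive u (basis_vec k) (q a t) (\sum_b G a b t u * L b k).
Variables (s t K : R).
Hypothesis s_gt0 : 0 < s.
Hypothesis s_lt_t : s < t.
Hypothesis t_lt_T : t < T.
Hypothesis psi_le : forall tau u, s <= tau <= t -> `|psi tau u| <= K * (1 + enorm u) ^+ 2.
Hypothesis psit_le : forall tau u, s <= tau <= t -> `|psit tau u| <= K * (1 + enorm u) ^+ 2.
Hypothesis q_le : forall tau a u, s <= tau <= t -> `|q a tau u| <= K * (1 + enorm u).
Hypothesis G_le : forall tau a b u, s <= tau <= t ->
  `|G a b tau u| <= K * (1 + enorm u) ^+ 2.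

Definition wrate tau : R := expect (rho tau) (fun u =>
  wgenerator (wcov tau) (psit tau u) (fun a => q a tau u) (fun a b => G a b tau u) (w u)).

(** [tested_increment] in the new coordinates: [q] and [G] are the gradient and
    the Hessian of [psi] there. *)
Lemma expect_increment c eps : 0 <= eps ->
  (forall tau, s <= tau <= t -> `|wrate tau - c| <= eps) ->
  `|expect (rho t) (psi t) - expect (rho s) (psi s) - c * (t - s)| <= eps * (t - s).
Proof.
move=> eps0 rc.
have T0 : 0 < T by rewrite (lt_trans s_gt0) ?(lt_trans s_lt_t).
have [M M0 hM] := solution_moment T0.
have ss : s <= s <= t by rewrite lexx ltW.
have K0 : 0 <= K.
  have := psi_le 0 ss; have := normr_ge0 (psi s 0) => a b; have := le_trans a b.
  have e := enorm_ge0 (0 : 'cV[R]_n).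
  by rewrite pmulr_lge0// exprn_gt0// ltr_pwDl.
pose l : R := 1 + \sum_a \sum_k `|L a k|.
have S0 : 0 <= \sum_a \sum_k `|L a k| by apply: sumr_ge0 => a _; exact: sumr_ge0.
have l1 : 1 <= l by rewrite lerDl.
have colL k : \sum_a `|L a k| <= l.
  apply: (@le_trans _ _ (\sum_k \sum_a `|L a k|)).
    by rewrite [leRHS](bigD1 k)//= lerDl sumr_ge0// => j _; exact: sumr_ge0.
  by rewrite exchange_big lerDr.
have Kl2 : K <= K * l ^+ 2 by rewrite ler_peMr// exprn_ege1.
have e1 (u : 'cV[R]_n) : 1 <= 1 + enorm u by rewrite lerDl enorm_ge0.
have w0 (u : 'cV[R]_n) : 0 <= (1 + enorm u) ^+ 2 by exact: sqr_ge0.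
apply: (@tested_increment R n rho (fun t => Defs.covariance (rho t)) (L^T *m L) m0 T M
  ((3 + 2 * M) ^+ 2 * (2 + 2 * M)) T0 (fp_regular sol) solution_density hM _ _ _ _
  psi psit (fun k t u => \sum_a q a t u * L a k)
  (fun k j t u => \sum_a \sum_b G a b t u * (L a k * L b j)) _ _ _ _ _ _ _ s t
  (K * l ^+ 2)) => //.
- by have [_] := fp_decay sol T0.
- by rewrite mulr_ge0 ?sqr_ge0 ?addr_ge0 ?mulr_ge0.
- move=> tau i j /andP[a b]; apply: covariance_bound; [exact: solution_density (ltW a)| |].
    exact: (fp_moment sol (ltW a)).
  by apply: hM; rewrite !ltW.
- by move=> tau u tau0; exact: solution_dflux.
- move=> k tau u tT; apply: cvg_sum_seq => a; apply: cvgM; last exact: cvg_cst.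
  exact: q_cont.
- move=> k j tau u tT; apply: cvg_sum_seq => a; apply: cvg_sum_seq => b.
  by apply: cvgM; [exact: G_cont|exact: cvg_cst].
- move=> tau k j u tT.
  have d := is_derive_sum_fun (index_enum 'I_n) (fun a => is_derive_mulr (L a k) (q_derive a j u tT)).
  apply: (is_derive_eq d); apply: eq_bigr => a _; rewrite mulr_suml.
  by apply: eq_bigr => b _; ring.
- by move=> tau u h; apply: (le_trans (psi_le u h)); rewrite ler_wpM2r.
- by move=> tau u h; apply: (le_trans (psit_le u h)); rewrite ler_wpM2r.
- move=> tau k u h; apply: (le_trans (ler_norm_sum _ _ _)).
  apply: (@le_trans _ _ (\sum_a (K * (1 + enorm u)) * `|L a k|)).
    by apply: ler_sum => a _; rewrite normrM ler_wpM2r// q_le.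
  rewrite -mulr_sumr mulrAC ler_wpM2r ?(le_trans ler01)//; last first.
  rewrite ler_wpM2l//; apply: (le_trans (colL k)); rewrite expr2 ler_peMr//.
  exact: le_trans l1.
- move=> tau k j u h; apply: (le_trans (ler_norm_sum _ _ _)).
  apply: (@le_trans _ _ (\sum_a (K * (1 + enorm u) ^+ 2) * (`|L a k| * \sum_b `|L b j|))).
    apply: ler_sum => a _; apply: (le_trans (ler_norm_sum _ _ _)).
    rewrite !mulr_sumr; apply: ler_sum => b _; rewrite !normrM ler_wpM2r ?mulr_ge0//.
    exact: G_le.
  rewrite -mulr_sumr mulrAC ler_wpM2r// ler_wpM2l// -mulr_suml expr2.
  by apply: ler_pM => //; exact: sumr_ge0.
- move=> tau st; rewrite (_ : tested_rate _ _ _ _ _ _ _ _ = wrate tau)//; first exact: rc.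
  congr Rintegral; apply/funext => u; congr (_ * _).
  exact: (generatorE L m0 _ (psit tau) (fun a => q a tau) (fun a b => G a b tau)).
Qed.

End increment.
End solution.

(** * Evolution of the covariance *)

Section covariance_spd.
Context {R : realType} {n : nat}.
Local Notation leb := (@lebesgue_cV R n).

(** A density whose covariance has a null direction [x] vanishes off a
    hyperplane transverse to [x], hence everywhere if it is continuous. *)
Lemma covariance_spd (f : 'cV[R]_n -> R) : prob_density f ->
  (second_moment f < +oo)%E -> continuous f -> spd (Defs.covariance f).
Proof.
move=> fd fm cf; have [mf f0 f1] := fd.
split; first by rewrite covariance_sym.
move=> x x0; set m := mean f.
pose p (u : 'cV[R]_n) := \sum_k x k ord0 * (u k ord0 - m k ord0).
have cg k : linear_growth (fun u : 'cV[R]_n => u k ord0 - m k ord0).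
  by apply: linear_growthD; [exact: linear_growth_coord|exact: linear_growth_cst].
have qE : (x^T *m Defs.covariance f *m x) ord0 ord0 = expect f (fun u => p u ^+ 2).
  rewrite (_ : (fun u => _) = fun u : 'cV[R]_n => \sum_l \sum_k (x k ord0 * x l ord0) *
      ((u k ord0 - m k ord0) * (u l ord0 - m l ord0))); last first.
    apply/funext => u; rewrite expr2 /p mulr_sumr; apply: eq_bigr => l _.
    by rewrite mulr_suml; apply: eq_bigr => k _; ring.
  rewrite expect_sum// => [|l]; last first.
    by apply: quadratic_growth_sum => k; apply: quadratic_growthZ; exact: quadratic_growthM.
  rewrite mxE; apply: eq_bigr => l _; rewrite mxE mulr_suml expect_sum// => [|k]; last first.
    by apply: quadratic_growthZ; exact: quadratic_growthM.
  apply: eq_bigr => k _; rewrite mxE expectZ//; last exact: quadratic_growthM.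
  by rewrite covariance_expect -/m; ring.
have pc : continuous p.
  by apply: continuous_sum => k; apply: continuous_mul; [exact: cst_continuous|exact: (cg k).1].
have fp0 u : 0 <= f u * p u ^+ 2 by rewrite mulr_ge0// sqr_ge0.
have cfp : continuous (fun u => f u * p u ^+ 2).
  by apply: continuous_mul => //; under eq_fun do rewrite expr2; exact: continuous_mul.
rewrite qE lt_neqAle; apply/andP; split; last exact: Rintegral_ge0.
apply/negP => /eqP /esym e0.
have qg : quadratic_growth (fun u => p u ^+ 2).
  have lp : linear_growth p.
    split=> //; have h k := (cg k).2; exists (\sum_k `|x k ord0| * (1 + `|m k ord0|)) => u.
    rewrite mulr_suml; apply: (le_trans (ler_norm_sum _ _ _)); apply: ler_sum => k _.
    rewrite normrM -mulrA ler_wpM2l//; apply: (le_trans (ler_normB _ _)).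
    have := coord_le_enorm u k; have := enorm_ge0 u; have := normr_ge0 (m k ord0); nra.
  by under eq_fun do rewrite expr2; exact: quadratic_growthM.
have z0 : forall u, f u * p u ^+ 2 = 0.
  apply: continuous_ge0_integral_eq0 => //.
  have ifp := expect_integrable fd fm qg.
  by rewrite -[LHS]fineK ?integrable_fin_num//; congr EFin; exact: e0.
have fz u : f u = 0.
  have [pu|pu] := eqVneq (p u) 0; last first.
    have /eqP := z0 u; rewrite mulf_eq0 sqrf_eq0 (negbTE pu) orbF => /eqP; exact.
  have pl h : p (u + h *: x) = h * \sum_k x k ord0 ^+ 2.
    transitivity (p u + h * \sum_k x k ord0 ^+ 2); last by rewrite pu add0r.
    rewrite /p mulr_sumr -big_split /=; apply: eq_bigr => k _.
    by rewrite !mxE; ring.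
  have lc : f (u + h *: x) @[h --> (0 : R)^'] --> f u.
    apply: (cvg_comp (fun h : R => u + h *: x) f); last first.
      exact: cf.
    suff h : u + h *: x @[h --> (0 : R)^'] --> u + (0 : R) *: x.
      by move: h; rewrite scale0r addr0.
    apply: cvgD; first exact: cvg_cst.
    apply: (@cvg_trans _ (h *: x @[h --> (0 : R)])); last exact: scalel_continuous.
    by move=> A hA; exact: (nbhs_dnbhs hA).
  have lz : f (u + h *: x) @[h --> (0 : R)^'] --> (0 : R).
    apply: (@cvg_trans _ (cst (0 : R) h @[h --> (0 : R)^'])); last exact: cvg_cst.
    apply: near_eq_cvg; near=> h; have h0 : h != 0 by near: h; exact: nbhs_dnbhs_neq.
    have /eqP := z0 (u + h *: x); rewrite mulf_eq0 sqrf_eq0 pl mulf_eq0 (negbTE h0) /=.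
    by rewrite (gt_eqF (sum_sqr_gt0 x0)) orbF => /eqP ->.
  by apply: (cvg_unique _ lc lz).
have : (\int[leb]_u (f u)%:E = 0)%E by apply: integral0_eq => u _; rewrite fz.
by rewrite f1 => /eqP; rewrite eqe oner_eq0.
Unshelve. all: by end_near. Qed.

End covariance_spd.

Lemma sum_delta (R : realType) n (X : 'I_n -> R) i :
  \sum_a X a * (a == i)%:R = X i.
Proof.
rewrite (bigD1 i)//= eqxx mulr1 big1 ?addr0// => a ai.
by rewrite (negbTE ai) mulr0.
Qed.

Section covariance_evolution.
Context {R : realType} {n : nat}.
Local Notation leb := (@lebesgue_cV R n).
Variables (Phi : 'cV[R]_n -> R) (rho0 : 'cV[R]_n -> R) (rho : R -> 'cV[R]_n -> R).
Variables (L : 'M[R]_n) (m0 : 'cV[R]_n) (c0 : R).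
Hypothesis PhiE : forall u, Phi u = 2^-1 * (\sum_a wcoord L m0 u a ^+ 2) + c0.
Hypothesis sol : fp_solution Phi rho0 rho.
Local Notation w := (wcoord L m0).
Local Notation W := (wcov rho L).

Definition wmean i t : R := expect (rho t) (fun u => w u i).
Definition wsecond i j t : R := expect (rho t) (fun u => w u i * w u j).

Let lw i : linear_growth (fun u => w u i) := @linear_growth_wcoord R n L m0 i.
Let qw i : quadratic_growth (fun u => w u i) := linear_quadratic_growth (lw i).
Let qww i j : quadratic_growth (fun u => w u i * w u j) := quadratic_growthM (lw i) (lw j).
Let k0 : 0 <= wcoord_cst L m0 := wcoord_cst_ge0 L m0.
Let dens t : 0 <= t -> prob_density (rho t) := @fp_density _ _ _ _ _ sol t.
Let mom t : 0 <= t -> (second_moment (rho t) < +oo)%E := @fp_moment _ _ _ _ _ sol t.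

Lemma wcovE t i j : 0 <= t -> W t i j = wsecond i j t - wmean i t * wmean j t.
Proof. by move=> t0; rewrite /wcov (wcovarianceE (dens t0) (mom t0) L m0). Qed.

Lemma wcov_sym t i j : W t i j = W t j i.
Proof.
have : (W t)^T = W t by rewrite /wcov !trmx_mul trmxK covariance_sym mulmxA.
by move=> /matrixP/(_ j i); rewrite mxE.
Qed.

(** Boundedness on bounded time intervals is all that the decay assumption gives;
    continuity and the differential equations follow from it. *)
Lemma wmoments_bounded T : 0 < T -> exists2 K, 0 <= K & forall t, 0 <= t <= T ->
  (forall i, `|wmean i t| <= K) /\ forall i j, `|wsecond i j t| <= K /\ `|W t i j| <= K.
Proof.
move=> T0; have [M M0 hM] := solution_moment sol T0.
set k := wcoord_cst L m0; have k0' : 0 <= k by exact: k0.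
have b1 t i : 0 <= t <= T -> `|wmean i t| <= k * (2 + 2 * M).
  move=> tT; have [t0 _] := andP tT; apply: (expect_le (dens t0) (mom t0)) => //; last exact: hM.
  move=> u; apply: (le_trans (wcoord_le L m0 u i)); rewrite ler_wpM2l//.
  by have := enorm_ge0 u; nra.
have b2 t i j : 0 <= t <= T -> `|wsecond i j t| <= k ^+ 2 * (2 + 2 * M).
  move=> tT; have [t0 _] := andP tT; apply: (expect_le (dens t0) (mom t0)) => //.
  - move=> u; rewrite normrM -exprMn expr2; apply: ler_pM => //; exact: wcoord_le.
  - exact: sqr_ge0.
  - exact: hM.
set K1 := k * (2 + 2 * M); set K2 := k ^+ 2 * (2 + 2 * M).
have K10 : 0 <= K1 by rewrite mulr_ge0// addr_ge0// mulr_ge0.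
have K20 : 0 <= K2 by rewrite mulr_ge0 ?sqr_ge0// addr_ge0// mulr_ge0.
exists (K1 + K2 + K1 * K1) => [|t tT]; first by rewrite !addr_ge0// mulr_ge0.
have K11 : 0 <= K1 * K1 by rewrite mulr_ge0.
split=> [i|i j]; first by have := b1 t i tT; rewrite -/K1; lra.
have c2 := b2 t i j tT; rewrite -/K2 in c2; split; first lra.
have [t0 _] := andP tT; rewrite wcovE//; apply: (le_trans (ler_normB _ _)).
have : `|wmean i t * wmean j t| <= K1 * K1.
  by rewrite normrM; apply: ler_pM => //; exact: b1.
lra.
Qed.

Definition wmean_rate i t : R := - \sum_b W t i b * wmean b t.
Definition wsecond_rate i j t : R :=
  - (\sum_b W t i b * wsecond b j t) - (\sum_b W t j b * wsecond b i t)
  + (W t i j + W t j i).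

Lemma wmean_increment i s t c eps : 0 < s -> s < t -> 0 <= eps ->
  (forall tau, s <= tau <= t -> `|wmean_rate i tau - c| <= eps) ->
  `|wmean i t - wmean i s - c * (t - s)| <= eps * (t - s).
Proof.
move=> s0 st eps0 rc; set k := wcoord_cst L m0.
have e0 := @enorm_ge0 R n.
apply: (@expect_increment R n Phi rho0 rho L m0 c0 PhiE sol (t + 1)
  (fun _ u => w u i) (fun _ _ => 0) (fun a _ _ => (a == i)%:R) (fun _ _ _ _ => 0)
  _ _ _ _ _ _ _ s t (1 + k)) => //.
- move=> tau u _; apply: (@continuous_comp _ _ _ snd (fun u => w u i)).
    exact: cvg_snd.
  exact: continuous_wcoord.
- by move=> tau u _; exact: cvg_cst.
- by move=> a tau u _; exact: cvg_cst.
- by move=> a b tau u _; exact: cvg_cst.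
- by move=> tau u _; exact: is_derive_cst.
- by move=> tau k' u _; under eq_bigr do rewrite mulrC; rewrite sum_delta; exact: is_derive_wcoord.
- by move=> tau a k' u _; under eq_bigr do rewrite mul0r; rewrite big1//; exact: is_derive_cst.
- by rewrite ltrDl.
- move=> tau u _; apply: (le_trans (wcoord_le L m0 u i)).
  by have := e0 u; have := k0; rewrite -/k; nra.
- by move=> tau u _; rewrite normr0 mulr_ge0 ?sqr_ge0// addr_ge0.
- move=> tau a u _; apply: (@le_trans _ _ 1).
    by case: eqP => _; rewrite ?normr1 ?normr0.
  by have := e0 u; have := k0; rewrite -/k; nra.
- by move=> tau a b u _; rewrite normr0 mulr_ge0 ?sqr_ge0// addr_ge0.
- move=> tau /[dup] ss /andP[h _]; have tau0 : 0 <= tau by rewrite (le_trans (ltW s0)).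
  rewrite (_ : wrate _ _ _ _ _ _ _ = wmean_rate i tau); first exact: rc.
  rewrite /wrate (_ : (fun u => _) = fun u => \sum_b (- W tau i b) * w u b); last first.
    apply/funext => u; rewrite /wgenerator sum_delta.
    rewrite [X in _ + X]big1 => [|a _]; last by apply: big1 => b _; rewrite mulr0.
    by rewrite addr0 sub0r -sumrN; apply: eq_bigr => b _; rewrite mulNr.
  rewrite (expect_sum (dens tau0) (mom tau0)) => [|b]; last exact: quadratic_growthZ.
  rewrite /wmean_rate -sumrN; apply: eq_bigr => b _.
  by rewrite (expectZ (dens tau0) (mom tau0))// mulNr.
Qed.

Lemma wsecond_increment i j s t c eps : 0 < s -> s < t -> 0 <= eps ->
  (forall tau, s <= tau <= t -> `|wsecond_rate i j tau - c| <= eps) ->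
  `|wsecond i j t - wsecond i j s - c * (t - s)| <= eps * (t - s).
Proof.
move=> s0 st eps0 rc; set k := wcoord_cst L m0.
have e0 := @enorm_ge0 R n; have k0' : 0 <= k by exact: k0.
pose dl (a b : 'I_n) : R := (a == b)%:R.
have dl1 a b : `|dl a b| <= 1 by rewrite /dl; case: eqP => _; rewrite ?normr1 ?normr0.
apply: (@expect_increment R n Phi rho0 rho L m0 c0 PhiE sol (t + 1)
  (fun _ u => w u i * w u j) (fun _ _ => 0)
  (fun a _ u => w u j * dl a i + w u i * dl a j)
  (fun a b _ _ => dl b j * dl a i + dl b i * dl a j)
  _ _ _ _ _ _ _ s t (2 + 2 * k + k ^+ 2)) => //.
- move=> tau u _; apply: (@continuous_comp _ _ _ snd (fun u => w u i * w u j)).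
    exact: cvg_snd.
  exact: (qww i j).1.
- by move=> tau u _; exact: cvg_cst.
- move=> a tau u _; apply: (@continuous_comp _ _ _ snd (fun u => w u j * dl a i + w u i * dl a j)).
    exact: cvg_snd.
  by apply: continuous_add; apply: continuous_mul;
    [exact: continuous_wcoord|exact: cst_continuous|exact: continuous_wcoord|exact: cst_continuous].
- by move=> a b tau u _; exact: cvg_cst.
- by move=> tau u _; exact: is_derive_cst.
- move=> tau k' u _.
  have d := is_derive_mul (is_derive_wcoord L m0 i k' u) (is_derive_wcoord L m0 j k' u).
  apply: (is_derive_eq d).
  rewrite (eq_bigr (fun a => (w u j * L a k') * dl a i + (w u i * L a k') * dl a j)).
    by rewrite big_split /= !sum_delta; ring.
  by move=> a _; ring.
- move=> tau a k' u _.
  have d := is_derive_add (is_derive_mulr (dl a i) (is_derive_wcoord L m0 j k' u))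
    (is_derive_mulr (dl a j) (is_derive_wcoord L m0 i k' u)).
  apply: (is_derive_eq d).
  rewrite (eq_bigr (fun b => (dl a i * L b k') * dl b j + (dl a j * L b k') * dl b i)).
    by rewrite big_split /= !sum_delta; ring.
  by move=> b _; ring.
- by rewrite ltrDl.
- move=> tau u _; apply: (@le_trans _ _ ((k * (1 + enorm u)) * (k * (1 + enorm u)))).
    by rewrite normrM; apply: ler_pM => //; exact: wcoord_le.
  by rewrite mulrACA -!expr2 ler_wpM2r ?sqr_ge0//; lra.
- by move=> tau u _; rewrite normr0; apply: mulr_ge0; [have := sqr_ge0 k; lra|exact: sqr_ge0].
- move=> tau a u _; apply: (le_trans (ler_normD _ _)); rewrite !normrM.
  have h1 := wcoord_le L m0 u i; have h2 := wcoord_le L m0 u j.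
  have g1 : `|w u j| * `|dl a i| <= k * (1 + enorm u).
    by rewrite -[leRHS]mulr1; apply: ler_pM.
  have g2 : `|w u i| * `|dl a j| <= k * (1 + enorm u).
    by rewrite -[leRHS]mulr1; apply: ler_pM.
  have := e0 u; have := sqr_ge0 k; nra.
- move=> tau a b u _; apply: (@le_trans _ _ 2).
    apply: (le_trans (ler_normD _ _)); rewrite !normrM [leRHS](_ : 2 = 1 * 1 + 1 * 1 :> R); last ring.
    by apply: lerD; apply: ler_pM.
  have := e0 u; have := sqr_ge0 k; set x := k ^+ 2; set y := enorm u; move=> x0 y0.
  by have : 1 <= (1 + y) ^+ 2 by [rewrite exprn_ege1// lerDl]; nra.
- move=> tau /[dup] ss /andP[h _]; have tau0 : 0 <= tau by rewrite (le_trans (ltW s0)).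
  rewrite (_ : wrate _ _ _ _ _ _ _ = wsecond_rate i j tau); first exact: rc.
  rewrite /wrate (_ : (fun u => _) = fun u =>
     (\sum_b (- W tau i b) * (w u b * w u j) + \sum_b (- W tau j b) * (w u b * w u i))
     + (W tau i j + W tau j i)); last first.
    apply/funext => u; rewrite /wgenerator sub0r; congr (_ + _); last first.
      rewrite (eq_bigr (fun a => W tau a j * dl a i + W tau a i * dl a j)).
        by rewrite big_split /= !sum_delta.
      move=> a _; rewrite (eq_bigr (fun b => (dl a i * W tau a b) * dl b j + (dl a j * W tau a b) * dl b i)).
        by rewrite big_split /= !sum_delta mulrC [X in _ + X]mulrC.
      by move=> b _; ring.
    rewrite (eq_bigr (fun a => (w u j * \sum_b W tau a b * w u b) * dl a i +
        (w u i * \sum_b W tau a b * w u b) * dl a j)); last by move=> a _; ring.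
    rewrite big_split /= !sum_delta opprD -!mulrN -!sumrN !mulr_sumr.
    by congr (_ + _); apply: eq_bigr => b _; ring.
  have qs c' i' j' : quadratic_growth (fun u => c' * (w u i' * w u j')) by exact: quadratic_growthZ.
  have qss c' i' : quadratic_growth (fun u => \sum_b c' b * (w u b * w u i')).
    exact: quadratic_growth_sum.
  have qc c' : quadratic_growth (fun _ : 'cV[R]_n => c').
    by apply: linear_quadratic_growth; exact: linear_growth_cst.
  have [hd hm] := (dens tau0, mom tau0).
  rewrite (expectD hd hm) ?(expectD hd hm) ?(expect_cst hd)//; last exact: quadratic_growthD.
  rewrite !(expect_sum hd hm)// /wsecond_rate -!sumrN; congr (_ + _ + _).
    by apply: eq_bigr => b _; rewrite (expectZ hd hm)// mulNr.
  by apply: eq_bigr => b _; rewrite (expectZ hd hm)// mulNr.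
Qed.

Let sum_bound (K : R) (x y : 'I_n -> R) : (forall b, `|x b| <= K) -> (forall b, `|y b| <= K) ->
  0 <= K -> `|\sum_b x b * y b| <= n%:R * (K * K).
Proof.
move=> hx hy K0; apply: (le_trans (ler_norm_sum _ _ _)).
apply: (@le_trans _ _ (\sum_(b < n) K * K)); last by rewrite sumr_const card_ord mulr_natl.
by apply: ler_sum => b _; rewrite normrM; apply: ler_pM.
Qed.

Lemma wmean_rate_bounded i T : 0 < T -> exists K, forall t, 0 < t < T -> `|wmean_rate i t| <= K.
Proof.
move=> T0; have [K K0 hK] := wmoments_bounded T0; exists (n%:R * (K * K)) => t /andP[t0 tT].
have [h1 h2] : (forall i, `|wmean i t| <= K) /\ forall i j, `|wsecond i j t| <= K /\ `|W t i j| <= K.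
  by apply: hK; rewrite !ltW.
rewrite /wmean_rate normrN; apply: sum_bound => // b; first exact: (h2 i b).2.
Qed.

Lemma wsecond_rate_bounded i j T : 0 < T ->
  exists K, forall t, 0 < t < T -> `|wsecond_rate i j t| <= K.
Proof.
move=> T0; have [K K0 hK] := wmoments_bounded T0.
exists (n%:R * (K * K) + n%:R * (K * K) + (K + K)) => t /andP[t0 tT].
have [h1 h2] : (forall i, `|wmean i t| <= K) /\ forall i j, `|wsecond i j t| <= K /\ `|W t i j| <= K.
  by apply: hK; rewrite !ltW.
have hs a c : `|\sum_b W t a b * wsecond b c t| <= n%:R * (K * K).
  by apply: sum_bound => // b; [exact: (h2 _ _).2|exact: (h2 _ _).1].
rewrite /wsecond_rate; apply: (le_trans (ler_normD _ _)); apply: lerD.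
  apply: (le_trans (ler_normB _ _)); rewrite normrN; exact: lerD.
by apply: (le_trans (ler_normD _ _)); apply: lerD; exact: (h2 _ _).2.
Qed.

Lemma wmean_continuous i t : 0 < t -> {for t, continuous (wmean i)}.
Proof.
apply: (increment_continuous (r := wmean_rate i)); first exact: wmean_increment.
exact: wmean_rate_bounded.
Qed.

Lemma wsecond_continuous i j t : 0 < t -> {for t, continuous (wsecond i j)}.
Proof.
apply: (increment_continuous (r := wsecond_rate i j)); first exact: wsecond_increment.
exact: wsecond_rate_bounded.
Qed.

Lemma wcov_continuous i j t : 0 < t -> {for t, continuous (fun t => W t i j)}.
Proof.
move=> t0.
have h : wsecond i j s - wmean i s * wmean j s @[s --> t] -->
    wsecond i j t - wmean i t * wmean j t.
  apply: cvgB; first exact: wsecond_continuous.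
  by apply: cvgM; exact: wmean_continuous.
rewrite -(wcovE i j (ltW t0)) in h; apply: cvg_trans h.
apply: near_eq_cvg; near=> s; rewrite wcovE//.
by apply: ltW; near: s; exact: lt_nbhsr.
Unshelve. all: by end_near. Qed.

Lemma is_derive_wmean i (t : R) : 0 < t -> is_derive t (1 : R) (wmean i) (wmean_rate i t).
Proof.
move=> t0; apply: increment_derive => //; first exact: wmean_increment.
apply: cvgN; apply: cvg_sum_seq => b.
by apply: cvgM; [exact: wcov_continuous|exact: wmean_continuous].
Qed.

Lemma is_derive_wsecond i j (t : R) : 0 < t ->
  is_derive t (1 : R) (wsecond i j) (wsecond_rate i j t).
Proof.
move=> t0; apply: increment_derive => //; first exact: wsecond_increment.
apply: cvgD; last by apply: cvgD; exact: wcov_continuous.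
apply: cvgB; last first.
  by apply: cvg_sum_seq => b; apply: cvgM; [exact: wcov_continuous|exact: wsecond_continuous].
apply: cvgN; apply: cvg_sum_seq => b.
by apply: cvgM; [exact: wcov_continuous|exact: wsecond_continuous].
Qed.

(** The covariance solves a closed Riccati equation [W' = 2 W - 2 W^2]: the
    contributions of the mean cancel. *)
Lemma is_derive_wcov i j (t : R) : 0 < t ->
  is_derive t (1 : R) (fun t => W t i j) (2 * W t i j - 2 * \sum_b W t i b * W t b j).
Proof.
move=> t0.
have d := is_derive_add (is_derive_wsecond i j t0) (is_derive_mull (-1)
  (is_derive_mul (is_derive_wmean i t0) (is_derive_wmean j t0))).
apply: (@near_eq_is_derive _ _ _ (fun t => wsecond i j t + -1 * (wmean i t * wmean j t))).
  near=> s; rewrite wcovE ?mulN1r//; apply: ltW; near: s; exact: lt_nbhsr.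
apply: (is_derive_eq d); rewrite /wsecond_rate /wmean_rate (wcov_sym t j i).
have e1 : \sum_b W t i b * W t b j = \sum_b W t i b * wsecond b j t - (\sum_b W t i b * wmean b t) * wmean j t.
  rewrite mulr_suml -sumrB; apply: eq_bigr => b _; rewrite (wcovE b j (ltW t0)); ring.
have e2 : \sum_b W t i b * W t b j = \sum_b W t j b * wsecond b i t - (\sum_b W t j b * wmean b t) * wmean i t.
  rewrite mulr_suml -sumrB; apply: eq_bigr => b _.
  by rewrite (wcov_sym t i b) (wcov_sym t b j) (wcovE b i (ltW t0)); ring.
rewrite (_ : 2 * \sum_b W t i b * W t b j = \sum_b W t i b * W t b j + \sum_b W t i b * W t b j); last by ring.
rewrite {1}e1 e2; ring.
Unshelve. all: by end_near. Qed.

End covariance_evolution.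

Section covariance_formula.
Context {R : realType} {n : nat}.
Variables (Phi : 'cV[R]_n -> R) (rho0 : 'cV[R]_n -> R) (rho : R -> 'cV[R]_n -> R).
Variables (L : 'M[R]_n) (m0 : 'cV[R]_n) (c0 : R) (l : 'rV[R]_n).
Hypothesis L_unit : L \in unitmx.
Hypothesis PhiE : forall u, Phi u = 2^-1 * (\sum_a wcoord L m0 u a ^+ 2) + c0.
Hypothesis sol : fp_solution Phi rho0 rho.
Hypothesis wcov1 : wcov rho L 1 = diag_mx l.
Hypothesis l_gt0 : forall i, 0 < l ord0 i.
Local Notation W := (wcov rho L).

Lemma solution_covariance_spd t : 0 < t -> spd (Defs.covariance (rho t)).
Proof.
move=> t0; apply: covariance_spd.
- exact: (fp_density sol (ltW t0)).
- exact: (fp_moment sol (ltW t0)).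
- by apply: rho_continuous => //; exact: (fp_regular sol).
Qed.

Lemma wcov_diag_gt0 t i : 0 < t -> 0 < W t i i.
Proof.
move=> t0; have Lt : L^T \in unitmx by rewrite unitmx_tr.
have [_ /(_ (delta_mx i (ord0 : 'I_1)))] := spd_congr Lt (solution_covariance_spd t0).
rewrite trmxK -/(W t) => h.
have {h} : 0 < ((delta_mx i (ord0 : 'I_1))^T *m W t *m delta_mx i (ord0 : 'I_1)) ord0 ord0.
  by apply: h; apply/negP => /eqP/colP/(_ i)/eqP; rewrite !mxE !eqxx oner_eq0.
by rewrite trmx_delta -rowE -colE !mxE.
Qed.

Let E j (t : R) : R := l ord0 j + (1 - l ord0 j) * expR (2 + - 2 * t).
Let Z i j (t : R) : R := (i == j)%:R * l ord0 j - W t i j * E j t.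

Let dE j (t : R) : is_derive t (1 : R) (E j) (- 2 * (E j t - l ord0 j)).
Proof.
have d1 : is_derive t (1 : R) (fun t : R => 2 + - 2 * t) (- 2).
  apply: (@is_derive_quadratic _ _ _ _ 0) => h.
  by rewrite mul0r [X in `|X|](_ : _ = 0) ?normr0//; ring.
pose g (t : R) := 2 + - 2 * t.
have d2 : is_derive t (1 : R) (fun t => expR (g t)) (expR (g t) * - 2).
  exact: (is_derive1_comp (is_derive_expR (g t)) d1).
have d3 := is_derive_add (is_derive_cst (l ord0 j) t (1 : R)) (is_derive_mull (1 - l ord0 j) d2).
by apply: (is_derive_eq d3); rewrite /E /g; ring.
Qed.

Let dZ i j (t : R) : 0 < t -> is_derive t (1 : R) (Z i j) (- 2 * \sum_b W t i b * Z b j t).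
Proof.
move=> t0; have d1 := is_derive_mul (is_derive_wcov PhiE sol i j t0) (dE j t).
have d2 := is_derive_add (is_derive_cst ((i == j)%:R * l ord0 j) t (1 : R)) (is_derive_mull (-1) d1).
rewrite (_ : Z i j = fun t => (i == j)%:R * l ord0 j + -1 * (W t i j * E j t)); last first.
  by apply/funext => s; rewrite mulN1r.
apply: (is_derive_eq d2).
have -> : \sum_b W t i b * Z b j t = W t i j * l ord0 j - (\sum_b W t i b * W t b j) * E j t.
  rewrite mulr_suml -[X in X - _](sum_delta (fun b => W t i b * l ord0 j)) -sumrB.
  by apply: eq_bigr => b _; rewrite /Z; ring.
by ring.
Qed.

(** Subtracting the expected solution of the Riccati equation, cleared of its
    denominator, leaves a linear homogeneous equation [Z' = - 2 W Z]. *)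
Let Z_eq0 t i j : 0 < t -> Z i j t = 0.
Proof.
move=> t0; have T0 : 0 < t + 2 by lra.
have [K K0 hK] := wmoments_bounded L m0 sol T0.
pose f (s : R) := \sum_i Z i j s * Z i j s.
pose f' (s : R) := \sum_i ((- 2 * \sum_b W s i b * Z b j s) * Z i j s +
  Z i j s * (- 2 * \sum_b W s i b * Z b j s)).
have f0 s : 0 <= f s by apply: sumr_ge0 => b _; rewrite -expr2 sqr_ge0.
have : f t = 0.
  apply: (@gronwall_eq0 _ f f' (t + 2) (4 * K * n%:R) 1) => //.
  - move=> s /andP[s0 _]; apply: is_derive_sum_fun => a.
    by apply: is_derive_mul; exact: dZ.
  - move=> s /andP[s0 sT]; have [_ hW] : (forall i, `|wmean rho L m0 i s| <= K) /\
        forall i j, `|wsecond rho L m0 i j s| <= K /\ `|W s i j| <= K.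
      by apply: hK; rewrite !ltW.
    apply: (le_trans (ler_norm_sum _ _ _)).
    apply: (@le_trans _ _ (\sum_a \sum_b (2 * K * (Z a j s * Z a j s) + 2 * K * (Z b j s * Z b j s)))).
      apply: ler_sum => a _.
      rewrite (_ : _ + _ = - 4 * \sum_b W s a b * (Z b j s * Z a j s)); last first.
        rewrite mulrC -mulrDr -mulrDl -[in LHS]mulr2n mulr_sumr.
        rewrite -mulr_natl mulr_sumr mulr_sumr; apply: eq_bigr => b _; ring.
      rewrite normrM normrN (ger0_norm (ler0n _ 4)) -ler_pdivlMl ?ltr0n//.
      apply: (le_trans (ler_norm_sum _ _ _)); rewrite mulr_sumr.
      apply: ler_sum => b _; rewrite normrM.
      apply: (@le_trans _ _ (K * `|Z b j s * Z a j s|)); first by rewrite ler_wpM2r// (hW a b).2.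
      rewrite [leRHS](_ : _ = K * ((Z a j s * Z a j s + Z b j s * Z b j s) / 2)); last by field.
      rewrite ler_wpM2l// ler_norml; apply/andP; split.
        by have := sqr_ge0 (Z a j s + Z b j s); rewrite expr2; lra.
      by have := sqr_ge0 (Z a j s - Z b j s); rewrite expr2; lra.
    under eq_bigr do rewrite big_split /= sumr_const card_ord -mulr_sumr -/(f s).
    rewrite big_split /= sumr_const card_ord sumrMnl -mulr_sumr -/(f s).
    by rewrite -(mulr_natr (2 * K * f s) n) le_eqVlt; apply/orP; left; apply/eqP; ring.
  - lra.
  - rewrite /f big1// => a _; rewrite /Z wcov1 mxE eq_sym /E (_ : 2 + -2 * 1 = 0); last by ring.
    rewrite expR0; case: eqP => [->|_]; rewrite ?mulr1n ?mulr0n; ring.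
  - by rewrite t0/=; lra.
move=> /eqP; rewrite psumr_eq0 => [/allP/(_ i (mem_index_enum _))|a _]; last first.
  by rewrite -expr2 sqr_ge0.
by rewrite /= mulf_eq0 orbb => /eqP.
Qed.

(** In the eigenbasis at time [1] the covariance is diagonal at all times. The
    bound [-1 < k i] says that it stays bounded as [t] tends to [0]. *)
Theorem wcov_formula : exists k : 'I_n -> R, (forall i, -1 < k i) /\
  forall t i j, 0 < t -> W t i j = (i == j)%:R * (expR (2 * t) / (expR (2 * t) + k i)).
Proof.
pose k i := (1 - l ord0 i) * expR 2 / l ord0 i.
have WE t i j : 0 < t -> W t i j * E j t = (i == j)%:R * l ord0 j.
  by move=> t0; have := @Z_eq0 t i j t0; rewrite /Z => /eqP; rewrite subr_eq0 => /eqP.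
have E0 t j : 0 < t -> 0 < E j t.
  by move=> t0; rewrite -(pmulr_rgt0 _ (wcov_diag_gt0 j t0)) WE// eqxx mul1r.
have Ek t j : E j t = l ord0 j * (expR (2 * t) + k j) / expR (2 * t).
  have e0 := expR_gt0 (2 * t); have li := l_gt0 j.
  rewrite /E /k mulNr expRD expRN; field.
  by rewrite !gt_eqF.
have kt t j : 0 < t -> 0 < expR (2 * t) + k j.
  move=> t0; have := E0 t j t0; rewrite Ek pmulr_lgt0 ?invr_gt0 ?expR_gt0//.
  by rewrite pmulr_rgt0.
exists k; split=> [j|t i j t0]; last first.
  have Ej : E j t != 0 by rewrite gt_eqF// E0.
  apply: (mulIf Ej); rewrite WE//.
  case: eqP => [->|_]; last by rewrite !mul0r.
  rewrite Ek !mul1r; field; rewrite !gt_eqF ?expR_gt0 ?kt//.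
have T1 : 0 < 1 :> R by [].
have [K K0 hK] := wmoments_bounded L m0 sol T1.
pose K1 := K + 1.
have K10 : 0 < K1 by rewrite ltr_wpDl.
have Klow t : 0 < t <= 1 -> K1^-1 <= expR (2 * t) + k j.
  move=> /andP[t0 t1].
  have wj : W t j j <= K1.
    have [_ /(_ j j)[_ h]] : (forall i, `|wmean rho L m0 i t| <= K) /\
        forall i j, `|wsecond rho L m0 i j t| <= K /\ `|W t i j| <= K.
      by apply: hK; rewrite ltW.
    by apply: (le_trans (ler_norm _)); apply: (le_trans h); rewrite lerDl.
  have := WE t j j t0; rewrite eqxx mul1r Ek => h.
  have e0 := expR_gt0 (2 * t); have li := l_gt0 j.
  have h2 : W t j j * (expR (2 * t) + k j) = expR (2 * t).
    have li0 : l ord0 j != 0 by rewrite gt_eqF.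
    apply: (mulfI li0).
    rewrite -[in RHS]h; field; by rewrite gt_eqF.
  have e1 : 1 <= expR (2 * t) by have := expR_ge1Dx (2 * t); lra.
  have K1n : K1 != 0 by rewrite gt_eqF.
  rewrite -[leRHS](mulfK K1n) -[leLHS]mul1r; apply: ler_wpM2r.
    by rewrite invr_ge0 ltW.
  by rewrite mulrC; apply: (le_trans e1); rewrite -{1}h2; apply: ler_wpM2r => //; exact/ltW/kt.
have lim : expR (2 * t) + k j @[t --> (0 : R)^'+] --> expR (2 * 0) + k j.
  apply: cvgD; last exact: cvg_cst.
  apply: cvg_at_right_filter.
  apply: (@continuous_comp _ _ _ (fun t : R => 2 * t) expR); last exact: continuous_expR.
  exact: (@scaler_continuous _ _ (2 : R) 0).
rewrite mulr0 expR0 in lim.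
suff : K1^-1 <= 1 + k j by move=> /(lt_le_trans _) h; have := h 0; rewrite invr_gt0 => /(_ K10); lra.
apply: (ler_cvg_to (cvg_cst K1^-1) lim); near=> t; apply: Klow.
by apply/andP; split; near: t; [exact: nbhs_right_gt|exact: nbhs_right_le].
Unshelve. all: by end_near. Qed.

End covariance_formula.

(** * The backward kernel *)

Section tempered_functions.
Context {R : realType} {n : nat}.
Variable T : R.
Implicit Types f g : R -> 'cV[R]_n -> R.

(** The conditions on test functions, in a form that is stable under sums and
    products: continuity, and growth of order [m] uniformly on compact time
    intervals. *)
Definition tempered m f : Prop :=
  (forall t u, 0 < t < T ->
     {for (t, u), continuous (fun p : R * 'cV[R]_n => f p.1 p.2)}) /\
  forall s t, 0 < s -> t < T -> exists2 K, 0 <= K &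
    forall tau u, s <= tau <= t -> `|f tau u| <= K * (1 + enorm u) ^+ m.

Let e1 (u : 'cV[R]_n) : 1 <= 1 + enorm u.
Proof. by rewrite lerDl enorm_ge0. Qed.

Lemma temperedW m m' f : (m <= m')%N -> tempered m f -> tempered m' f.
Proof.
move=> mm [cf bf]; split=> // s t s0 tT; have [K K0 hK] := bf s t s0 tT.
exists K => // tau u h; apply: (le_trans (hK tau u h)); rewrite ler_wpM2l//.
exact: ler_weXn2l.
Qed.

Lemma tempered_time (a : R -> R) : (forall t, 0 < t < T -> {for t, continuous a}) ->
  tempered 0 (fun t _ => a t).
Proof.
move=> ca; split=> [t u tT|s t s0 tT].
  apply: (@continuous_comp _ _ _ fst a); first exact: cvg_fst.
  exact: ca.
have [st|ts] := leP s t; last first.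
  by exists 0 => // tau u /andP[h1 h2]; move: (le_trans h1 h2); rewrite leNgt ts.
have [|c _ hc] := @EVT_max R (fun x => `|a x|) s t st.
  apply: continuous_in_subspaceT => x /set_mem /=; rewrite in_itv /= => /andP[h1 h2].
  by apply: cvg_norm; apply: ca; rewrite (lt_le_trans s0 h1) (le_lt_trans h2 tT).
by exists `|a c| => // tau u st'; rewrite expr0 mulr1; apply: hc; rewrite in_itv.
Qed.

Lemma tempered_cst c : tempered 0 (fun _ _ => c).
Proof. by apply: (tempered_time (a := fun _ => c)) => t _; exact: cvg_cst. Qed.

Lemma tempered_space f (g : 'cV[R]_n -> R) : linear_growth g -> tempered 1 (fun _ => g).
Proof.
move=> [cg [K hK]]; split=> [t u _|s t _ _].
  by apply: (@continuous_comp _ _ _ snd g); [exact: cvg_snd|exact: cg].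
exists `|K| => // tau u _; rewrite expr1; apply: (le_trans (hK u)).
by rewrite ler_wpM2r ?ler_norm// (le_trans ler01).
Qed.

Lemma temperedD m f g : tempered m f -> tempered m g ->
  tempered m (fun t u => f t u + g t u).
Proof.
move=> [cf bf] [cg bg]; split=> [t u tT|s t s0 tT].
  by apply: cvgD; [exact: cf|exact: cg].
have [K K0 hK] := bf s t s0 tT; have [K' K0' hK'] := bg s t s0 tT.
exists (K + K') => [|tau u h]; first exact: addr_ge0.
by rewrite mulrDl; apply: (le_trans (ler_normD _ _)); apply: lerD; [exact: hK|exact: hK'].
Qed.

Lemma temperedM m m' f g : tempered m f -> tempered m' g ->
  tempered (m + m') (fun t u => f t u * g t u).
Proof.
move=> [cf bf] [cg bg]; split=> [t u tT|s t s0 tT].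
  by apply: cvgM; [exact: cf|exact: cg].
have [K K0 hK] := bf s t s0 tT; have [K' K0' hK'] := bg s t s0 tT.
exists (K * K') => [|tau u h]; first exact: mulr_ge0.
by rewrite normrM exprD mulrACA; apply: ler_pM => //; [exact: hK|exact: hK'].
Qed.

Lemma tempered_sum m (I : Type) (s : seq I) (F : I -> R -> 'cV[R]_n -> R) :
  (forall i, tempered m (F i)) -> tempered m (fun t u => \sum_(i <- s) F i t u).
Proof.
move=> tF; elim: s => [|i s ih].
  rewrite (_ : (fun t u => _) = fun _ _ => 0); last first.
    by apply/funext => t; apply/funext => u; rewrite big_nil.
  by apply: (@temperedW 0); [|exact: tempered_cst].
rewrite (_ : (fun t u => _) = fun t u => F i t u + \sum_(i <- s) F i t u); last first.
  by apply/funext => t; apply/funext => u; rewrite big_cons.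
exact: temperedD.
Qed.

Lemma tempered_le m f g : tempered m g ->
  (forall t u, 0 < t < T ->
     {for (t, u), continuous (fun p : R * 'cV[R]_n => f p.1 p.2)}) ->
  (forall t u, 0 < t < T -> `|f t u| <= `|g t u|) -> tempered m f.
Proof.
move=> [cg bg] cf fg; split=> // s t s0 tT; have [K K0 hK] := bg s t s0 tT.
exists K => // tau u /[dup] h /andP[h1 h2]; apply: le_trans (hK tau u h).
by apply: fg; rewrite (lt_le_trans s0 h1) (le_lt_trans h2 tT).
Qed.

End tempered_functions.

Lemma is_derive_expR_comp (R : realType) n (f : 'cV[R]_n -> R) u v df :
  is_derive u v f df -> is_derive u v (fun w => expR (f w)) (expR (f u) * df).
Proof.
move=> /is_derive_coord_line h; apply/is_derive_coord_line.
have := is_derive1_comp (is_derive_expR (f (u + 0 *: v))) h.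
by rewrite scale0r addr0.
Qed.

Section backward_kernel.
Context {R : realType} {n : nat}.
Variables (L : 'M[R]_n) (m0 : 'cV[R]_n) (k : 'I_n -> R) (T : R) (zeta : 'I_n -> R).
Hypothesis k_gt : forall i, -1 < k i.
Hypothesis T_gt0 : 0 < T.
Local Notation w := (wcoord L m0).

(** With the coefficients [W i = e^(2 t) / (e^(2 t) + k i)], the Ornstein-Uhlenbeck
    process that starts from [x] at time [tau] is at time [T] a Gaussian with mean
    [sroot tau / sroot T * x] and variance [spread tau / (sroot T)^2]. The
    backward kernel is its density at the point [zeta / sroot T], as a function of
    the starting time and point and up to a constant factor.

    [sroot] is the square root of [exp (2 tau) + k i], written as an exponential
    so as to be positive at all times. *)
Definition sroot i (tau : R) : R := expR (2^-1 * ln (expR (2 * tau) + k i)).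
Definition spread (tau : R) : R := expR (2 * T) - expR (2 * tau).
Definition residual i tau u : R := zeta i - sroot i tau * w u i.
Definition log_bkernel tau u : R := \sum_i
  (- 2^-1 * ln (spread tau) + - 2^-1 * ((residual i tau u * residual i tau u) * (spread tau)^-1)).
Definition bkernel tau u : R := expR (log_bkernel tau u).

Definition bkernel_time tau u : R := bkernel tau u * \sum_i
  (expR (2 * tau) * (spread tau)^-1
   + residual i tau u * w u i * (expR (2 * tau) * (sroot i tau)^-1 * (spread tau)^-1)
   + -1 * (residual i tau u * residual i tau u) * (expR (2 * tau) * (spread tau)^-1 * (spread tau)^-1)).
Definition bkernel_grad a tau u : R :=
  bkernel tau u * (residual a tau u * (sroot a tau * (spread tau)^-1)).
Definition bkernel_hess a b tau u : R :=
  bkernel tau u * ((residual a tau u * residual b tau u) *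
     (sroot a tau * (spread tau)^-1 * (sroot b tau * (spread tau)^-1))
   + (b == a)%:R * (-1 * (sroot a tau * sroot a tau * (spread tau)^-1))).

Lemma expk_gt0 i tau : 0 <= tau -> 0 < expR (2 * tau) + k i.
Proof.
move=> t0; have := k_gt i; have := expR_ge1Dx (2 * tau); lra.
Qed.

Lemma sroot_gt0 i tau : 0 < sroot i tau. Proof. exact: expR_gt0. Qed.

Lemma sroot_sqr i tau : 0 <= tau -> sroot i tau * sroot i tau = expR (2 * tau) + k i.
Proof.
move=> t0; rewrite -expRD -mulrDl (_ : 2^-1 + 2^-1 = 1 :> R); last by field.
by rewrite mul1r lnK// posrE expk_gt0.
Qed.

Lemma spread_gt0 tau : tau < T -> 0 < spread tau.
Proof. by move=> tT; rewrite subr_gt0 ltr_expR ltr_pM2l. Qed.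

Lemma is_derive_exp2 (tau : R) :
  is_derive tau (1 : R) (fun t => expR (2 * t)) (2 * expR (2 * tau)).
Proof.
have d1 : is_derive tau (1 : R) (fun t : R => 2 * t) 2.
  apply: (@is_derive_quadratic _ _ _ _ 0) => h.
  by rewrite mul0r [X in `|X|](_ : _ = 0) ?normr0//; ring.
have d2 := is_derive1_comp (is_derive_expR (2 * tau)) d1.
by apply: (is_derive_eq d2); rewrite mulrC.
Qed.

Lemma is_derive_root i (tau : R) : 0 <= tau ->
  is_derive tau (1 : R) (sroot i) (expR (2 * tau) * (sroot i tau)^-1).
Proof.
move=> t0; have e0 := expk_gt0 i t0.
have d1 := is_derive_add (is_derive_exp2 tau) (is_derive_cst (k i) tau (1 : R)).
pose g (t : R) := expR (2 * t) + k i.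
have d2 : is_derive tau (1 : R) (fun t => ln (g t)) _ := is_derive1_comp (is_derive1_ln (e0 : 0 < g tau)) d1.
have d3 := is_derive_mull 2^-1 d2.
pose h (t : R) := 2^-1 * ln (g t).
have d4 : is_derive tau (1 : R) (fun t => expR (h t)) _ := is_derive1_comp (is_derive_expR (h tau)) d3.
apply: (is_derive_eq d4); rewrite /h -/(sroot i tau) addr0 /g -(sroot_sqr i t0).
by field; rewrite gt_eqF ?sroot_gt0.
Qed.

Lemma is_derive_spread (tau : R) :
  is_derive tau (1 : R) spread (- 2 * expR (2 * tau)).
Proof.
have d1 := is_derive_add (is_derive_cst (expR (2 * T)) tau (1 : R)) (is_derive_mull (-1) (is_derive_exp2 tau)).
rewrite (_ : spread = fun t => expR (2 * T) + -1 * expR (2 * t)); last first.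
  by apply/funext => t; rewrite mulN1r.
by apply: (is_derive_eq d1); ring.
Qed.

Lemma is_derive_spreadV (tau : R) : tau < T ->
  is_derive tau (1 : R) (fun t => (spread t)^-1)
    (2 * expR (2 * tau) * (spread tau)^-1 * (spread tau)^-1).
Proof.
move=> tT; have s0 : spread tau != 0 by rewrite gt_eqF// spread_gt0.
have h := is_deriveV s0 (is_derive_spread tau); apply: (is_derive_eq h).
by rewrite /GRing.scale /=; field.
Qed.

Lemma is_derive_residual_time i u (tau : R) : 0 <= tau ->
  is_derive tau (1 : R) (fun t => residual i t u)
    (- (expR (2 * tau) * (sroot i tau)^-1 * w u i)).
Proof.
move=> t0; have d := is_derive_add (is_derive_cst (zeta i) tau (1 : R))
  (is_derive_mull (-1) (is_derive_mulr (w u i) (is_derive_root i t0))).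
rewrite (_ : (fun t => _) = fun t => zeta i + -1 * (sroot i t * w u i)); last first.
  by apply/funext => t; rewrite mulN1r.
by apply: (is_derive_eq d); ring.
Qed.

Lemma is_derive_residual i c u tau :
  is_derive u (basis_vec c) (residual i tau) (- (sroot i tau * L i c)).
Proof.
have d := is_derive_add (is_derive_cst (zeta i) u (basis_vec c))
  (is_derive_mull (- sroot i tau) (is_derive_wcoord L m0 i c u)).
rewrite (_ : residual i tau = fun u => zeta i + - sroot i tau * w u i); last first.
  by apply/funext => v; rewrite mulNr.
by apply: (is_derive_eq d); ring.
Qed.

Lemma is_derive_bkernel_time (tau : R) u : 0 <= tau < T ->
  is_derive tau (1 : R) (fun t => bkernel t u) (bkernel_time tau u).
Proof.
move=> /andP[t0 tT]; have s0 := spread_gt0 tT.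
have dr i := is_derive_residual_time i u t0.
have d1 i := is_derive_add (is_derive_mull (- 2^-1) (is_derive1_comp (is_derive1_ln s0) (is_derive_spread tau)))
  (is_derive_mull (- 2^-1) (is_derive_mul (is_derive_mul (dr i) (dr i)) (is_derive_spreadV tT))).
have d2 := is_derive_sum_fun (index_enum 'I_n) d1.
have d3 := is_derive1_comp (is_derive_expR (log_bkernel tau u)) d2.
apply: (is_derive_eq d3); rewrite /bkernel_time -/(bkernel tau u); congr (_ * _).
apply: eq_bigr => i _; have := sroot_gt0 i tau; move: s0.
set a := spread tau; set b := sroot i tau => a0 b0.
by field; rewrite !gt_eqF.
Qed.

Lemma is_derive_bkernel c tau u :
  is_derive u (basis_vec c) (bkernel tau) (\sum_a bkernel_grad a tau u * L a c).
Proof.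
have dr i := is_derive_residual i c u tau.
have d1 i := is_derive_add (is_derive_cst (- 2^-1 * ln (spread tau)) u (basis_vec c))
  (is_derive_mull (- 2^-1) (is_derive_mulr (spread tau)^-1 (is_derive_mul (dr i) (dr i)))).
have d2 := is_derive_sum_fun (index_enum 'I_n) d1.
have d3 := is_derive_expR_comp d2.
apply: (is_derive_eq d3); rewrite -/(log_bkernel tau u) -/(bkernel tau u) mulr_sumr.
by apply: eq_bigr => i _; rewrite /bkernel_grad; set c' := (spread tau)^-1; field.
Qed.

Lemma is_derive_bkernel_grad a c tau u :
  is_derive u (basis_vec c) (bkernel_grad a tau) (\sum_b bkernel_hess a b tau u * L b c).
Proof.
have d := is_derive_mul (is_derive_bkernel c tau u)
  (is_derive_mulr (sroot a tau * (spread tau)^-1) (is_derive_residual a c u tau)).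
apply: (is_derive_eq d).
rewrite [RHS](eq_bigr (fun b => bkernel_grad b tau u * L b c * (residual a tau u * (sroot a tau / spread tau))
  + (- bkernel tau u * (sroot a tau * sroot a tau * (spread tau)^-1) * L b c) * (b == a)%:R)); last first.
  by move=> b _; rewrite /bkernel_hess /bkernel_grad; ring.
by rewrite big_split /= sum_delta -mulr_suml; congr (_ + _); ring.
Qed.

Let ct1 (t : R) : {for t, continuous (fun t : R => expR (2 * t))}.
Proof.
apply: (@continuous_comp _ _ _ (fun t : R => 2 * t) expR); last exact: continuous_expR.
exact: (@scaler_continuous _ _ (2 : R) t).
Qed.

Lemma spread_continuous : continuous spread.
Proof. by move=> t; apply: cvgB; [exact: cvg_cst|exact: ct1]. Qed.

Lemma spreadV_continuous (t : R) : t < T -> {for t, continuous (fun t : R => (spread t)^-1)}.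
Proof.
move=> tT; apply: cvgV; last exact: spread_continuous.
by rewrite gt_eqF// spread_gt0.
Qed.

Lemma sroot_continuous i (t : R) : 0 <= t -> {for t, continuous (sroot i)}.
Proof.
move=> t0; apply: differentiable_continuous; apply/derivable1_diffP.
exact: (@ex_derive _ _ _ _ _ _ _ (is_derive_root i t0)).
Qed.

Let t_exp : @tempered R n T 0 (fun t _ => expR (2 * t)).
Proof. by apply: tempered_time => t _; exact: ct1. Qed.

Let t_spreadV : @tempered R n T 0 (fun t _ => (spread t)^-1).
Proof.
by apply: (tempered_time (a := fun t => (spread t)^-1)) => t /andP[_ tT]; exact: spreadV_continuous.
Qed.

Let t_root i : @tempered R n T 0 (fun t _ => sroot i t).
Proof. by apply: tempered_time => t /andP[t0 _]; apply: sroot_continuous; exact: ltW. Qed.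

Let t_rootV i : @tempered R n T 0 (fun t _ => (sroot i t)^-1).
Proof.
apply: (tempered_time (a := fun t => (sroot i t)^-1)) => t /andP[t0 _]; apply: cvgV.
  by rewrite gt_eqF// sroot_gt0.
by apply: sroot_continuous; exact: ltW.
Qed.

Let t_w i : tempered T 1 (fun _ u => w u i).
Proof. by apply: tempered_space => //; exact: linear_growth_wcoord. Qed.

Let t_residual i : tempered T 1 (residual i).
Proof.
rewrite (_ : residual i = fun t u => zeta i + -1 * (sroot i t * w u i)); last first.
  by apply/funext => t; apply/funext => u; rewrite mulN1r.
apply: temperedD; first by apply: (@temperedW _ _ _ 0) => //; exact: tempered_cst.
by apply: (@temperedM _ _ _ 0 1); [exact: tempered_cst|exact: (@temperedM _ _ _ 0 1)].
Qed.

Let t_ln : @tempered R n T 0 (fun t _ => - 2^-1 * ln (spread t)).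
Proof.
apply: (@temperedM _ _ _ 0 0); first exact: tempered_cst.
apply: (tempered_time (a := fun t => ln (spread t))) => t /andP[_ tT].
have h := @spread_continuous t.
exact: (continuous_comp h (continuous_ln (spread_gt0 tT))).
Qed.

Let t_rr i j : tempered T 2 (fun t u => residual i t u * residual j t u).
Proof. exact: (@temperedM _ _ _ 1 1). Qed.

Let t_log : tempered T 2 log_bkernel.
Proof.
apply: tempered_sum => i; apply: temperedD; first exact: (@temperedW _ _ _ 0).
apply: (@temperedM _ _ _ 0 2); first exact: tempered_cst.
exact: (@temperedM _ _ _ 2 0).
Qed.

Lemma bkernel_le tau u : tau < T -> bkernel tau u <= expR (\sum_(i < n) (- 2^-1 * ln (spread tau))).
Proof.
move=> tT; have s0 := spread_gt0 tT.
rewrite ler_expR; apply: ler_sum => i _.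
by rewrite gerDl mulNr oppr_le0 mulr_ge0 ?invr_ge0// mulr_ge0 ?invr_ge0 ?(ltW s0)// -expr2 sqr_ge0.
Qed.

Lemma bkernel_ge0 tau u : 0 <= bkernel tau u. Proof. exact: expR_ge0. Qed.

Lemma tempered_bkernel : tempered T 0 bkernel.
Proof.
apply: (@tempered_le _ _ _ 0 _ (fun t _ => expR (\sum_(i < n) (- 2^-1 * ln (spread t))))).
- apply: (tempered_time (a := fun t => expR (\sum_(i < n) (- 2^-1 * ln (spread t))))) => t tT.
  apply: (@continuous_comp _ _ _ (fun t => \sum_(i < n) (- 2^-1 * ln (spread t))) expR); last exact: continuous_expR.
  apply: cvg_sum_seq => i; have := t_ln.1 t 0 tT.
  exact: (slice_continuous_time (f := fun t _ => - 2^-1 * ln (spread t))).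
- move=> t u tT; apply: (@continuous_comp _ _ _ (fun p : R * 'cV[R]_n => log_bkernel p.1 p.2) expR).
    exact: t_log.1.
  exact: continuous_expR.
- by move=> t u /andP[_ tT]; rewrite !ger0_norm ?expR_ge0// bkernel_le.
Qed.

Lemma tempered_bkernel_time : tempered T 2 bkernel_time.
Proof.
apply: (@temperedM _ _ _ 0 2); first exact: tempered_bkernel.
apply: tempered_sum => i; apply: temperedD; first apply: temperedD.
- by apply: (@temperedW _ _ _ 0) => //; exact: (@temperedM _ _ _ 0 0).
- apply: (@temperedM _ _ _ 2 0); first exact: (@temperedM _ _ _ 1 1).
  by apply: (@temperedM _ _ _ 0 0) => //; exact: (@temperedM _ _ _ 0 0).
- apply: (@temperedM _ _ _ 2 0).
    by apply: (@temperedM _ _ _ 0 2) => //; exact: tempered_cst.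
  by apply: (@temperedM _ _ _ 0 0) => //; exact: (@temperedM _ _ _ 0 0).
Qed.

Lemma tempered_bkernel_grad a : tempered T 1 (bkernel_grad a).
Proof.
apply: (@temperedM _ _ _ 0 1); first exact: tempered_bkernel.
by apply: (@temperedM _ _ _ 1 0) => //; exact: (@temperedM _ _ _ 0 0).
Qed.

Lemma tempered_bkernel_hess a b : tempered T 2 (bkernel_hess a b).
Proof.
apply: (@temperedM _ _ _ 0 2); first exact: tempered_bkernel.
apply: temperedD.
  apply: (@temperedM _ _ _ 2 0) => //; apply: (@temperedM _ _ _ 0 0); exact: (@temperedM _ _ _ 0 0).
apply: (@temperedW _ _ _ 0) => //.
apply: (@temperedM _ _ _ 0 0); first exact: tempered_cst.
apply: (@temperedM _ _ _ 0 0); first exact: tempered_cst.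
by apply: (@temperedM _ _ _ 0 0) => //; exact: (@temperedM _ _ _ 0 0).
Qed.

(** The kernel solves the backward equation with the coefficients of the
    solution, so that its generator vanishes. *)
Lemma bkernel_generator (W : 'M[R]_n) tau u : 0 < tau < T ->
  (forall i j, W i j = (i == j)%:R * (expR (2 * tau) / (expR (2 * tau) + k i))) ->
  wgenerator W (bkernel_time tau u) (fun a => bkernel_grad a tau u)
    (fun a b => bkernel_hess a b tau u) (w u) = 0.
Proof.
move=> /andP[/ltW t0 tT] WE; have s0 := spread_gt0 tT.
have W1 a (X : 'I_n -> R) : \sum_b W a b * X b = expR (2 * tau) / (sroot a tau * sroot a tau) * X a.
  rewrite sroot_sqr// -[RHS](sum_delta (fun b => expR (2 * tau) / (expR (2 * tau) + k a) * X b)).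
  by apply: eq_bigr => b _; rewrite WE eq_sym; ring.
rewrite /wgenerator /bkernel_time.
under [X in _ - X]eq_bigr do rewrite W1.
under [X in _ + X]eq_bigr do rewrite W1.
rewrite mulr_sumr -sumrB -big_split big1//= => a _.
rewrite /bkernel_grad /bkernel_hess eqxx mulr1n mul1r.
have := sroot_gt0 a tau; move: s0.
set c := spread tau; set b := sroot a tau => c0 b0.
by field; rewrite !gt_eqF.
Qed.

End backward_kernel.

(** * Gaussian integrals *)

Section product_integral.
Context {R : realType}.
Local Notation leb := (@lebesgue_cV R).
Local Notation mu := (@lebesgue_measure R).

Lemma measurable_prod_coord n (f : 'I_n -> R -> R) : (forall i, measurable_fun setT (f i)) ->
  measurable_fun setT (fun v : 'cV[R]_n => \prod_i f i (v i ord0)).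
Proof.
move=> mf; apply: measurable_prod => i _.
exact: (measurableT_comp (mf i) (measurable_coord i)).
Qed.

Lemma ge0_integral_prod_coord n (f : 'I_n -> R -> R) :
  (forall i, measurable_fun setT (f i)) -> (forall i x, 0 <= f i x) ->
  (\int[leb n]_v (\prod_i f i (v i ord0))%:E = \prod_i \int[mu]_x (f i x)%:E)%E.
Proof.
elim: n f => [|n ih] f mf f0.
  under eq_integral do rewrite big_ord0.
  by rewrite big_ord0 integral_cst//= mul1e; exact: diracT.
have p0 m (g : 'I_m -> R -> R) (v : 'cV[R]_m) : (forall i x, 0 <= g i x) ->
    0 <= \prod_i g i (v i ord0) by move=> g0; exact: prodr_ge0.
rewrite ge0_integral_cons; last 2 first.
- by apply/measurable_EFinP; exact: measurable_prod_coord.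
- by move=> v; rewrite lee_fin p0.
under eq_integral => x _.
  under eq_integral do rewrite big_ord_recl cons_cV0 /= EFinM.
  under eq_integral do under eq_bigr do rewrite cons_cVS.
  rewrite ge0_integralZl_EFin//; last 2 first.
  - by move=> v _; rewrite lee_fin; apply: prodr_ge0 => i _.
  - apply/measurable_EFinP.
    exact: (@measurable_prod_coord _ (fun i => f (lift ord0 i))).
  rewrite (ih (fun i => f (lift ord0 i)))//.
  over.
rewrite big_ord_recl /= ge0_integralZr//.
- by apply/measurable_EFinP; exact: mf.
- by move=> x _; rewrite lee_fin.
- by apply: prode_ge0 => i _; apply: integral_ge0 => x _; rewrite lee_fin.
Qed.

End product_integral.

Section gaussian_moments.
Context {R : realType}.
Local Notation leb := (@lebesgue_cV R).
Local Notation mu := (@lebesgue_measure R).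

Lemma normal_pdf_expE (m s x : R) : 0 < s ->
  normal_pdf m s x = normal_peak s * expR (- (2^-1 * ((x - m) / s) ^+ 2)).
Proof.
move=> s0; have sn : s != 0 by rewrite gt_eqF.
rewrite normal_pdfE// /normal_fun; congr (_ * expR _).
by rewrite -mulr_natr; field.
Qed.

Lemma normal_peak1V (s : R) : 0 < s -> normal_peak s = normal_peak 1 / s.
Proof.
move=> s0; rewrite /normal_peak expr1n mul1r -mulrnAr sqrtrM ?sqr_ge0//.
by rewrite sqrtr_sqr gtr0_norm// invfM mulrC.
Qed.

Lemma normal_pdf_affine (m s x : R) : 0 < s ->
  normal_pdf m s (s * x + m) = normal_pdf 0 1 x / s.
Proof.
move=> s0; rewrite !normal_pdf_expE//; rewrite (normal_peak1V s0) mulrAC.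
congr (_ * expR _ / _); rewrite addrK subr0; congr (- (_ * _ ^+ 2)); field.
by rewrite gt_eqF.
Qed.

Let phi : R -> R := normal_pdf 0 1.
Let phi_ge0 x : 0 <= phi x. Proof. exact: normal_pdf_ge0. Qed.
Let phiE x : phi x = normal_peak 1 * expR (- (2^-1 * (x * x))).
Proof. by rewrite /phi normal_pdf_expE// subr0 divr1 expr2. Qed.
Let m_phi : measurable_fun setT phi. Proof. exact: measurable_normal_pdf. Qed.

Let int_coord1 (f : R -> R) : measurable_fun setT f -> (forall x, 0 <= f x) ->
  (\int[leb 1]_v (f (v ord0 ord0))%:E = \int[mu]_x (f x)%:E)%E.
Proof.
move=> mf f0; have := @ge0_integral_prod_coord R 1 (fun _ => f) (fun _ => mf) (fun _ => f0).
by under eq_integral do rewrite big_ord1; rewrite big_ord1.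
Qed.

(** [x phi] has the integrable derivative [(1 - x^2) phi]. *)
Lemma integral_sqr_standard_normal : (\int[mu]_x (x ^+ 2 * phi x)%:E = 1)%E.
Proof.
pose dom (x : R) := 4 * normal_peak 1 / normal_peak 2 * normal_pdf 0 2 x.
have pk : 0 < normal_peak 2 :> R by apply: normal_peak_gt0; rewrite gt_eqF.
have pk1 : 0 < normal_peak 1 :> R by exact: normal_peak_gt0.
have domE x : dom x = 4 * normal_peak 1 * expR (- (8^-1 * (x * x))).
  rewrite /dom normal_pdf_expE// subr0.
  rewrite (_ : 2^-1 * (x / 2) ^+ 2 = 8^-1 * (x * x)); last by field.
  by field; rewrite gt_eqF.
have dle x : (1 + x * x) * phi x <= dom x.
  rewrite domE phiE mulrCA [leRHS](_ : _ = normal_peak 1 * (4 * expR (- (8^-1 * (x * x))))); last by ring.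
  rewrite (ler_pM2l pk1).
  have : 1 + 3 / 8 * (x * x) <= expR (3 / 8 * (x * x)) := expR_ge1Dx _.
  rewrite (_ : - (2^-1 * (x * x)) = - (8^-1 * (x * x)) - 3 / 8 * (x * x)); last by field.
  rewrite expRD; set e := expR (3 / 8 * (x * x)) => he.
  have e0 : 0 < e by exact: expR_gt0.
  have a0 := expR_gt0 (- (8^-1 * (x * x))).
  rewrite [expR (- (3 / 8 * _))]expRN -/e mulrCA [leRHS]mulrC (ler_pM2l a0) ler_pdivrMr//.
  have := sqr_ge0 x; rewrite expr2; lra.
have idom : (leb 1).-integrable setT (EFin \o (fun v : 'cV[R]_1 => dom (v ord0 ord0))).
  have mdom : measurable_fun setT dom by apply: measurable_funM => //; exact: measurable_normal_pdf.
  have dom0 x : 0 <= dom x by rewrite domE mulr_ge0 ?expR_ge0// mulr_ge0// ltW.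
  apply/integrableP; split.
    by apply/measurable_EFinP; apply: (measurableT_comp mdom); exact: measurable_coord.
  under eq_integral do rewrite gee0_abs ?lee_fin//.
  rewrite (int_coord1 mdom dom0) /dom; under eq_integral do rewrite EFinM.
  rewrite ge0_integralZl_EFin//.
  - by rewrite integral_normal_pdf mule1 ltry.
  - by move=> x _; rewrite lee_fin normal_pdf_ge0.
  - by apply/measurable_EFinP; exact: measurable_normal_pdf.
  - by apply: divr_ge0; [apply: mulr_ge0 => //; exact: ltW|exact: ltW].
pose x0 (v : 'cV[R]_1) : R := v ord0 ord0.
have cx : continuous x0 by exact: coord_cV_continuous.
have cp : continuous (fun v => phi (x0 v)).
  move=> v; apply: (@continuous_comp _ _ _ x0 phi); first exact: cx.
  by apply: continuous_normal_pdf; rewrite oner_eq0.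
have dx v : is_derive v (basis_vec ord0) x0 1.
  have := @is_derive_wcoord R 1 1%:M 0 ord0 ord0 v.
  rewrite (_ : (1%:M : 'M[R]_1) ord0 ord0 = 1); last by rewrite mxE.
  rewrite (_ : (fun u : 'cV[R]_1 => wcoord 1%:M 0 u ord0) = x0)//.
  by apply/funext => u; rewrite /wcoord mul1mx subr0.
have dp v : is_derive v (basis_vec ord0) (fun v => phi (x0 v)) (- x0 v * phi (x0 v)).
  have d := is_derive_mull (normal_peak 1) (is_derive_expR_comp
    (is_derive_mull (- 2^-1) (is_derive_mul (dx v) (dx v)))).
  rewrite (_ : (fun v => _) = fun v => normal_peak 1 * expR (- 2^-1 * (x0 v * x0 v))); last first.
    by apply/funext => u; rewrite phiE mulNr.
  by apply: (is_derive_eq d); rewrite phiE mulNr; field.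
have dg v := is_derive_mul (dx v) (dp v).
have cg' : continuous (fun v => 1 * phi (x0 v) + x0 v * (- x0 v * phi (x0 v))).
  apply: continuous_add; first by apply: continuous_mul => //; exact: cst_continuous.
  apply: continuous_mul => //; apply: continuous_mul => //; exact: continuous_opp.
have bd (v : 'cV[R]_1) : 0 <= phi (x0 v) /\ (1 + x0 v * x0 v) * phi (x0 v) <= dom (x0 v).
  by split.
have ig : (leb 1).-integrable setT (EFin \o (fun v => x0 v * phi (x0 v))).
  apply: (integrable_le _ _ idom).
    by apply: continuous_measurable_cV; exact: continuous_mul.
  move=> v; have [p0 le] := bd v; apply: le_trans le; rewrite normrM (ger0_norm p0) ler_wpM2r//.
  rewrite ler_norml; apply/andP; split.
    by have := sqr_ge0 (1 + x0 v); have := sqr_ge0 (x0 v); rewrite !expr2; lra.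
  by have := sqr_ge0 (1 - x0 v); have := sqr_ge0 (x0 v); rewrite !expr2; lra.
have ig' : (leb 1).-integrable setT (EFin \o (fun v => 1 * phi (x0 v) + x0 v * (- x0 v * phi (x0 v)))).
  apply: (integrable_le _ _ idom); first exact: continuous_measurable_cV.
  move=> v; have [p0 le] := bd v; apply: le_trans le.
  rewrite (_ : 1 * _ + _ = (1 - x0 v * x0 v) * phi (x0 v)); last by ring.
  rewrite normrM (ger0_norm p0) ler_wpM2r//.
  by rewrite ler_norml; have := sqr_ge0 (x0 v); rewrite expr2; lra.
have i2 : (leb 1).-integrable setT (EFin \o (fun v => x0 v ^+ 2 * phi (x0 v))).
  apply: (integrable_le _ _ idom).
    apply: continuous_measurable_cV; apply: continuous_mul => //.
    by under eq_fun do rewrite expr2; exact: continuous_mul.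
  move=> v; have [p0 le] := bd v; apply: le_trans le.
  have x20 : 0 <= x0 v ^+ 2 by exact: sqr_ge0.
  have f20 : 0 <= x0 v ^+ 2 * phi (x0 v) by exact: mulr_ge0.
  by rewrite (ger0_norm f20) ler_wpM2r// -expr2; lra.
have I0 := integral_derive_eq0 dg cg' ig ig'.
have m2 : measurable_fun setT (fun x : R => x ^+ 2 * phi x).
  by apply: measurable_funM => //; exact: measurable_funX.
have ip : (leb 1).-integrable setT (EFin \o (fun v => phi (x0 v))).
  apply: (integrable_le _ _ idom); first exact: continuous_measurable_cV.
  move=> v; have [p0 le] := bd v; apply: le_trans le.
  by rewrite ger0_norm// ler_peMl// lerDl -expr2 sqr_ge0.
have I1 : (\int[leb 1]_v (phi (x0 v))%:E = 1)%E.
  by rewrite (int_coord1 m_phi phi_ge0) integral_normal_pdf.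
rewrite -(int_coord1 m2) => [|x]; last by rewrite mulr_ge0 ?sqr_ge0.
rewrite -[RHS]I1 -[LHS]add0e -[X in (X + _)%E]I0 -integralD//.
apply: eq_integral => v _; rewrite -EFinD; congr EFin; rewrite /x0; ring.
Qed.

(** Adding the image under [x -> - x] cancels the cross term of the square, so
    that no integral of a function of variable sign is involved. *)
Lemma integral_sqr_normal (m s : R) : 0 < s ->
  (\int[mu]_x (x ^+ 2 * normal_pdf m s x)%:E = (m ^+ 2 + s ^+ 2)%:E)%E.
Proof.
move=> s0; pose I : \bar R := (\int[mu]_x ((s * x + m) ^+ 2 * phi x)%:E)%E.
have mq (a b : R) : measurable_fun setT (fun x : R => (a * x + b) ^+ 2 * phi x).
  apply: measurable_funM => //; apply: measurable_funX.
  exact: (measurable_affine1 a b).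
have IE : (\int[mu]_x (x ^+ 2 * normal_pdf m s x)%:E = I)%E.
  pose g (x : measurableTypeR R) : \bar R := ((x : R) ^+ 2 * normal_pdf m s x)%:E.
  have mg : measurable_fun setT g.
    apply/measurable_EFinP; apply: measurable_funM; last exact: measurable_normal_pdf.
    exact: measurable_funX.
  have g0 x : (0 <= g x)%E by rewrite lee_fin mulr_ge0 ?sqr_ge0 ?normal_pdf_ge0.
  have sn : s != 0 by rewrite gt_eqF.
  have := ge0_integral_affine1 m sn mg g0; rewrite (gtr0_norm s0) => h.
  have -> : I = (s%:E * \int[mu]_x g (affine1 s m x))%E.
    have mga : measurable_fun setT (fun x => g (affine1 s m x)).
      exact: (measurableT_comp mg (measurable_affine1 s m)).
    have s0' := ltW s0; rewrite -ge0_integralZl_EFin//.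
    apply: eq_integral => x _; rewrite /g /affine1 -EFinM normal_pdf_affine// -/phi; congr EFin.
    by field.
  by rewrite h muleA -EFinM divff// mul1e.
have IN : I = (\int[mu]_x ((- s * x + m) ^+ 2 * phi x)%:E)%E.
  pose g (x : measurableTypeR R) : \bar R := ((- s * (x : R) + m) ^+ 2 * phi x)%:E.
  have mg : measurable_fun setT g by apply/measurable_EFinP; exact: mq.
  have g0 x : (0 <= g x)%E by rewrite lee_fin mulr_ge0 ?sqr_ge0.
  have n1 : - 1 != 0 :> R by rewrite oppr_eq0 oner_eq0.
  have := ge0_integral_affine1 0 n1 mg g0; rewrite normrN1 invr1 mul1e => <-.
  apply: eq_integral => x _; rewrite /g /affine1 addr0 mulN1r; congr EFin.
  by rewrite (_ : phi (- x) = phi x) ?mulrNN//; rewrite !phiE mulrNN.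
have I2 : (I + I = (2 * (m ^+ 2 + s ^+ 2))%:E)%E.
  pose f1 (a : R) (x : measurableTypeR R) : \bar R := ((a * (x : R) + m) ^+ 2 * phi x)%:E.
  pose p0 (x : measurableTypeR R) : \bar R := (phi x)%:E.
  pose p2 (x : measurableTypeR R) : \bar R := ((x : R) ^+ 2 * phi x)%:E.
  have mf1 a : measurable_fun setT (f1 a) by apply/measurable_EFinP; exact: mq.
  have mp0 : measurable_fun setT p0 by apply/measurable_EFinP; exact: m_phi.
  have mp2 : measurable_fun setT p2.
    by apply/measurable_EFinP; apply: measurable_funM => //; exact: measurable_funX.
  have f10 a x : setT x -> (0 <= f1 a x)%E by move=> _; rewrite lee_fin mulr_ge0 ?sqr_ge0.
  have p00 x : setT x -> (0 <= p0 x)%E by move=> _; rewrite lee_fin.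
  have p20 x : setT x -> (0 <= p2 x)%E by move=> _; rewrite lee_fin mulr_ge0 ?sqr_ge0.
  have c1 : 0 <= 2 * m ^+ 2 by rewrite mulr_ge0 ?sqr_ge0.
  have c2 : 0 <= 2 * s ^+ 2 by rewrite mulr_ge0 ?sqr_ge0.
  have q10 x : setT x -> (0 <= (2 * m ^+ 2)%:E * p0 x)%E by move=> _; rewrite mule_ge0 ?p00.
  have q20 x : setT x -> (0 <= (2 * s ^+ 2)%:E * p2 x)%E by move=> _; rewrite mule_ge0 ?p20.
  rewrite {2}IN.
  rewrite -[LHS](@ge0_integralD _ _ _ mu _ measurableT (f1 s) (f1 (- s)) (f10 s) (mf1 s) (f10 (- s)) (mf1 (- s))).
  transitivity (\int[mu]_x ((2 * m ^+ 2)%:E * p0 x + (2 * s ^+ 2)%:E * p2 x))%E.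
    by apply: eq_integral => x _; rewrite /f1 /p0 /p2 -!EFinM -!EFinD; congr EFin; ring.
  rewrite (@ge0_integralD _ _ _ mu _ measurableT _ _ q10 (measurable_funeM _ mp0) q20 (measurable_funeM _ mp2)).
  rewrite (ge0_integralZl_EFin _ measurableT p00 mp0 c1) (ge0_integralZl_EFin _ measurableT p20 mp2 c2).
  rewrite (integral_sqr_standard_normal : \int[mu]_x p2 x = 1)%E (integral_normal_pdf 0 1 : \int[mu]_x p0 x = 1)%E.
  by rewrite !mule1 -EFinD; congr EFin; ring.
rewrite IE; have : (I + I = (2 * (m ^+ 2 + s ^+ 2))%:E)%E by [].
case: (I) => // x /eqP; rewrite -EFinD eqe => /eqP h.
by congr EFin; lra.
Qed.

Lemma integral_centered_normal (m s : R) : 0 < s ->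
  (\int[mu]_x (((x - m) / s) ^+ 2 * normal_pdf m s x)%:E = 1)%E.
Proof.
move=> s0; have sn : s != 0 by rewrite gt_eqF.
pose g (x : measurableTypeR R) : \bar R := ((((x : R) - m) / s) ^+ 2 * normal_pdf m s x)%:E.
have mg : measurable_fun setT g.
  apply/measurable_EFinP; apply: measurable_funM; last exact: measurable_normal_pdf.
  by apply: measurable_funX; apply: measurable_funM => //; exact: measurable_funB.
have g0 x : (0 <= g x)%E by rewrite lee_fin mulr_ge0 ?sqr_ge0 ?normal_pdf_ge0.
have := ge0_integral_affine1 m sn mg g0; rewrite (gtr0_norm s0) => h.
have s0' := ltW s0; transitivity (s%:E * \int[mu]_x g (affine1 s m x))%E.
  by rewrite h muleA -EFinM divff// mul1e.
have mga : measurable_fun setT (fun x => g (affine1 s m x)).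
  exact: (measurableT_comp mg (measurable_affine1 s m)).
rewrite -ge0_integralZl_EFin// -integral_sqr_standard_normal.
apply: eq_integral => x _; rewrite /g /affine1 -EFinM normal_pdf_affine// -/phi addrK; congr EFin.
by field.
Qed.

End gaussian_moments.

Section product_normal.
Context {R : realType} {n : nat}.
Local Notation leb := (@lebesgue_cV R n).

Definition product_normal (m s : 'I_n -> R) (v : 'cV[R]_n) : R :=
  \prod_i normal_pdf (m i) (s i) (v i ord0).

Lemma product_normal_ge0 m s v : 0 <= product_normal m s v.
Proof. by apply: prodr_ge0 => i _; exact: normal_pdf_ge0. Qed.

Lemma measurable_product_normal m s : measurable_fun setT (product_normal m s).
Proof. apply: (@measurable_prod_coord R n (fun i => normal_pdf (m i) (s i))) => i; exact: measurable_normal_pdf. Qed.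

Lemma integral_product_normal m s : (\int[leb]_v (product_normal m s v)%:E = 1)%E.
Proof.
rewrite (@ge0_integral_prod_coord _ _ (fun i => normal_pdf (m i) (s i))).
- by rewrite big1// => i _; exact: integral_normal_pdf.
- by move=> i; exact: measurable_normal_pdf.
- by move=> i x; exact: normal_pdf_ge0.
Qed.

Lemma integral_sqr_product_normal m s j : 0 < s j ->
  (\int[leb]_v (v j ord0 ^+ 2 * product_normal m s v)%:E = (m j ^+ 2 + s j ^+ 2)%:E)%E.
Proof.
move=> sj; pose f i (x : R) := (if i == j then x ^+ 2 else 1) * normal_pdf (m i) (s i) x.
transitivity (\int[leb]_v (\prod_i f i (v i ord0))%:E)%E.
  apply: eq_integral => v _; congr EFin; rewrite /f big_split /=; congr (_ * _).
  by rewrite (bigD1 j)//= eqxx big1 ?mulr1// => i /negbTE ->.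
rewrite ge0_integral_prod_coord.
- rewrite (bigD1 j)//= big1 ?mule1 => [|i /negbTE ij]; rewrite /f.
    by rewrite eqxx integral_sqr_normal.
  by rewrite ij; under eq_integral do rewrite mul1r; exact: integral_normal_pdf.
- move=> i; apply: measurable_funM; last exact: measurable_normal_pdf.
  by case: (i == j) => //; exact: measurable_funX.
- by move=> i x; rewrite mulr_ge0 ?normal_pdf_ge0//; case: (i == j); rewrite ?sqr_ge0.
Qed.

Lemma integral_centered_product_normal m s j : 0 < s j ->
  (\int[leb]_v (((v j ord0 - m j) / s j) ^+ 2 * product_normal m s v)%:E = 1)%E.
Proof.
move=> sj; pose f i (x : R) := (if i == j then ((x - m j) / s j) ^+ 2 else 1) * normal_pdf (m i) (s i) x.
transitivity (\int[leb]_v (\prod_i f i (v i ord0))%:E)%E.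
  apply: eq_integral => v _; congr EFin; rewrite /f big_split /=; congr (_ * _).
  by rewrite (bigD1 j)//= eqxx big1 ?mulr1// => i /negbTE ->.
rewrite ge0_integral_prod_coord.
- rewrite (bigD1 j)//= big1 ?mule1 => [|i /negbTE ij]; rewrite /f.
    by rewrite eqxx integral_centered_normal.
  by rewrite ij; under eq_integral do rewrite mul1r; exact: integral_normal_pdf.
- move=> i; apply: measurable_funM; last exact: measurable_normal_pdf.
  case: (i == j) => //; apply: measurable_funX; apply: measurable_funM => //.
  exact: measurable_funB.
- by move=> i x; rewrite mulr_ge0 ?normal_pdf_ge0//; case: (i == j); rewrite ?sqr_ge0.
Qed.

End product_normal.

(** * Gaussian densities in normalizing coordinates *)

Section wnormal.
Context {R : realType} {n : nat}.
Local Notation leb := (@lebesgue_cV R n).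
Variables (L : 'M[R]_n) (m0 : 'cV[R]_n).
Hypothesis L_unit : L \in unitmx.
Local Notation w := (wcoord L m0).
Implicit Types (m s : 'I_n -> R) (u a : 'cV[R]_n).

(** The law under which the coordinates are independent Gaussians with means [m]
    and deviations [s]. *)
Definition wnormal m s u : R :=
  `|\det L| * \prod_i normal_pdf (m i) (s i) (w u i).

Definition wpoint (x : 'I_n -> R) : 'cV[R]_n := m0 + invmx L *m \col_i x i.

Lemma wpointK x i : w (wpoint x) i = x i.
Proof. by rewrite /wcoord /wpoint addrAC subrr add0r mulKVmx// mxE. Qed.

Lemma wcoordK u : wpoint (w u) = u.
Proof.
rewrite /wpoint (_ : \col_i w u i = L *m (u - m0)) ?mulKmx ?subrKC//.
by apply/colP => i; rewrite mxE.
Qed.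

Let det_gt0 : 0 < `|\det L|.
Proof. by rewrite normr_gt0 -unitfE -unitmxE. Qed.

Lemma wnormal_ge0 m s u : 0 <= wnormal m s u.
Proof. by rewrite mulr_ge0// prodr_ge0// => i _; exact: normal_pdf_ge0. Qed.

Lemma measurable_wcoord i : measurable_fun setT (fun u => w u i).
Proof. by apply: continuous_measurable_cV; exact: continuous_wcoord. Qed.

Lemma measurable_wnormal m s : measurable_fun setT (wnormal m s).
Proof.
apply: measurable_funM => //; apply: measurable_prod => i _.
exact: (measurableT_comp (measurable_normal_pdf (m i) (s i)) (measurable_wcoord i)).
Qed.

Lemma integral_wnormal m s (g : 'cV[R]_n -> R) : measurable_fun setT g ->
  (forall v, 0 <= g v) ->
  (\int[leb]_u (g (L *m (u - m0)) * wnormal m s u)%:E =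
   \int[leb]_v (g v * product_normal m s v)%:E)%E.
Proof.
move=> mg g0; pose f v : \bar R := (g v * product_normal m s v)%:E.
have mf : measurable_fun setT f.
  by apply/measurable_EFinP; apply: measurable_funM => //; exact: measurable_product_normal.
have f0 v : (0 <= f v)%E by rewrite lee_fin mulr_ge0// product_normal_ge0.
have h := ge0_integral_affine (- (L *m m0)) L_unit mf f0.
transitivity (`|\det L|%:E * \int[leb]_u f (L *m u + - (L *m m0))%R)%E; last first.
  by rewrite h muleA -EFinM divff ?mul1e// gt_eqF.
pose fa (u : 'cV[R]_n) : \bar R := f (L *m u + - (L *m m0)).
have mfa : measurable_fun setT fa.
  exact: (measurableT_comp mf (measurable_mulmx L (- (L *m m0)))).
have fa0 u : setT u -> (0 <= fa u)%E by move=> _; exact: f0.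
rewrite -(ge0_integralZl_EFin _ measurableT fa0 mfa (ltW det_gt0)).
apply: eq_integral => u _; rewrite /fa /f -EFinM -mulmxBr; congr EFin.
by rewrite /wnormal /product_normal /wcoord; ring.
Qed.

Lemma integral_wnormal1 m s : (\int[leb]_u (wnormal m s u)%:E = 1)%E.
Proof.
have := @integral_wnormal m s (fun _ => 1) (measurable_cst _) (fun _ => ler01).
under eq_integral do rewrite mul1r.
by under [X in _ = X]eq_integral do rewrite mul1r; rewrite integral_product_normal.
Qed.

Lemma integral_sqr_wnormal m s j : 0 < s j ->
  (\int[leb]_u (w u j ^+ 2 * wnormal m s u)%:E = (m j ^+ 2 + s j ^+ 2)%:E)%E.
Proof.
move=> sj; rewrite -(integral_sqr_product_normal m sj).
apply: (@integral_wnormal m s (fun v => v j ord0 ^+ 2)) => [|v]; last exact: sqr_ge0.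
by apply: measurable_funX; exact: measurable_coord.
Qed.

Lemma integral_centered_wnormal m s j : 0 < s j ->
  (\int[leb]_u (((w u j - m j) / s j) ^+ 2 * wnormal m s u)%:E = 1)%E.
Proof.
move=> sj; rewrite -(integral_centered_product_normal m sj).
apply: (@integral_wnormal m s (fun v => ((v j ord0 - m j) / s j) ^+ 2)) => [|v]; last exact: sqr_ge0.
apply: measurable_funX; apply: measurable_funM => //; apply: measurable_funB => //.
exact: measurable_coord.
Qed.

Lemma measurable_wpoint_affine m s :
  measurable_fun setT (fun v : 'cV[R]_n => wpoint (fun i => m i + s i * v i ord0)).
Proof.
rewrite (_ : (fun v => _) = fun v : 'cV[R]_n =>
    invmx L *m diag_mx (\row_i s i) *m v + wpoint m).
  exact: measurable_mulmx.
apply/funext => v; rewrite /wpoint [RHS]addrCA -mulmxA -mulmxDr; congr (_ + _ *m _).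
by apply/colP => i; rewrite mxE mul_diag_mx !mxE addrC.
Qed.

(** Sampling: integrating against a Gaussian density is averaging over its mean
    plus a standard Gaussian scaled by its deviations. *)
Lemma wnormal_sampling m s (f : 'cV[R]_n -> \bar R) : (forall i, 0 < s i) ->
  measurable_fun setT f -> (forall u, 0 <= f u)%E ->
  (\int[leb]_u (f u * (wnormal m s u)%:E) =
   \int[leb]_v (f (wpoint (fun i => (m i + s i * v i ord0)%R)) *
     (product_normal (fun _ => 0) (fun _ => 1) v)%:E))%E.
Proof.
move=> s0 mf f0; set D := diag_mx (\row_i s i).
have detD : \det D = \prod_i s i by rewrite det_diag; apply: eq_bigr => i _; rewrite mxE.
have ps0 : 0 < \prod_i s i by exact: prodr_gt0.
have Du : D \in unitmx by rewrite unitmxE detD unitfE gt_eqF.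
have Mu : invmx L *m D \in unitmx by rewrite unitmx_mul unitmx_inv L_unit Du.
pose h u : \bar R := (f u * (wnormal m s u)%:E)%E.
have mh : measurable_fun setT h.
  by apply: emeasurable_funM => //; apply/measurable_EFinP; exact: measurable_wnormal.
have h0 u : (0 <= h u)%E by rewrite mule_ge0// lee_fin wnormal_ge0.
have pE (v : 'cV[R]_n) : wpoint (fun i => m i + s i * v i ord0) = (invmx L *m D *m v + wpoint m)%R.
  rewrite /wpoint [RHS]addrCA -mulmxA -mulmxDr; congr (_ + _ *m _).
  by apply/colP => i; rewrite mxE mul_diag_mx !mxE addrC.
have dM : `|\det (invmx L *m D)| = `|\det L|^-1 * \prod_i s i.
  by rewrite det_mulmx det_inv detD normrM normfV (gtr0_norm ps0).
have dM0 : 0 < `|\det (invmx L *m D)| by rewrite dM mulr_gt0// invr_gt0.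
have d0 := ltW dM0.
have aff := ge0_integral_affine (wpoint m) Mu mh h0.
transitivity (`|\det (invmx L *m D)|%:E * \int[leb]_v h (invmx L *m D *m v + wpoint m)%R)%E.
  by rewrite aff muleA -EFinM divff ?mul1e// gt_eqF.
pose ha (v : 'cV[R]_n) : \bar R := h (invmx L *m D *m v + wpoint m).
have mha : measurable_fun setT ha.
  exact: (measurableT_comp mh (measurable_mulmx _ _)).
have ha0 u : setT u -> (0 <= ha u)%E by move=> _; exact: h0.
rewrite -(ge0_integralZl_EFin _ measurableT ha0 mha d0); apply: eq_integral => v _.
rewrite /ha -pE /h muleCA -EFinM; congr (_ * _%:E)%E; rewrite dM /wnormal.
rewrite (_ : \prod_i normal_pdf _ _ _ = product_normal (fun _ => 0) (fun _ => 1) v / \prod_i s i).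
  by field; rewrite !gt_eqF.
rewrite -prodfV -big_split /=; apply: eq_bigr => i _.
by rewrite wpointK addrC normal_pdf_affine.
Qed.

End wnormal.

(** * Representation of a solution by a Mehler kernel *)

Lemma cvg_cV (R : realType) n (T : Type) (F : set_system T) (FF : Filter F)
    (f : T -> 'cV[R]_n) (l : 'cV[R]_n) :
  (forall i, f x i ord0 @[x --> F] --> l i ord0) -> f @ F --> l.
Proof.
move=> fl; apply/cvg_ballP => e e0.
have : \forall x \near F, forall i, `|l i ord0 - f x i ord0| < e.
  by apply: filter_forall => i; have /cvgrPdist_lt := fl i; exact.
by apply: filterS => x h; apply/ball_cVE.
Qed.

Section kernels.
Context {R : realType} {n : nat}.
Local Notation leb := (@lebesgue_cV R n).
Variables (L : 'M[R]_n) (m0 : 'cV[R]_n) (k : 'I_n -> R) (T : R).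
Hypothesis L_unit : L \in unitmx.
Hypothesis k_gt : forall i, -1 < k i.
Hypothesis T_gt0 : 0 < T.
Local Notation w := (wcoord L m0).

Definition deviation (tau : R) : R := Num.sqrt (spread T tau).

Lemma deviation_gt0 tau : tau < T -> 0 < deviation tau.
Proof. by move=> tT; rewrite sqrtr_gt0 spread_gt0. Qed.

Lemma deviation_sqr tau : tau < T -> deviation tau ^+ 2 = spread T tau.
Proof. by move=> tT; rewrite sqr_sqrtr// ltW// spread_gt0. Qed.

Lemma expR_ln_half (x : R) : 0 < x -> expR (- 2^-1 * ln x) = (Num.sqrt x)^-1.
Proof.
move=> x0; rewrite mulNr expRN; congr _^-1.
rewrite -[LHS]gtr0_norm ?expR_gt0// -sqrtr_sqr expr2 -expRD -mulrDl.
by rewrite (_ : 2^-1 + 2^-1 = 1 :> R) ?mul1r ?lnK ?posrE//; field.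
Qed.

Definition kernel_mass tau : R := `|\det L| * \prod_i (normal_peak 1 * sroot k i tau).

Lemma kernel_mass_gt0 tau : 0 < kernel_mass tau.
Proof.
rewrite mulr_gt0 ?normr_gt0 -?unitfE -?unitmxE// prodr_gt0// => i _.
by rewrite mulr_gt0 ?sroot_gt0// normal_peak_gt0// oner_eq0.
Qed.

Lemma normal_pdf_scaled (m c r p x : R) : 0 < c -> 0 < r ->
  p * p = (r * (x - m)) * (r * (x - m)) ->
  normal_pdf m (c / r) x = normal_peak 1 * r * (c^-1 * expR (- 2^-1 * (p * p * (c ^+ 2)^-1))).
Proof.
move=> c0 r0 pE; rewrite normal_pdf_expE ?divr_gt0// normal_peak1V ?divr_gt0//.
rewrite (_ : - (2^-1 * ((x - m) / (c / r)) ^+ 2) = - 2^-1 * (p * p * (c ^+ 2)^-1)).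
  by field; rewrite !gt_eqF.
by rewrite pE; field; rewrite !gt_eqF.
Qed.

Lemma bkernel_prod zeta tau u : tau < T -> bkernel L m0 k T zeta tau u =
  \prod_i ((deviation tau)^-1 * expR (- 2^-1 * (residual L m0 k zeta i tau u *
    residual L m0 k zeta i tau u * (deviation tau ^+ 2)^-1))).
Proof.
move=> tT; have s0 := spread_gt0 tT.
rewrite /bkernel /log_bkernel expR_sum; apply: eq_bigr => i _.
by rewrite expRD expR_ln_half// deviation_sqr.
Qed.

(** As a function of the integration variable the backward kernel is a Gaussian
    density up to a constant, which makes its concentration visible. *)
Lemma wnormal_bkernel zeta tau u : tau < T ->
  wnormal L m0 (fun i => zeta i / sroot k i tau) (fun i => deviation tau / sroot k i tau) u =
  kernel_mass tau * bkernel L m0 k T zeta tau u.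
Proof.
move=> tT; rewrite bkernel_prod// /wnormal /kernel_mass -mulrA; congr (_ * _).
rewrite -big_split /=; apply: eq_bigr => i _.
apply: normal_pdf_scaled; [exact: deviation_gt0|exact: sroot_gt0|].
rewrite /residual; field; rewrite gt_eqF ?sroot_gt0//.
Qed.

(** The transition density from [u] at time [0] to [a] at time [T]. *)
Definition mehler u a : R := wnormal L m0
  (fun i => sroot k i 0 / sroot k i T * w u i) (fun i => deviation 0 / sroot k i T) a.

Lemma mehler_bkernel u a :
  mehler u a = kernel_mass T * bkernel L m0 k T (fun i => sroot k i T * w a i) 0 u.
Proof.
rewrite bkernel_prod// /mehler /wnormal /kernel_mass -mulrA; congr (_ * _).
rewrite -big_split /=; apply: eq_bigr => i _.
apply: normal_pdf_scaled; [exact: deviation_gt0|exact: sroot_gt0|].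
have := sroot_gt0 k i T; rewrite /residual.
by set r := sroot k i T; set r0 := sroot k i 0 => r_gt0; field; rewrite gt_eqF.
Qed.

Lemma deviation_cvg : deviation tau @[tau --> T] --> (0 : R).
Proof.
have h := @spread_continuous R T T.
have h2 := continuous_comp h (@sqrt_continuous R _).
rewrite (_ : 0 = deviation T :> R); first exact: h2.
by rewrite /deviation /spread subrr sqrtr0.
Qed.

End kernels.

Section representation.
Context {R : realType} {n : nat}.
Local Notation leb := (@lebesgue_cV R n).
Variables (Phi : 'cV[R]_n -> R) (rho0 : 'cV[R]_n -> R) (rho : R -> 'cV[R]_n -> R).
Variables (L : 'M[R]_n) (m0 : 'cV[R]_n) (c0 : R) (k : 'I_n -> R) (T : R).
Hypothesis L_unit : L \in unitmx.
Hypothesis PhiE : forall u, Phi u = 2^-1 * (\sum_a wcoord L m0 u a ^+ 2) + c0.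
Hypothesis sol : fp_solution Phi rho0 rho.
Hypothesis k_gt : forall i, -1 < k i.
Hypothesis wcovE : forall t i j, 0 < t ->
  wcov rho L t i j = (i == j)%:R * (expR (2 * t) / (expR (2 * t) + k i)).
Hypothesis T_gt0 : 0 < T.
Local Notation w := (wcoord L m0).
Local Notation psi := (bkernel L m0 k T).

Let dens t : 0 <= t -> prob_density (rho t) := @fp_density _ _ _ _ _ sol t.
Let mom t : 0 <= t -> (second_moment (rho t) < +oo)%E := @fp_moment _ _ _ _ _ sol t.

(** The rate of the pairing with the backward kernel is the expectation of a
    vanishing generator. *)
Lemma bkernel_conserved zeta s t : 0 < s -> s < t -> t < T ->
  expect (rho t) (psi zeta t) = expect (rho s) (psi zeta s).
Proof.
move=> s0 st tT.
have t1 := tempered_bkernel L m0 T zeta k_gt.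
have t2 := tempered_bkernel_time L m0 T zeta k_gt.
have t3 := tempered_bkernel_grad L m0 T zeta k_gt.
have t4 := tempered_bkernel_hess L m0 T zeta k_gt.
have [K1 K10 h1] := (temperedW (leq0n 2) t1).2 s t s0 tT.
have [K2 K20 h2] := t2.2 s t s0 tT.
have /choice[K3 hK3] : forall a, exists K, 0 <= K /\ forall tau u, s <= tau <= t ->
    `|bkernel_grad L m0 k T zeta a tau u| <= K * (1 + enorm u).
  by move=> a; have [K K0 h] := (t3 a).2 s t s0 tT; exists K; split.
have /choice[K4 hK4] : forall ab : 'I_n * 'I_n, exists K, 0 <= K /\ forall tau u, s <= tau <= t ->
    `|bkernel_hess L m0 k T zeta ab.1 ab.2 tau u| <= K * (1 + enorm u) ^+ 2.
  by move=> [a b]; have [K K0 h] := (t4 a b).2 s t s0 tT; exists K.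
pose K := K1 + K2 + \sum_a K3 a + \sum_ab K4 ab.
have S3 : 0 <= \sum_a K3 a by apply: sumr_ge0 => a _; exact: (hK3 a).1.
have S4 : 0 <= \sum_ab K4 ab by apply: sumr_ge0 => a _; exact: (hK4 a).1.
have e0 (u : 'cV[R]_n) : 0 <= 1 + enorm u by rewrite addr_ge0// enorm_ge0.
have e20 (u : 'cV[R]_n) : 0 <= (1 + enorm u) ^+ 2 by exact: sqr_ge0.
have K1K : K1 <= K by rewrite /K; lra.
have K2K : K2 <= K by rewrite /K; lra.
have K3K a : K3 a <= K.
  have : K3 a <= \sum_a K3 a by rewrite (bigD1 a)//= lerDl sumr_ge0// => b _; exact: (hK3 b).1.
  rewrite /K; lra.
have K4K ab : K4 ab <= K.
  have : K4 ab <= \sum_ab K4 ab by rewrite (bigD1 ab)//= lerDl sumr_ge0// => b _; exact: (hK4 b).1.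
  rewrite /K; lra.
suff : `|expect (rho t) (psi zeta t) - expect (rho s) (psi zeta s) - 0 * (t - s)| <= 0 * (t - s).
  by rewrite !mul0r subr0 normr_le0 subr_eq0 => /eqP.
apply: (@expect_increment R n Phi rho0 rho L m0 c0 PhiE sol T (psi zeta)
  (bkernel_time L m0 k T zeta) (bkernel_grad L m0 k T zeta) (bkernel_hess L m0 k T zeta)
  t1.1 t2.1 (fun a => (t3 a).1) (fun a b => (t4 a b).1) _ _ _ s t K s0 st tT _ _ _ _ 0 0 (lexx 0)).
- by move=> tau u /andP[h h']; apply: is_derive_bkernel_time => //; rewrite h' ltW.
- by move=> tau c u _; exact: is_derive_bkernel.
- by move=> tau a c u _; exact: is_derive_bkernel_grad.
- by move=> tau u h; apply: (le_trans (h1 tau u h)); rewrite ler_wpM2r.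
- by move=> tau u h; apply: (le_trans (h2 tau u h)); rewrite ler_wpM2r.
- by move=> tau a u h; apply: (le_trans ((hK3 a).2 tau u h)); rewrite ler_wpM2r.
- by move=> tau a b u h; apply: (le_trans ((hK4 (a, b)).2 tau u h)); rewrite ler_wpM2r.
- move=> tau /andP[h h']; have tau0 := lt_le_trans s0 h; have tauT := le_lt_trans h' tT.
  rewrite subr0 (_ : wrate _ _ _ _ _ _ _ = 0) ?normr0//.
  rewrite /wrate (_ : (fun u => _) = fun _ => 0) ?(expect_cst (dens (ltW tau0)))//.
  apply/funext => u; apply: bkernel_generator => //; first by rewrite tau0.
  by move=> i j; exact: wcovE.
Qed.

Let times (m : nat) : R := T / m.+2%:R.

Let times_itv m : 0 < times m < T.
Proof.
rewrite divr_gt0//= ltr_pdivrMr// ltr_pMr// ltr1n//.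
Qed.

Let times_cvg : times m @[m --> \oo] --> (0 : R).
Proof.
rewrite -(mulr0 T); apply: cvgM; first exact: cvg_cst.
have := @cvg_harmonic R; rewrite -(cvg_shiftS (@harmonic R) (nbhs (0 : R))); exact.
Qed.

Let times_right : times m @[m --> \oo] --> (0 : R)^'+.
Proof.
move=> A hA; have h : \forall m \near \oo, 0 < times m -> A (times m) := times_cvg hA.
have h2 : \forall m \near \oo, A (times m).
  by apply: filterS h => m; apply; have /andP[] := times_itv m.
exact: h2.
Qed.

Lemma continuous_bkernel zeta tau : continuous (psi zeta tau).
Proof.
have cr i : continuous (residual L m0 k zeta i tau).
  apply: continuous_add; first exact: cst_continuous.
  apply: continuous_opp; apply: continuous_mul; first exact: cst_continuous.
  exact: continuous_wcoord.
move=> u; apply: (@continuous_comp _ _ _ (log_bkernel L m0 k T zeta tau) expR); last exact: continuous_expR.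
apply: continuous_sum => i; apply: continuous_add; first exact: cst_continuous.
apply: continuous_mul; first exact: cst_continuous.
by apply: continuous_mul; [exact: continuous_mul|exact: cst_continuous].
Qed.

Let density_integrable f : prob_density f -> leb.-integrable setT (EFin \o f).
Proof.
move=> [mf f0 f1]; apply/integrableP; split; first exact/measurable_EFinP.
by under eq_integral do rewrite gee0_abs ?lee_fin//; rewrite f1 ltry.
Qed.

Let bound (tau : R) : R := expR (\sum_(i < n) (- 2^-1 * ln (spread T tau))).

Let bkernel_norm_le zeta tau u : tau < T -> `|psi zeta tau u| <= bound tau.
Proof. by move=> tT; rewrite ger0_norm ?bkernel_ge0// bkernel_le. Qed.

Let bkernel_integrable f zeta tau : prob_density f -> tau < T ->
  leb.-integrable setT (EFin \o (fun u => f u * psi zeta tau u)).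
Proof.
move=> df tT; have [mf f0 _] := df.
apply: (integrable_le (g := fun u => bound tau * f u)).
- by apply: measurable_funM => //; apply: continuous_measurable_cV; exact: continuous_bkernel.
- by move=> u; rewrite normrM (ger0_norm (f0 u)) mulrC ler_wpM2r// bkernel_norm_le.
- by apply: integrable_cstM; exact: density_integrable.
Qed.

Let expect_bkernelE f zeta tau : prob_density f -> tau < T ->
  (\int[leb]_u (f u * psi zeta tau u)%:E = (expect f (psi zeta tau))%:E)%E.
Proof. by move=> df tT; rewrite fineK// integrable_fin_num//; exact: bkernel_integrable. Qed.

(** The solution attains its initial datum in [L^1], and the kernel is bounded
    uniformly up to time [0]. *)
Lemma expect_bkernel_initial zeta s : 0 < s < T ->
  expect (rho s) (psi zeta s) = expect rho0 (psi zeta 0).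
Proof.
move=> /andP[s0 sT]; set J := expect (rho s) _.
have d0 : prob_density rho0 by rewrite -(fp_init sol); exact: dens.
have [m_rho0 rho00 _] := d0.
have JE m : J = expect (rho (times m)) (psi zeta (times m)).
  have /andP[t0 tT] := times_itv m; rewrite /J.
  by have [h|h|->//] := ltgtP s (times m); [rewrite (bkernel_conserved zeta s0 h tT)|exact: bkernel_conserved].
have half m : 0 <= times m <= T / 2.
  have /andP[t0 tT] := times_itv m; rewrite (ltW t0) /times ler_pM2l// lef_pV2 ?posrE ?ltr0n//.
  by rewrite ler_nat.
have T2 : T / 2 < T by rewrite ltr_pdivrMr// ltr_pMr// ltr1n.
have bd tau u : 0 <= tau <= T / 2 -> `|psi zeta tau u| <= bound (T / 2).
  move=> /andP[t0 th]; apply: (le_trans (bkernel_norm_le zeta u (le_lt_trans th T2))).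
  rewrite ler_expR; apply: ler_sum => i _; apply: ler_wnM2l.
    by rewrite oppr_le0 invr_ge0.
  rewrite ler_ln ?posrE ?spread_gt0//; last exact: le_lt_trans th T2.
  by rewrite lerD2l lerN2 ler_expR ler_pM2l.
have c1 : expect rho0 (psi zeta (times m)) @[m --> \oo] --> expect rho0 (psi zeta 0).
  apply: (Rintegral_dominated (g := fun u => bound (T / 2) * rho0 u) _ _ _ _).2.
  - move=> m; apply: measurable_funM => //; apply: continuous_measurable_cV.
    exact: continuous_bkernel.
  - move=> u; apply: cvgM; first exact: cvg_cst.
    have h0 : 0 <= (0 : R) < T by rewrite lexx.
    have := @ex_derive _ _ _ _ _ _ _ (is_derive_bkernel_time L m0 zeta k_gt u h0).
    by move=> /derivable1_diffP/differentiable_continuous c; exact: (cvg_comp _ _ times_cvg c).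
  - by move=> m u; rewrite normrM (ger0_norm (rho00 u)) mulrC ler_wpM2r// bd.
  - by apply: integrable_cstM; exact: density_integrable.
pose D m := \int[leb]_u `|rho (times m) u - rho0 u|.
have idiff m : leb.-integrable setT (EFin \o (fun u => rho (times m) u - rho0 u)).
  have /andP[t0 _] := times_itv m.
  by apply: integrable_sub; apply: density_integrable => //; exact: dens (ltW t0).
have iD m : leb.-integrable setT (EFin \o (fun u => `|rho (times m) u - rho0 u|)).
  have := integrable_norm (idiff m); exact.
have cD : D m @[m --> \oo] --> (0 : R).
  have := cvg_comp _ _ times_right (fp_trace sol).
  move=> /fine_cvg; apply: cvg_trans; apply: near_eq_cvg; apply: nearW => m.
  by rewrite /= /L1_dist Lnorm1.
have c2 : expect rho0 (psi zeta (times m)) @[m --> \oo] --> J.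
  apply/cvgrPdist_le => e e0.
  have b0 : 0 < bound (T / 2) by exact: expR_gt0.
  have eb : 0 < e / bound (T / 2) by exact: divr_gt0.
  have /cvgrPdist_le/(_ _ eb) := cD; apply: filterS => m.
  rewrite sub0r normrN => hD.
  have /andP[t0 tT] := times_itv m; have dm := dens (ltW t0).
  rewrite {1}(JE m) /expect -RintegralB//; [|exact: bkernel_integrable..].
  apply: (@le_trans _ _ (\int[leb]_u (bound (T / 2) * `|rho (times m) u - rho0 u|))).
    apply: Rintegral_abs_le.
    - apply: (integrable_measurable (f := fun u => _)).
      by apply: integrable_sub; exact: bkernel_integrable.
    - move=> u; rewrite -mulrBl normrM mulrC ler_wpM2r// bd//.
    - exact: integrable_cstM.
  rewrite RintegralZl//.
  by rewrite mulrC -ler_pdivlMr//; apply: le_trans hD; exact: ler_norm.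
exact: (cvg_unique _ c2 c1).
Qed.

Let integral_scaled f zeta c tau : prob_density f -> 0 <= c -> tau < T ->
  (\int[leb]_u (f u * (c * psi zeta tau u))%:E = (c * expect f (psi zeta tau))%:E)%E.
Proof.
move=> df c_ge0 tT; have [mf f0 _] := df.
transitivity (\int[leb]_u (c%:E * (f u * psi zeta tau u)%:E))%E.
  by apply: eq_integral => u _; rewrite -EFinM; congr EFin; ring.
have p0 u : setT u -> (0 <= (f u * psi zeta tau u)%:E)%E.
  by move=> _; rewrite lee_fin mulr_ge0// bkernel_ge0.
have mp : measurable_fun setT (fun u => (f u * psi zeta tau u)%:E).
  apply/measurable_EFinP; apply: measurable_funM => //.
  by apply: continuous_measurable_cV; exact: continuous_bkernel.
by rewrite (ge0_integralZl_EFin _ measurableT p0 mp c_ge0) expect_bkernelE.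
Qed.

(** As the time [tau] of the pairing increases to [T], the kernel concentrates at
    [a]. After sampling, the mean and the deviations enter the argument of the
    solution, which converges pointwise by continuity; the lemma of Fatou gives
    an inequality, which is enough because both sides are probability
    densities. *)
Lemma solution_le_mehler a :
  ((rho T a)%:E <= \int[leb]_u (rho0 u * mehler L m0 k T u a)%:E)%E.
Proof.
pose zeta i := sroot k i T * w a i.
have d0 : prob_density rho0 by rewrite -(fp_init sol); exact: dens.
under eq_integral do rewrite mehler_bkernel//.
rewrite -/zeta.
pose J := expect rho0 (psi zeta 0).
have mass_ge0 t : 0 <= kernel_mass L k t := ltW (kernel_mass_gt0 k L_unit t).
rewrite (integral_scaled zeta d0 (mass_ge0 T) T_gt0) -/J.
pose tau m := T - times m.
have tauT m : 0 < tau m < T.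
  by have /andP[h1 h2] := times_itv m; rewrite subr_gt0 h2 gtrBl.
have tau_cvg : tau m @[m --> \oo] --> T.
  by rewrite -[X in _ --> X]subr0; apply: cvgB; [exact: cvg_cst|exact: times_cvg].
pose mean_ m i := zeta i / sroot k i (tau m).
pose dev_ m i := deviation T (tau m) / sroot k i (tau m).
pose pt m (v : 'cV[R]_n) := wpoint L m0 (fun i => mean_ m i + dev_ m i * v i ord0).
pose pn : 'cV[R]_n -> R := product_normal (fun _ => 0) (fun _ => 1).
have pn0 v : 0 <= pn v by exact: product_normal_ge0.
have mpn : measurable_fun setT pn by exact: measurable_product_normal.
pose f_ m (v : 'cV[R]_n) : \bar R := ((rho (tau m) (pt m v))%:E * (pn v)%:E)%E.
have mf_ m : measurable_fun setT (f_ m).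
  apply: emeasurable_funM; apply/measurable_EFinP => //.
  have /andP[t0 _] := tauT m; have [mr _ _] := dens (ltW t0).
  apply: (measurableT_comp mr); exact: measurable_wpoint_affine.
have f_0 m v : setT v -> (0 <= f_ m v)%E.
  have /andP[t0 _] := tauT m; have [_ r0 _] := dens (ltW t0).
  by move=> _; rewrite /f_ mule_ge0// lee_fin.
have If_ m : (\int[leb]_v f_ m v = (kernel_mass L k (tau m) * J)%:E)%E.
  have /andP[t0 tT] := tauT m; have dm := dens (ltW t0); have [mr r0 _] := dm.
  have s0 i : 0 < dev_ m i by rewrite divr_gt0 ?deviation_gt0 ?sroot_gt0.
  rewrite -(wnormal_sampling m0 L_unit (mean_ m) s0 (f := fun u => (rho (tau m) u)%:E)); last 2 first.
  - exact/measurable_EFinP.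
  - by move=> u; rewrite lee_fin.
  rewrite /J -(expect_bkernel_initial zeta (tauT m)).
  rewrite -(integral_scaled zeta dm (mass_ge0 (tau m)) tT).
  by apply: eq_integral => u _; rewrite -EFinM wnormal_bkernel.
have sr_cvg i : sroot k i (tau m) @[m --> \oo] --> sroot k i T.
  have c : {for T, continuous (sroot k i)} := sroot_continuous k_gt (ltW T_gt0).
  exact: (cvg_comp _ _ tau_cvg c).
have srV_cvg i : (sroot k i (tau m))^-1 @[m --> \oo] --> (sroot k i T)^-1.
  by apply: cvgV => //; rewrite gt_eqF// sroot_gt0.
have pt_cvg v : pt m v @[m --> \oo] --> a.
  rewrite -(wcoordK m0 L_unit a) /pt /wpoint; apply: cvgD; first exact: cvg_cst.
  apply: cvg_cV => i; rewrite mxE; under eq_fun do rewrite mxE.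
  apply: cvg_sum_seq => j; apply: cvgM; first exact: cvg_cst.
  rewrite mxE; under eq_fun do rewrite mxE.
  have -> : w a j = zeta j / sroot k j T + 0 * (sroot k j T)^-1 * v j ord0.
    by rewrite /zeta; field; rewrite gt_eqF// sroot_gt0.
  apply: cvgD; first by apply: cvgM => //; exact: cvg_cst.
  apply: cvgM; last exact: cvg_cst.
  by apply: cvgM => //; exact: (cvg_comp _ _ tau_cvg (deviation_cvg T)).
have f_cvg v : f_ m v @[m --> \oo] --> ((rho T a)%:E * (pn v)%:E)%E.
  rewrite /f_ -EFinM; under eq_fun do rewrite -EFinM.
  apply: cvg_EFin; first exact: nearW.
  apply: cvgM; last exact: cvg_cst.
  have [c _ _ _] := fp_regular sol a T_gt0.
  apply: (cvg_comp (fun m => (tau m, pt m v)) (fun p : R * 'cV[R]_n => rho p.1 p.2)); last exact: c.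
  exact: (cvg_pair tau_cvg (pt_cvg v)).
have Il : (\int[leb]_v limn_einf (f_ ^~ v) = (rho T a)%:E)%E.
  transitivity (\int[leb]_v ((rho T a)%:E * (pn v)%:E))%E.
    by apply: eq_integral => v _; exact: (cvg_limn_einf_sup (f_cvg v)).1.
  have r0 : 0 <= rho T a by have [_ h _] := dens (ltW T_gt0).
  have q0 v : setT v -> (0 <= (pn v)%:E)%E by rewrite lee_fin.
  have mqn : measurable_fun setT (fun v => (pn v)%:E) by exact/measurable_EFinP.
  rewrite (ge0_integralZl_EFin _ measurableT q0 mqn r0).
  by rewrite integral_product_normal mule1.
have mass_cvg : kernel_mass L k (tau m) @[m --> \oo] --> kernel_mass L k T.
  apply: cvgM; first exact: cvg_cst.
  elim: (index_enum _) => [|i r ih].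
    by under eq_fun do rewrite big_nil; rewrite big_nil; exact: cvg_cst.
  under eq_fun do rewrite big_cons; rewrite big_cons; apply: cvgM => //.
  by apply: cvgM => //; exact: cvg_cst.
have Ir : limn_einf (fun m => \int[leb]_v f_ m v)%E = (kernel_mass L k T * J)%:E.
  apply: (@cvg_limn_einf_sup _ _ _ _).1; under eq_fun do rewrite If_.
  apply: cvg_EFin; first exact: nearW.
  by apply: cvgM => //; exact: cvg_cst.
by rewrite -Il -Ir; exact: fatou.
Qed.

End representation.

(** * The Mehler kernel as a Markov kernel *)

Section markov_kernel.
Context {R : realType} {n : nat}.
Local Notation leb := (@lebesgue_cV R n).
Variables (L : 'M[R]_n) (m0 : 'cV[R]_n) (F s : 'I_n -> R).
Hypothesis L_unit : L \in unitmx.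
Hypothesis s_gt0 : forall i, 0 < s i.
Hypothesis Fs1 : forall i, F i ^+ 2 + s i ^+ 2 = 1.
Local Notation w := (wcoord L m0).

(** In normalizing coordinates the Gibbs density is the standard Gaussian. For a
    kernel with factors [F] and deviations [s], the relation [F^2 + s^2 = 1]
    expresses that it is left invariant. *)
Definition equilibrium : 'cV[R]_n -> R := wnormal L m0 (fun _ => 0) (fun _ => 1).
Definition transition u a : R := wnormal L m0 (fun i => F i * w u i) s a.

Let det_gt0 : 0 < `|\det L|.
Proof. by rewrite normr_gt0 -unitfE -unitmxE. Qed.

Lemma equilibriumE a : equilibrium a =
  `|\det L| * normal_peak 1 ^+ n * expR (- (2^-1 * \sum_i w a i ^+ 2)).
Proof.
rewrite /equilibrium /wnormal -mulrA; congr (_ * _).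
rewrite (eq_bigr (fun i => normal_peak 1 * expR (- (2^-1 * w a i ^+ 2)))); last first.
  by move=> i _; rewrite normal_pdf_expE// subr0 divr1.
by rewrite big_split /= prodr_const card_ord -expR_sum mulr_sumr sumrN.
Qed.

Lemma transitionE u a : transition u a =
  `|\det L| * normal_peak 1 ^+ n * (\prod_i (s i)^-1) *
  expR (- (2^-1 * \sum_i ((w a i - F i * w u i) / s i) ^+ 2)).
Proof.
rewrite /transition /wnormal -!mulrA; congr (_ * _).
rewrite (eq_bigr (fun i => normal_peak 1 * ((s i)^-1 *
    expR (- (2^-1 * ((w a i - F i * w u i) / s i) ^+ 2))))); last first.
  by move=> i _; rewrite normal_pdf_expE// (normal_peak1V (s_gt0 i)) -[LHS]mulrA.
by rewrite !big_split /= prodr_const card_ord -expR_sum mulr_sumr sumrN.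
Qed.

Lemma mass_gt0 : 0 < `|\det L| * normal_peak 1 ^+ n :> R.
Proof. by rewrite mulr_gt0// exprn_gt0// normal_peak_gt0// oner_eq0. Qed.

Lemma equilibrium_gt0 a : 0 < equilibrium a.
Proof. by rewrite equilibriumE mulr_gt0 ?mass_gt0 ?expR_gt0. Qed.

Lemma transition_gt0 u a : 0 < transition u a.
Proof.
rewrite transitionE mulr_gt0 ?expR_gt0// mulr_gt0 ?mass_gt0// prodr_gt0// => i _.
by rewrite invr_gt0.
Qed.

Lemma measurable_equilibrium : measurable_fun setT equilibrium.
Proof. exact: measurable_wnormal. Qed.

Lemma measurable_transition :
  measurable_fun setT (fun p : 'cV[R]_n * 'cV[R]_n => transition p.1 p.2).
Proof.
under eq_fun do rewrite transitionE.
apply: measurable_funM => //; apply: measurableT_comp => //.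
apply: measurableT_comp => //; apply: measurable_funM => //.
apply: measurable_sum => i; apply: measurable_funX; apply: measurable_funM => //.
apply: measurable_funB.
  by apply: (measurableT_comp (measurable_wcoord L m0 i)); exact: measurable_snd.
apply: measurable_funM => //.
by apply: (measurableT_comp (measurable_wcoord L m0 i)); exact: measurable_fst.
Qed.

Lemma measurable_transitionl a : measurable_fun setT (transition^~ a).
Proof. exact: (measurableT_comp measurable_transition (measurable_pair2 a)). Qed.

Lemma integral_equilibrium : (\int[leb]_a (equilibrium a)%:E = 1)%E.
Proof. exact: integral_wnormal1. Qed.

Lemma integral_transition u : (\int[leb]_a (transition u a)%:E = 1)%E.
Proof. exact: integral_wnormal1. Qed.

(** Detailed balance, which rests on [F i ^+ 2 + s i ^+ 2 = 1]: the exponent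
    [(x^2 + z^2 - 2 F x z) / (2 s^2)] is symmetric in [x] and [z]. *)
Lemma transition_reversible u a :
  equilibrium u * transition u a = equilibrium a * transition a u.
Proof.
rewrite !transitionE !equilibriumE.
set c := _ * normal_peak 1 ^+ n; set p := \prod_i _.
rewrite [LHS](_ : _ = c * c * p * expR (- (2^-1 * \sum_i w u i ^+ 2)
    - 2^-1 * \sum_i ((w a i - F i * w u i) / s i) ^+ 2)); last by rewrite expRD; ring.
rewrite [RHS](_ : _ = c * c * p * expR (- (2^-1 * \sum_i w a i ^+ 2)
    - 2^-1 * \sum_i ((w u i - F i * w a i) / s i) ^+ 2)); last by rewrite expRD; ring.
congr (_ * expR _); rewrite -!opprD -!mulrDr -!big_split /=.
congr (- (_ * _)); apply: eq_bigr => i _.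
have F2 : F i ^+ 2 = 1 - s i ^+ 2 by rewrite -(Fs1 i) addrK.
have sn : s i != 0 by rewrite gt_eqF.
have e (x z : R) : x ^+ 2 + ((z - F i * x) / s i) ^+ 2 =
    (x ^+ 2 + z ^+ 2 - 2 * F i * x * z) / s i ^+ 2.
  apply: (@mulIf _ (s i ^+ 2)); first by rewrite expf_neq0.
  rewrite mulrDl expr_div_n !divfK ?expf_neq0//.
  rewrite (_ : (z - F i * x) ^+ 2 = z ^+ 2 - 2 * F i * x * z + F i ^+ 2 * x ^+ 2); last by ring.
  by rewrite F2; ring.
by rewrite !e; congr (_ / _); ring.
Qed.

End markov_kernel.

Section gibbs_density.
Context {R : realType} {n : nat}.
Local Notation leb := (@lebesgue_cV R n).
Variables (Phi : 'cV[R]_n -> R) (L : 'M[R]_n) (m0 : 'cV[R]_n) (c0 : R).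
Hypothesis L_unit : L \in unitmx.
Hypothesis PhiE : forall u, Phi u = 2^-1 * (\sum_a wcoord L m0 u a ^+ 2) + c0.

Lemma gibbs_equilibrium : gibbs Phi = equilibrium L m0.
Proof.
set c := `|\det L| * normal_peak 1 ^+ n.
have c_gt0 : 0 < c := mass_gt0 L_unit.
have cn : c != 0 by rewrite gt_eqF.
have E u : expR (- Phi u) = expR (- c0) / c * equilibrium L m0 u.
  by rewrite equilibriumE -/c PhiE opprD expRD; field.
rewrite /gibbs; have -> : \int[leb]_v expR (- Phi v) = expR (- c0) / c.
  rewrite /Rintegral; under eq_integral do rewrite E EFinM.
  rewrite ge0_integralZl_EFin//.
  - by rewrite integral_equilibrium// mule1.
  - by move=> u _; rewrite lee_fin ltW// equilibrium_gt0.
  - by apply/measurable_EFinP; exact: measurable_equilibrium.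
  - by rewrite divr_ge0 ?expR_ge0// ltW.
apply/funext => u; rewrite E; field.
by rewrite cn gt_eqF ?expR_gt0.
Qed.

End gibbs_density.

Section identification.
Context {R : realType} {n : nat}.
Local Notation leb := (@lebesgue_cV R n).
Variables (L : 'M[R]_n) (m0 : 'cV[R]_n) (F s : 'I_n -> R).
Hypothesis L_unit : L \in unitmx.
Hypothesis s_gt0 : forall i, 0 < s i.
Local Notation tr := (transition L m0 F s).
Variables (f0 f : 'cV[R]_n -> R).
Hypothesis f0_density : prob_density f0.
Hypothesis f_density : prob_density f.

Lemma measurable_transported (g : 'cV[R]_n -> R) : measurable_fun setT g ->
  measurable_fun setT (fun p : 'cV[R]_n * 'cV[R]_n => (g p.1 * tr p.1 p.2)%:E).
Proof.
move=> mg; apply/measurable_EFinP; apply: measurable_funM.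
  by apply: (measurableT_comp mg); exact: measurable_fst.
exact: measurable_transition.
Qed.

Let tr_ge0 u a : 0 <= tr u a := ltW (@transition_gt0 R n L m0 F s L_unit s_gt0 u a).

(** Two densities of which one dominates the other agree almost everywhere. *)
Lemma transported_ae_eq :
  (forall a, (f a)%:E <= \int[leb]_u (f0 u * tr u a)%:E)%E ->
  {ae leb, forall a, (f a)%:E = \int[leb]_u (f0 u * tr u a)%:E}%E.
Proof.
move=> le; have [mf f_ge0 f1] := f_density; have [mf0 f0_ge0 f01] := f0_density.
have p0 u a : (0 <= (f0 u * tr u a)%:E)%E by rewrite lee_fin mulr_ge0.
pose P (a : 'cV[R]_n) : \bar R := (\int[leb]_u (f0 u * tr u a)%:E)%E.
have m12 := measurable_transported mf0.
have mP : measurable_fun setT P.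
  apply: (@measurable_ge0_integral _ _ _ _ R leb (fun a u => (f0 u * tr u a)%:E)) => //.
  have ms : measurable_fun setT (fun p : 'cV[R]_n * 'cV[R]_n => (p.2, p.1)).
    by apply: measurable_fun_pair; [exact: measurable_snd|exact: measurable_fst].
  exact: (measurableT_comp m12 ms).
have P1 : (\int[leb]_a P a = 1)%E.
  rewrite /P -(@fubini_tonelli _ _ _ _ _ leb leb (fun p => (f0 p.1 * tr p.1 p.2)%:E))//.
  rewrite -[RHS]f01; apply: eq_integral => u _.
  transitivity (\int[leb]_a ((f0 u)%:E * (tr u a)%:E))%E.
    by apply: eq_integral => a _; rewrite -EFinM.
  rewrite ge0_integralZl_EFin//.
  - by rewrite integral_transition// mule1.
  - by move=> a _; rewrite lee_fin.
  - by apply/measurable_EFinP; exact: measurable_wnormal.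
have mfE : measurable_fun setT (fun a => (f a)%:E) by exact/measurable_EFinP.
pose D (a : 'cV[R]_n) : \bar R := (P a - (f a)%:E)%E.
have mD : measurable_fun setT D by exact: emeasurable_funB.
have D0 a : (0 <= D a)%E by rewrite /D sube_ge0// le.
have PE a : P a = (D a + (f a)%:E)%E by rewrite /D subeK.
have fE0 a : setT a -> (0 <= (f a)%:E)%E by rewrite lee_fin.
have ID : (\int[leb]_a D a = 0)%E.
  have : (\int[leb]_a D a + 1 = 1)%E.
    rewrite -{2}P1 -[X in (_ + X)%E]f1 -ge0_integralD//.
    by apply: eq_integral => a _; rewrite PE.
  case: (\int[leb]_a D a)%E => //= x /eqP; rewrite -EFinD eqe => /eqP h.
  by congr EFin; lra.
have : (\int[leb]_a `|D a| = 0)%E.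
  by rewrite -[RHS]ID; apply: eq_integral => a _; rewrite gee0_abs.
move=> /(ae_eq_integral_abs leb measurableT mD); apply: filterS => a /(_ I) h.
by rewrite -/(P a) PE h add0e.
Qed.

End identification.

(** * Relative entropy *)

Section entropy_function.
Context {R : realType}.

(** Dividing by a reference density [g], the integrand [f ln (f / g)] becomes
    [g * entropy_fun (f / g)] up to terms of integral zero, and is nonnegative. *)
Definition entropy_fun (x : R) : R := x * ln x - x + 1.

Lemma ln_lower (x : R) : 0 < x -> 1 - x^-1 <= ln x.
Proof.
move=> x0; have := expR_ge1Dx (- ln x).
by rewrite expRN lnK ?posrE//; lra.
Qed.

Lemma entropy_fun0 : entropy_fun 0 = 1.
Proof. by rewrite /entropy_fun mul0r subr0 add0r. Qed.

(** Convexity, in the form of the tangent at [b]. *)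
Lemma entropy_fun_tangent (x b : R) : 0 <= x -> 0 < b ->
  entropy_fun b + ln b * (x - b) <= entropy_fun x.
Proof.
rewrite le_eqVlt => /orP[/eqP <-|x0] b0; first by rewrite entropy_fun0 /entropy_fun; lra.
have := ln_lower (divr_gt0 x0 b0); rewrite invf_div ln_div ?posrE// => h.
have : x - b <= x * (ln x - ln b).
  by apply: le_trans (ler_wpM2l (ltW x0) h); rewrite mulrBr mulr1 mulrCA divff ?mulr1// gt_eqF.
by rewrite /entropy_fun; lra.
Qed.

Lemma entropy_fun_ge0 (x : R) : 0 <= x -> 0 <= entropy_fun x.
Proof.
move=> x0; have := entropy_fun_tangent x0 (@ltr01 R).
by rewrite ln1 mul0r /entropy_fun ln1; lra.
Qed.

Lemma entropy_fun_sqrt (x : R) : 0 <= x -> (Num.sqrt x - 1) ^+ 2 <= entropy_fun x.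
Proof.
rewrite le_eqVlt => /orP[/eqP <-|x0].
  by rewrite sqrtr0 sub0r sqrrN expr1n entropy_fun0.
have s0 : 0 < Num.sqrt x by rewrite sqrtr_gt0.
have xE : x = Num.sqrt x * Num.sqrt x by rewrite -expr2 sqr_sqrtr// ltW.
rewrite /entropy_fun {2 3 4}xE; set s := Num.sqrt x in s0 *.
rewrite lnM ?posrE//; have h := ln_lower s0.
have : s * s - s <= s * s * ln s.
  apply: le_trans (ler_wpM2l (ltW (mulr_gt0 s0 s0)) h).
  by rewrite mulrBr mulr1 -mulrA divff ?mulr1// gt_eqF.
by rewrite expr2; lra.
Qed.

Lemma measurable_entropy_fun : measurable_fun setT entropy_fun.
Proof.
apply: measurable_funD => //; apply: measurable_funB => //.
by apply: measurable_funM => //; exact: measurable_ln.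
Qed.

(** The distance to [1], by [x - 1 = (sqrt x - 1) (sqrt x + 1)] and a weighted
    arithmetic-geometric mean inequality. *)
Lemma abs_le_entropy_fun (x eps : R) : 0 <= x -> 0 < eps ->
  `|x - 1| <= entropy_fun x / (2 * eps) + eps * (x + 1).
Proof.
move=> x0 e0; have h := entropy_fun_sqrt x0.
have xE : Num.sqrt x ^+ 2 = x by rewrite sqr_sqrtr.
set s := Num.sqrt x in h xE; have s0 : 0 <= s by exact: sqrtr_ge0.
rewrite (_ : x - 1 = (s - 1) * (s + 1)); last by rewrite -xE; ring.
rewrite normrM (ger0_norm (_ : 0 <= s + 1)); last by rewrite addr_ge0.
apply: (@le_trans _ _ ((s - 1) ^+ 2 / (2 * eps) + eps * (x + 1))); last first.
  by rewrite lerD2r ler_wpM2r// invr_ge0 mulr_ge0// ltW.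
rewrite -(real_normK (num_real (s - 1))); set y := `|s - 1|.
have e2 : 0 < 2 * eps by rewrite mulr_gt0.
rewrite -subr_ge0 -xE.
rewrite (_ : _ - _ = (y - eps * (s + 1)) ^+ 2 / (2 * eps) + eps * (s - 1) ^+ 2 / 2); last first.
  by field; rewrite gt_eqF.
have e0' := ltW e0; have e2' := ltW e2.
apply: addr_ge0; apply: divr_ge0 => //; first exact: sqr_ge0.
by apply: mulr_ge0 => //; exact: sqr_ge0.
Qed.

End entropy_function.

Section jensen.
Context d {T : measurableType d} {R : realType} (mu : {measure set T -> \bar R}).
Variables (q kap : T -> R) (b : R).
Hypothesis mq : measurable_fun setT q.
Hypothesis q0 : forall x, 0 <= q x.
Hypothesis q1 : (\int[mu]_x (q x)%:E = 1)%E.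
Hypothesis mkap : measurable_fun setT kap.
Hypothesis kap0 : forall x, 0 <= kap x.
Hypothesis b0 : 0 <= b.
Hypothesis qkap : (\int[mu]_x (q x * kap x)%:E = b%:E)%E.

Let I : \bar R := (\int[mu]_x (q x * entropy_fun (kap x))%:E)%E.

(* Each term is moved to the side where it is nonnegative, because integrals of
   nonnegative functions always add up, be they finite or not. *)
Let tangent c : 0 < c -> ((entropy_fun c + ln c * (b - c))%:E <= I)%E.
Proof.
move=> c0; pose lp := Num.max 0 (ln c); pose ln' := Num.max 0 (- ln c).
have lp0 : 0 <= lp by rewrite le_max lexx.
have ln0 : 0 <= ln' by rewrite le_max lexx.
have lE : ln c = lp - ln'.
  by rewrite /lp /ln'; have [h|h] := leP 0 (ln c);
    [rewrite (max_idPl _)|rewrite (max_idPr _)]; rewrite ?oppr_le0 ?oppr_ge0 ?(ltW h)//; lra.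
have hc := entropy_fun_ge0 (ltW c0).
pose Q x : \bar R := (q x)%:E; pose QK x : \bar R := (q x * kap x)%:E.
pose QH x : \bar R := (q x * entropy_fun (kap x))%:E.
have mQ : measurable_fun setT Q by exact/measurable_EFinP.
have mQK : measurable_fun setT QK by apply/measurable_EFinP; exact: measurable_funM.
have mQH : measurable_fun setT QH.
  by apply/measurable_EFinP; apply: measurable_funM => //; exact: (measurableT_comp measurable_entropy_fun).
have Q0 x : setT x -> (0 <= Q x)%E by rewrite lee_fin.
have QK0 x : setT x -> (0 <= QK x)%E by rewrite lee_fin mulr_ge0.
have QH0 x : setT x -> (0 <= QH x)%E by rewrite lee_fin mulr_ge0// entropy_fun_ge0.
have scale (a : R) (g : T -> \bar R) : 0 <= a -> measurable_fun setT g ->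
    (forall x, setT x -> 0 <= g x)%E ->
    (\int[mu]_x (a%:E * g x) = a%:E * \int[mu]_x g x)%E.
  by move=> a0 mg g0; exact: ge0_integralZl_EFin.
have sc0 (a : R) (g : T -> \bar R) : 0 <= a -> (forall x, setT x -> 0 <= g x)%E ->
    (forall x, setT x -> 0 <= a%:E * g x)%E.
  by move=> a0 g0 x _; rewrite mule_ge0 ?g0.
have al0 : 0 <= entropy_fun c + ln' * c by rewrite addr_ge0// mulr_ge0// ltW.
have lc0 : 0 <= lp * c by rewrite mulr_ge0// ltW.
have le : ((entropy_fun c + ln' * c + lp * b)%:E <= I + (lp * c + ln' * b)%:E)%E.
  have -> : (entropy_fun c + ln' * c + lp * b)%:E =
      (\int[mu]_x ((entropy_fun c + ln' * c)%:E * Q x + lp%:E * QK x))%E.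
    rewrite ge0_integralD//; [|exact: sc0|exact: measurable_funeM|exact: sc0|exact: measurable_funeM].
    by rewrite !scale// /Q /QK q1 qkap mule1 -EFinM -EFinD.
  have -> : (I + (lp * c + ln' * b)%:E)%E =
      (\int[mu]_x (QH x + ((lp * c)%:E * Q x + ln'%:E * QK x)))%E.
    rewrite ge0_integralD//; last 2 first.
    - by move=> x _; apply: adde_ge0; exact: sc0.
    - by apply: emeasurable_funD; exact: measurable_funeM.
    rewrite ge0_integralD//; [|exact: sc0|exact: measurable_funeM|exact: sc0|exact: measurable_funeM].
    by rewrite !scale// /Q /QK q1 qkap mule1 -EFinM -EFinD.
  apply: ge0_le_integral => //.
  - by move=> x _; apply: adde_ge0; exact: sc0.
  - by apply: emeasurable_funD; exact: measurable_funeM.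
  - by apply: emeasurable_funD => //; apply: emeasurable_funD; exact: measurable_funeM.
  - move=> x _; rewrite /Q /QK /QH -!EFinM -!EFinD lee_fin.
    have := ler_wpM2l (q0 x) (entropy_fun_tangent (kap0 x) c0).
    rewrite lE; lra.
case: I le => [x| |] le; [|by rewrite leey|by move: le].
by move: le; rewrite -EFinD !lee_fin lE; lra.
Qed.

Lemma jensen_entropy_fun : ((entropy_fun b)%:E <= I)%E.
Proof.
move: b0; rewrite le_eqVlt => /orP[/eqP b_0|b_gt0]; last first.
  by have := tangent b_gt0; rewrite subrr mulr0 addr0.
rewrite -b_0 entropy_fun0.
have lim c : 0 < c -> ((1 - c)%:E <= I)%E.
  move=> c0; have := tangent c0; rewrite -b_0 /entropy_fun.
  by rewrite (_ : c * ln c - c + 1 + ln c * (0 - c) = 1 - c)//; ring.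
move: lim; case: I => [x||] lim; rewrite ?leey//; last first.
  by have := lim 1 ltr01.
rewrite lee_fin leNgt; apply/negP => x1.
have c0 : 0 < (1 - x) / 2 by rewrite divr_gt0// subr_gt0.
by have := lim _ c0; rewrite lee_fin; lra.
Qed.

End jensen.

Section entropy_of_transition.
Context {R : realType} {n : nat}.
Local Notation leb := (@lebesgue_cV R n).
Variables (L : 'M[R]_n) (m0 : 'cV[R]_n) (F s : 'I_n -> R).
Hypothesis L_unit : L \in unitmx.
Hypothesis s_gt0 : forall i, 0 < s i.
Hypothesis Fs1 : forall i, F i ^+ 2 + s i ^+ 2 = 1.
Local Notation w := (wcoord L m0).
Local Notation tr := (transition L m0 F s).
Local Notation eqm := (equilibrium L m0).

Definition entropy (f : 'cV[R]_n -> R) : \bar R :=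
  (\int[leb]_a (eqm a * entropy_fun (f a / eqm a))%:E)%E.

Let eq_gt0 a : 0 < eqm a := equilibrium_gt0 m0 L_unit a.
Let eq_ge0 a : 0 <= eqm a := ltW (eq_gt0 a).
Let tr_gt0 u a : 0 < tr u a := transition_gt0 m0 F L_unit s_gt0 u a.
Let tr_ge0 u a : 0 <= tr u a := ltW (tr_gt0 u a).
Let measurable_eqV : measurable_fun setT (fun a => (eqm a)^-1).
Proof.
rewrite (_ : (fun a => _) = fun a => (`|\det L| * normal_peak 1 ^+ n)^-1 *
    expR (2^-1 * \sum_i w a i ^+ 2)); last first.
  by apply/funext => a; rewrite equilibriumE invfM -expRN opprK.
apply: measurable_funM => //; apply: measurableT_comp => //; apply: measurable_funM => //.
by apply: measurable_sum => i; apply: measurable_funX; exact: measurable_wcoord.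
Qed.

Lemma measurable_ratio (f : 'cV[R]_n -> R) : measurable_fun setT f ->
  measurable_fun setT (fun a => f a / eqm a).
Proof. by move=> mf; exact: measurable_funM. Qed.

Lemma measurable_entropy_integrand (f : 'cV[R]_n -> R) : measurable_fun setT f ->
  measurable_fun setT (fun a => eqm a * entropy_fun (f a / eqm a)).
Proof.
move=> mf; apply: measurable_funM; first exact: measurable_equilibrium.
exact: (measurableT_comp measurable_entropy_fun (measurable_ratio mf)).
Qed.

Let s_le1 i : s i <= 1.
Proof.
have : s i ^+ 2 <= 1 ^+ 2 by rewrite expr1n -(Fs1 i) lerDr sqr_ge0.
by rewrite ler_pXn2r// nnegrE ltW.
Qed.

Let log_scale : R := \sum_i - ln (s i).
Let log_scale_ge0 : 0 <= log_scale.
Proof. by apply: sumr_ge0 => i _; rewrite oppr_ge0 -(@ln1 R) ler_ln ?posrE. Qed.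

Lemma ln_transition_ratio u a : ln (tr u a / eqm a) =
  log_scale + \sum_i 2^-1 * w a i ^+ 2 - \sum_i 2^-1 * ((w a i - F i * w u i) / s i) ^+ 2.
Proof.
rewrite transitionE// equilibriumE.
have cn : `|\det L| * normal_peak 1 ^+ n != 0 :> R by rewrite gt_eqF// mass_gt0.
have -> : \prod_i (s i)^-1 = expR log_scale.
  by rewrite expR_sum; apply: eq_bigr => i _; rewrite expRN lnK// posrE.
rewrite -!mulr_sumr -[RHS]expRK 2!expRD; congr ln.
set c := _ * normal_peak 1 ^+ n in cn *; set x := expR (- (2^-1 * \sum_i w a i ^+ 2)).
rewrite (_ : expR (2^-1 * \sum_i w a i ^+ 2) = x^-1); last by rewrite /x expRN invrK.
have x0 : x != 0 by rewrite gt_eqF// expR_gt0.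
by field; rewrite cn x0.
Qed.

Let integral_quadratic u (c : R) (g : 'I_n -> 'cV[R]_n -> R) (v : 'I_n -> R) : 0 <= c ->
  (forall i, measurable_fun setT (g i)) ->
  (forall i, (\int[leb]_a (g i a ^+ 2 * tr u a)%:E = (v i)%:E)%E) ->
  (\int[leb]_a (tr u a * (c + \sum_i 2^-1 * g i a ^+ 2))%:E =
   (c + \sum_i 2^-1 * v i)%:E)%E.
Proof.
move=> c0 mg gv.
pose G0 a : \bar R := (tr u a)%:E; pose G i a : \bar R := (g i a ^+ 2 * tr u a)%:E.
have mG0 : measurable_fun setT G0 by apply/measurable_EFinP; exact: measurable_wnormal.
have mG i : measurable_fun setT (G i).
  apply/measurable_EFinP; apply: measurable_funM; last exact: measurable_wnormal.
  exact: measurable_funX.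
have G00 a : setT a -> (0 <= G0 a)%E by rewrite lee_fin.
have Gi0 i a : setT a -> (0 <= G i a)%E by rewrite lee_fin mulr_ge0 ?sqr_ge0.
have h0 : 0 <= 2^-1 :> R by rewrite invr_ge0.
have cG0 a : setT a -> (0 <= c%:E * G0 a)%E by move=> _; rewrite mule_ge0 ?G00.
have hG i a : setT a -> (0 <= (2^-1)%:E * G i a)%E by move=> _; rewrite mule_ge0 ?Gi0.
transitivity (\int[leb]_a (c%:E * G0 a + \sum_i (2^-1)%:E * G i a))%E.
  apply: eq_integral => a _; rewrite /G0 /G.
  under [in RHS]eq_bigr do rewrite -EFinM.
  rewrite -EFinM sumEFin -EFinD mulrDr mulrC mulr_sumr; congr (_ + _)%:E.
  by apply: eq_bigr => i _; ring.
rewrite ge0_integralD//; last 3 first.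
- exact: measurable_funeM.
- by move=> a _; apply: sume_ge0 => i _; exact: hG.
- by apply: emeasurable_sum => i; exact: measurable_funeM.
rewrite ge0_integral_sum//; last by move=> i; exact: measurable_funeM.
rewrite (ge0_integralZl_EFin _ measurableT G00 mG0 c0) (integral_transition m0 F s L_unit u : \int[leb]_a G0 a = 1)%E.
rewrite mule1 EFinD -sumEFin; congr (_ + _)%E; apply: eq_bigr => i _.
by rewrite (ge0_integralZl_EFin _ measurableT (Gi0 i) (mG i) h0) gv EFinM.
Qed.

(** The entropy of a Gaussian is [(F^2 w^2 + s^2 - 1 - ln s^2) / 2] in each
    coordinate; here [- ln s^2] is bounded by [1 / s^2 - 1 = F^2 / s^2]. *)
Definition transition_cost u : R :=
  \sum_i 2^-1 * (F i ^+ 2 * w u i ^+ 2 + F i ^+ 2 / s i ^+ 2).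

(** The entropy of the Gaussian [tr u]. All terms of the logarithm are moved to
    the side where they are nonnegative before integrating. *)
Lemma entropy_transition u : (entropy (tr u) <= (transition_cost u)%:E)%E.
Proof.
have := @integral_quadratic u 1 (fun i a => (w a i - F i * w u i) / s i) (fun _ => 1) ler01.
set B := (\int[leb]_a (_ * _)%:E)%E => BE.
have {BE} BE : B = (1 + \sum_(i < n) 2^-1 * 1)%:E.
  apply: BE => i.
    apply: measurable_funM => //; apply: measurable_funB => //; exact: measurable_wcoord.
  exact: integral_centered_wnormal.
have := @integral_quadratic u log_scale (fun i a => w a i)
  (fun i => (F i * w u i) ^+ 2 + s i ^+ 2) log_scale_ge0.
set D := (\int[leb]_a (_ * _)%:E)%E => DE.
have {DE} DE : D = (log_scale + \sum_i 2^-1 * ((F i * w u i) ^+ 2 + s i ^+ 2))%:E.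
  by apply: DE => i; [exact: measurable_wcoord|exact: integral_sqr_wnormal].
have mtr : measurable_fun setT (tr u) by exact: measurable_wnormal.
have meq : measurable_fun setT eqm by exact: measurable_equilibrium.
have key : (entropy (tr u) + B = 1 + D)%E.
  rewrite -(integral_equilibrium m0 L_unit) /entropy -!ge0_integralD//.
  - apply: eq_integral => a _; rewrite -!EFinD; congr EFin.
    rewrite /entropy_fun ln_transition_ratio.
    set x := \sum_i _ * _ ^+ 2; set y := \sum_i _ * _ ^+ 2.
    by field; rewrite gt_eqF.
  - by move=> a _; rewrite lee_fin.
  - exact/measurable_EFinP.
  - move=> a _; rewrite lee_fin mulr_ge0// addr_ge0// sumr_ge0// => i _.
    by rewrite mulr_ge0 ?sqr_ge0// invr_ge0.
  - apply/measurable_EFinP; apply: measurable_funM => //; apply: measurable_funD => //.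
    apply: measurable_sum => i; apply: measurable_funM => //; apply: measurable_funX.
    exact: measurable_wcoord.
  - by move=> a _; rewrite lee_fin mulr_ge0// entropy_fun_ge0// divr_ge0.
  - by apply/measurable_EFinP; exact: measurable_entropy_integrand.
  - move=> a _; rewrite lee_fin mulr_ge0// addr_ge0// sumr_ge0// => i _.
    by rewrite mulr_ge0 ?sqr_ge0// invr_ge0.
  - apply/measurable_EFinP; apply: measurable_funM => //; apply: measurable_funD => //.
    apply: measurable_sum => i; apply: measurable_funM => //; apply: measurable_funX.
    apply: measurable_funM => //; apply: measurable_funB => //; exact: measurable_wcoord.
have cost : log_scale + \sum_i 2^-1 * ((F i * w u i) ^+ 2 + s i ^+ 2) <=
    \sum_(i < n) 2^-1 * 1 + transition_cost u.
  rewrite /log_scale /transition_cost -!big_split /=; apply: ler_sum => i _.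
  have s2 : 0 < s i ^+ 2 by rewrite exprn_gt0.
  have h : 1 - (s i ^+ 2)^-1 <= 2 * ln (s i).
    by have := ln_lower s2; rewrite lnXn// mulr_natl.
  have e : (s i ^+ 2)^-1 = 1 + F i ^+ 2 / s i ^+ 2.
    have s2n : s i ^+ 2 != 0 by rewrite gt_eqF.
    by rewrite -[X in X + _](divff s2n) -mulrDl addrC Fs1 mul1r.
  have s1 : s i ^+ 2 <= 1 by rewrite -(Fs1 i) lerDr sqr_ge0.
  by rewrite e in h; rewrite exprMn; lra.
move: key; rewrite BE DE; case: (entropy (tr u)) => [x| |] //.
by rewrite -!EFinD => -[h]; rewrite lee_fin; lra.
Qed.

Variables (f0 f : 'cV[R]_n -> R).
Hypothesis f0_density : prob_density f0.
Hypothesis f_density : prob_density f.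
Hypothesis f_transported :
  {ae leb, forall a, (f a)%:E = \int[leb]_u (f0 u * tr u a)%:E}%E.

Let mf0 : measurable_fun setT f0. Proof. by case: f0_density. Qed.
Let mf : measurable_fun setT f. Proof. by case: f_density. Qed.
Let f0_ge0 u : 0 <= f0 u. Proof. by case: f0_density. Qed.
Let f_ge0 u : 0 <= f u. Proof. by case: f_density. Qed.
Let f01 : (\int[leb]_u (f0 u)%:E = 1)%E. Proof. by case: f0_density. Qed.
Let entropy_ge0 (g : 'cV[R]_n -> R) a : 0 <= g a -> 0 <= eqm a * entropy_fun (g a / eqm a).
Proof. by move=> g0; rewrite mulr_ge0// entropy_fun_ge0// divr_ge0. Qed.

Let measurable_tr2 : measurable_fun setT (fun p : 'cV[R]_n * 'cV[R]_n => tr p.1 p.2).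
Proof. exact: measurable_transition. Qed.

Let measurable_swapped (g : 'cV[R]_n * 'cV[R]_n -> R) : measurable_fun setT g ->
  measurable_fun setT (fun p => g (p.2, p.1)).
Proof.
move=> mg; have ms : measurable_fun setT (fun p : 'cV[R]_n * 'cV[R]_n => (p.2, p.1)).
  by apply: measurable_fun_pair; [exact: measurable_snd|exact: measurable_fst].
exact: (measurableT_comp mg ms).
Qed.

Let transported_ratio a : (f a)%:E = (\int[leb]_u (f0 u * tr u a)%:E)%E ->
  (\int[leb]_u (f0 u * (tr u a / eqm a))%:E = (f a / eqm a)%:E)%E.
Proof.
move=> fa; have p0 u : setT u -> (0 <= (f0 u * tr u a)%:E)%E by rewrite lee_fin mulr_ge0.
have mp : measurable_fun setT (fun u => (f0 u * tr u a)%:E).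
  by apply/measurable_EFinP; apply: measurable_funM => //; exact: measurable_transitionl.
have v0 : 0 <= (eqm a)^-1 by rewrite invr_ge0.
transitivity (\int[leb]_u ((eqm a)^-1%:E * (f0 u * tr u a)%:E))%E.
  by apply: eq_integral => u _; rewrite -EFinM; congr EFin; ring.
by rewrite (ge0_integralZl_EFin _ measurableT p0 mp v0) -fa -EFinM mulrC.
Qed.

(** Jensen for the average over starting points with weight [f0]. *)
Lemma entropy_le_cost :
  (entropy f <= \int[leb]_u (f0 u * transition_cost u)%:E)%E.
Proof.
pose g (p : 'cV[R]_n * 'cV[R]_n) : R :=
  f0 p.1 * (eqm p.2 * entropy_fun (tr p.1 p.2 / eqm p.2)).
have g0 p : (0 <= (g p)%:E)%E by rewrite lee_fin mulr_ge0// entropy_ge0.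
have mg : measurable_fun setT g.
  apply: measurable_funM; first by apply: (measurableT_comp mf0); exact: measurable_fst.
  apply: measurable_funM.
    by apply: (measurableT_comp (measurable_equilibrium L m0)); exact: measurable_snd.
  apply: (measurableT_comp measurable_entropy_fun); apply: measurable_funM => //.
  by apply: (measurableT_comp measurable_eqV); exact: measurable_snd.
have mgE : measurable_fun setT (EFin \o g) by exact/measurable_EFinP.
have mP : measurable_fun setT (fun a => \int[leb]_u (g (u, a))%:E)%E.
  apply: (@measurable_ge0_integral _ _ _ _ R leb (fun a u => (g (u, a))%:E)); last by move=> a u; exact: g0.
  by apply/measurable_EFinP; exact: measurable_swapped.
apply: (@le_trans _ _ (\int[leb]_a \int[leb]_u (g (u, a))%:E)%E).
  apply: ae_ge0_le_integral => //.
  - by move=> a _; rewrite lee_fin entropy_ge0.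
  - by apply/measurable_EFinP; exact: measurable_entropy_integrand.
  - by move=> a _; exact: integral_ge0.
  - apply: filterS f_transported => a fa _.
    have mk : measurable_fun setT (fun u => tr u a / eqm a).
      by apply: measurable_funM => //; exact: measurable_transitionl.
    have J := @jensen_entropy_fun _ _ R leb f0 (fun u => tr u a / eqm a) (f a / eqm a)
      mf0 f0_ge0 f01 mk (fun u => divr_ge0 (tr_ge0 u a) (eq_ge0 a))
      (divr_ge0 (f_ge0 a) (eq_ge0 a)) (transported_ratio fa).
    rewrite EFinM; apply: (le_trans (lee_wpmul2l _ J)); first by rewrite lee_fin.
    have q0 u : setT u -> (0 <= (f0 u * entropy_fun (tr u a / eqm a))%:E)%E.
      by move=> _; rewrite lee_fin mulr_ge0// entropy_fun_ge0// divr_ge0.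
    have mq : measurable_fun setT (fun u => (f0 u * entropy_fun (tr u a / eqm a))%:E).
      apply/measurable_EFinP; apply: measurable_funM => //.
      exact: (measurableT_comp measurable_entropy_fun mk).
    rewrite -(ge0_integralZl_EFin _ measurableT q0 mq (eq_ge0 a)) le_eqVlt; apply/orP; left; apply/eqP.
    by apply: eq_integral => u _; rewrite -EFinM /g; congr EFin; ring.
rewrite -(@fubini_tonelli _ _ _ _ _ leb leb (EFin \o g) mgE g0).
apply: ge0_le_integral; first exact: measurableT.
- by move=> u _; apply: integral_ge0 => a _; exact: g0.
- apply: (@measurable_ge0_integral _ _ _ _ R leb (fun u a => (g (u, a))%:E)); last by move=> a u; exact: g0.
  by under eq_fun do rewrite -surjective_pairing.
- apply/measurable_EFinP; apply: measurable_funM => //; apply: measurable_sum => i.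
  apply: measurable_funM => //; apply: measurable_funD => //; apply: measurable_funM => //.
  by apply: measurable_funX; exact: measurable_wcoord.
- move=> u _; rewrite EFinM.
  apply: le_trans (lee_wpmul2l _ (entropy_transition u)); last by rewrite lee_fin.
  rewrite /entropy -ge0_integralZl_EFin//.
  - by move=> a _; rewrite lee_fin entropy_ge0.
  - by apply/measurable_EFinP; apply: measurable_entropy_integrand; exact: measurable_wnormal.
Qed.

(** By detailed balance, the ratio of [f] to the equilibrium at [a] is an average
    of the ratio of [f0], with weight [tr a]; Jensen applies to this average. *)
Lemma entropy_contraction : (entropy f <= entropy f0)%E.
Proof.
pose g (p : 'cV[R]_n * 'cV[R]_n) : R :=
  eqm p.2 * (tr p.2 p.1 * entropy_fun (f0 p.1 / eqm p.1)).
have h0 u : 0 <= entropy_fun (f0 u / eqm u) by rewrite entropy_fun_ge0// divr_ge0.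
have g0 p : (0 <= (g p)%:E)%E.
  by rewrite lee_fin; exact: mulr_ge0 (eq_ge0 _) (mulr_ge0 (tr_ge0 _ _) (h0 _)).
have mh : measurable_fun setT (fun u => entropy_fun (f0 u / eqm u)).
  exact: (measurableT_comp measurable_entropy_fun (measurable_ratio mf0)).
have mg : measurable_fun setT g.
  apply: measurable_funM.
    by apply: (measurableT_comp (measurable_equilibrium L m0)); exact: measurable_snd.
  apply: measurable_funM; first exact: (measurable_swapped measurable_tr2).
  by apply: (measurableT_comp mh); exact: measurable_fst.
have mgE : measurable_fun setT (EFin \o g) by exact/measurable_EFinP.
have mP : measurable_fun setT (fun a => \int[leb]_u (g (u, a))%:E)%E.
  apply: (@measurable_ge0_integral _ _ _ _ R leb (fun a u => (g (u, a))%:E)); last by move=> a u; exact: g0.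
  by apply/measurable_EFinP; exact: measurable_swapped.
apply: (@le_trans _ _ (\int[leb]_a \int[leb]_u (g (u, a))%:E)%E).
  apply: ae_ge0_le_integral => //.
  - by move=> a _; rewrite lee_fin entropy_ge0.
  - by apply/measurable_EFinP; exact: measurable_entropy_integrand.
  - by move=> a _; exact: integral_ge0.
  - apply: filterS f_transported => a fa _.
    have mk : measurable_fun setT (tr a) by exact: measurable_wnormal.
    have bal : (\int[leb]_u (tr a u * (f0 u / eqm u))%:E = (f a / eqm a)%:E)%E.
      rewrite -(transported_ratio fa); apply: eq_integral => u _; congr EFin.
      have := transition_reversible L m0 s_gt0 Fs1 a u => r.
      apply: (@mulIf _ (eqm a * eqm u)); first by rewrite mulf_neq0// gt_eqF.
      transitivity (eqm a * tr a u * f0 u); first by field; rewrite gt_eqF.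
      by rewrite r; field; rewrite gt_eqF.
    have J := @jensen_entropy_fun _ _ R leb (tr a) (fun u => f0 u / eqm u) (f a / eqm a)
      mk (tr_ge0 a) (integral_transition m0 F s L_unit a) (measurable_ratio mf0)
      (fun u => divr_ge0 (f0_ge0 u) (eq_ge0 u)) (divr_ge0 (f_ge0 a) (eq_ge0 a)) bal.
    rewrite EFinM; apply: (le_trans (lee_wpmul2l _ J)); first by rewrite lee_fin.
    have q0 u : setT u -> (0 <= (tr a u * entropy_fun (f0 u / eqm u))%:E)%E.
      by move=> _; rewrite lee_fin mulr_ge0.
    have mq : measurable_fun setT (fun u => (tr a u * entropy_fun (f0 u / eqm u))%:E).
      by apply/measurable_EFinP; exact: measurable_funM.
    by rewrite -(ge0_integralZl_EFin _ measurableT q0 mq (eq_ge0 a)).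
rewrite -(@fubini_tonelli _ _ _ _ _ leb leb (EFin \o g) mgE g0).
rewrite le_eqVlt; apply/orP; left; apply/eqP; apply: eq_integral => u _.
transitivity (\int[leb]_a ((eqm u * entropy_fun (f0 u / eqm u))%:E * (tr u a)%:E))%E.
  apply: eq_integral => a _; rewrite -EFinM /g /=; congr EFin.
  rewrite mulrA (transition_reversible L m0 s_gt0 Fs1 a u); ring.
rewrite ge0_integralZl_EFin//.
- by rewrite integral_transition// mule1.
- by move=> a _; rewrite lee_fin.
- by apply/measurable_EFinP; exact: measurable_wnormal.
- exact: mulr_ge0.
Qed.

End entropy_of_transition.

(** * Exponential convergence *)

Section relative_entropy.
Context {R : realType} {n : nat}.
Local Notation leb := (@lebesgue_cV R n).
Variables (L : 'M[R]_n) (m0 : 'cV[R]_n).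
Hypothesis L_unit : L \in unitmx.
Local Notation eqm := (equilibrium L m0).
Variable f : 'cV[R]_n -> R.
Hypothesis f_density : prob_density f.

Let eq_gt0 a : 0 < eqm a := equilibrium_gt0 m0 L_unit a.
Let eq_ge0 a : 0 <= eqm a := ltW (eq_gt0 a).
Let mf : measurable_fun setT f. Proof. by case: f_density. Qed.
Let f_ge0 u : 0 <= f u. Proof. by case: f_density. Qed.
Let f1 : (\int[leb]_u (f u)%:E = 1)%E. Proof. by case: f_density. Qed.
Let eq1 : (\int[leb]_u (eqm u)%:E = 1)%E := integral_equilibrium m0 L_unit.

Let E a : R := eqm a * entropy_fun (f a / eqm a).
Let E_ge0 a : 0 <= E a.
Proof. by rewrite mulr_ge0// entropy_fun_ge0// divr_ge0. Qed.
Let mE : measurable_fun setT E. Proof. exact: measurable_entropy_integrand. Qed.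
Let meq : measurable_fun setT eqm. Proof. exact: measurable_equilibrium. Qed.

Let KL_integrand a : f a * ln (f a / eqm a) = E a + (f a - eqm a).
Proof. by rewrite /E /entropy_fun; field; rewrite gt_eqF. Qed.

Lemma entropy_ge0 : (0 <= entropy L m0 f)%E.
Proof. by apply: integral_ge0 => a _; rewrite lee_fin; exact: E_ge0. Qed.

Let density_integrable (g : 'cV[R]_n -> R) : measurable_fun setT g -> (forall u, 0 <= g u) ->
  (\int[leb]_u (g u)%:E < +oo)%E -> leb.-integrable setT (EFin \o g).
Proof.
move=> mg g0 g1; apply/integrableP; split; first exact/measurable_EFinP.
by under eq_integral do rewrite gee0_abs ?lee_fin//.
Qed.

Let f_int : leb.-integrable setT (EFin \o f).
Proof. by apply: density_integrable => //; rewrite f1 ltry. Qed.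
Let eq_int : leb.-integrable setT (EFin \o eqm).
Proof. by apply: density_integrable => //; rewrite eq1 ltry. Qed.

Lemma KL_entropy : (entropy L m0 f < +oo)%E -> KL f eqm = entropy L m0 f.
Proof.
move=> fin; have E_int : leb.-integrable setT (EFin \o E) by exact: density_integrable.
have d_int : leb.-integrable setT (EFin \o (fun a => f a - eqm a)) by exact: integrable_sub.
rewrite /KL; under eq_integral do rewrite KL_integrand EFinD.
rewrite integralD//; under [X in (_ + X)%E]eq_integral do rewrite EFinB.
by rewrite integralB// f1 eq1 subee// adde0.
Qed.

(** The negative part of the integrand of [KL] is at most the equilibrium
    density, so that a bound on [KL] is a bound on the positive part. *)
Lemma entropy_finite : (KL f eqm < +oo)%E -> (entropy L m0 f < +oo)%E.
Proof.
pose G a : \bar R := (f a * ln (f a / eqm a))%:E.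
have mG : measurable_fun setT G.
  apply/measurable_EFinP; under eq_fun do rewrite KL_integrand.
  by apply: measurable_funD => //; exact: measurable_funB.
rewrite (_ : KL f eqm = \int[leb]_a G a)%E// integralE => fin.
have eqE0 a : setT a -> (0 <= (eqm a)%:E)%E by rewrite lee_fin.
have mqE : measurable_fun setT (fun a => (eqm a)%:E) by exact/measurable_EFinP.
have neg : (\int[leb]_a G^\- a <= 1)%E.
  rewrite -eq1; apply: ge0_le_integral => //.
  - exact: measurable_funeneg.
  - move=> a _; rewrite funenegE ge_max; apply/andP; split; last by rewrite lee_fin eq_ge0.
    rewrite /G -EFinN lee_fin KL_integrand.
    by have := E_ge0 a; have := f_ge0 a; lra.
have neg0 : (0 <= \int[leb]_a G^\- a)%E by exact: integral_ge0.
have pos : (\int[leb]_a G^\+ a < +oo)%E.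
  move: fin; have : (\int[leb]_a G^\- a)%E \is a fin_num.
    by rewrite ge0_fin_numE// (le_lt_trans neg)// ltry.
  case: (\int[leb]_a G^\- a)%E => // y _; case: (\int[leb]_a G^\+ a)%E => [x _| |] //=.
  by rewrite ltry.
have mp : measurable_fun setT G^\+%E by exact: measurable_funepos.
apply: (@le_lt_trans _ _ (\int[leb]_a (G^\+ a + (eqm a)%:E))%E).
  apply: ge0_le_integral => //.
  - by move=> a _; rewrite lee_fin; exact: E_ge0.
  - exact/measurable_EFinP.
  - exact: emeasurable_funD.
  - move=> a _; rewrite funeposE /G -/(E a).
    apply: (@le_trans _ _ ((f a * ln (f a / eqm a))%:E + (eqm a)%:E)%E).
      by rewrite -EFinD lee_fin KL_integrand; have := f_ge0 a; lra.
    by apply: leeD => //; rewrite le_max lexx.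
rewrite ge0_integralD// eq1.
by apply: lte_add_pinfty => //; exact: ltry.
Qed.

(** With [eps] of the order of the square root of the entropy, both terms have
    that order. *)
Lemma L1_le_entropy eps : 0 < eps ->
  (L1_dist f eqm <= (2 * eps)^-1%:E * entropy L m0 f + (2 * eps)%:E)%E.
Proof.
move=> e0; rewrite /L1_dist Lnorm1.
have e20 : 0 <= (2 * eps)^-1 by rewrite invr_ge0 mulr_ge0// ltW.
pose EE a : \bar R := (E a)%:E; pose S a : \bar R := (f a + eqm a)%:E.
have EE0 a : setT a -> (0 <= EE a)%E by rewrite lee_fin.
have mEE : measurable_fun setT EE by exact/measurable_EFinP.
have S0 a : setT a -> (0 <= S a)%E by rewrite lee_fin addr_ge0.
have mS : measurable_fun setT S by apply/measurable_EFinP; exact: measurable_funD.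
have cE a : setT a -> (0 <= (2 * eps)^-1%:E * EE a)%E by move=> ?; rewrite mule_ge0 ?EE0.
have cS a : setT a -> (0 <= eps%:E * S a)%E by move=> ?; rewrite mule_ge0 ?S0// lee_fin ltW.
have IS : (\int[leb]_a S a = 2%:E)%E.
  rewrite /S; under eq_integral do rewrite EFinD.
  rewrite ge0_integralD//; [|by move=> a _; rewrite lee_fin|exact/measurable_EFinP
    |by move=> a _; rewrite lee_fin|exact/measurable_EFinP].
  by rewrite f1 eq1 -EFinD.
have -> : ((2 * eps)^-1%:E * entropy L m0 f + (2 * eps)%:E =
    \int[leb]_a ((2 * eps)^-1%:E * EE a + eps%:E * S a))%E.
  rewrite ge0_integralD//; [|exact: measurable_funeM|exact: measurable_funeM].
  rewrite (ge0_integralZl_EFin _ measurableT EE0 mEE e20) (ge0_integralZl_EFin _ measurableT S0 mS (ltW e0)).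
  by rewrite IS -EFinM [eps * 2]mulrC.
apply: ge0_le_integral => //.
- apply: measurableT_comp => //; apply/measurable_EFinP; exact: measurable_funB.
- by apply: emeasurable_funD; exact: measurable_funeM.
- move=> a _; rewrite /EE /S -!EFinM -EFinD /= lee_fin.
  have h := abs_le_entropy_fun (divr_ge0 (f_ge0 a) (eq_ge0 a)) e0.
  have en : eqm a != 0 by rewrite gt_eqF.
  have e2n : 2 * eps != 0 by rewrite gt_eqF// mulr_gt0.
  rewrite (_ : f a - eqm a = eqm a * (f a / eqm a - 1)); last by field.
  rewrite normrM (ger0_norm (eq_ge0 a)); apply: (le_trans (ler_wpM2l (eq_ge0 a) h)).
  rewrite le_eqVlt; apply/orP; left; apply/eqP; rewrite /E; field.
  by rewrite en (gt_eqF e0).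
Qed.

End relative_entropy.

Section convergence.
Context {R : realType} {n : nat}.
Local Notation leb := (@lebesgue_cV R n).
Variables (Phi : 'cV[R]_n -> R) (rho0 : 'cV[R]_n -> R) (rho : R -> 'cV[R]_n -> R).
Variables (L : 'M[R]_n) (m0 : 'cV[R]_n) (c0 : R) (k : 'I_n -> R).
Hypothesis L_unit : L \in unitmx.
Hypothesis PhiE : forall u, Phi u = 2^-1 * (\sum_a wcoord L m0 u a ^+ 2) + c0.
Hypothesis sol : fp_solution Phi rho0 rho.
Hypothesis k_gt : forall i, -1 < k i.
Hypothesis wcovE : forall t i j, 0 < t ->
  wcov rho L t i j = (i == j)%:R * (expR (2 * t) / (expR (2 * t) + k i)).
Local Notation w := (wcoord L m0).

Let F t i : R := sroot k i 0 / sroot k i t.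
Let s t i : R := deviation t 0 / sroot k i t.

Let s_gt0 t i : 0 < t -> 0 < s t i.
Proof. by move=> t0; rewrite divr_gt0 ?sroot_gt0 ?deviation_gt0. Qed.

Let F2 t i : 0 < t -> F t i ^+ 2 = (1 + k i) / (expR (2 * t) + k i).
Proof.
move=> t0; have := sroot_sqr k_gt i (ltW t0); have := sroot_sqr k_gt i (lexx (0 : R)).
rewrite /F mulr0 expR0; move: (sroot k i 0) (sroot k i t) => a b ea eb.
by rewrite expr_div_n !expr2 ea eb.
Qed.

Let s2 t i : 0 < t -> s t i ^+ 2 = (expR (2 * t) - 1) / (expR (2 * t) + k i).
Proof.
move=> t0; have := sroot_sqr k_gt i (ltW t0); have := deviation_sqr t0.
rewrite /s /spread mulr0 expR0; move: (deviation t 0) (sroot k i t) => a b ea eb.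
by rewrite expr_div_n ea expr2 eb.
Qed.

Let Fs1 t i : 0 < t -> F t i ^+ 2 + s t i ^+ 2 = 1.
Proof.
move=> t0; rewrite F2// s2// -mulrDl (_ : 1 + k i + _ = expR (2 * t) + k i); last by ring.
by rewrite divff// gt_eqF// (expk_gt0 k_gt i (ltW t0)).
Qed.

Let dens t : 0 <= t -> prob_density (rho t) := @fp_density _ _ _ _ _ sol t.
Let dens0 : prob_density rho0.
Proof. by rewrite -(fp_init sol); exact: dens. Qed.

Let transported t : 0 < t ->
  {ae leb, forall a, (rho t a)%:E = \int[leb]_u (rho0 u * transition L m0 (F t) (s t) u a)%:E}%E.
Proof.
move=> t0; apply: transported_ae_eq => //; [by move=> i; exact: s_gt0|exact: dens (ltW t0)|].
by move=> a; exact: (solution_le_mehler L_unit PhiE sol k_gt wcovE t0).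
Qed.

(** From time [1] on, each Gaussian [transition u] is exponentially close to the
    equilibrium, at a distance that grows only quadratically in [u]. *)
Lemma entropy_decay : exists2 c, 0 <= c &
  forall t, 1 <= t -> (entropy L m0 (rho t) <= (c * expR (- (2 * t)))%:E)%E.
Proof.
pose wt u : R := \sum_i (1 + k i) * (w u i ^+ 2 + 1).
have k1 i : 0 <= 1 + k i by have := k_gt i; lra.
have wt0 u : 0 <= wt u.
  by apply: sumr_ge0 => i _; rewrite mulr_ge0// addr_ge0// sqr_ge0.
have m0' : (second_moment rho0 < +oo)%E by rewrite -(fp_init sol); exact: (fp_moment sol).
have qwt : quadratic_growth wt.
  apply: quadratic_growth_sum => i; apply: quadratic_growthZ; apply: quadratic_growthD.
    under eq_fun do rewrite expr2.
    by apply: quadratic_growthM; exact: linear_growth_wcoord.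
  by apply: linear_quadratic_growth; exact: linear_growth_cst.
pose c := expect rho0 wt.
have [m_rho0 rho00 _] := dens0.
have cE : (\int[leb]_u (rho0 u * wt u)%:E = c%:E)%E.
  by rewrite fineK// integrable_fin_num//; exact: expect_integrable.
have mwt : measurable_fun setT wt by apply: continuous_measurable_cV; exact: qwt.1.
exists c; first by rewrite -lee_fin -cE; apply: integral_ge0 => u _; rewrite lee_fin mulr_ge0.
move=> t t1; have t0 : 0 < t by rewrite (lt_le_trans ltr01).
have st i : 0 < s t i by exact: s_gt0.
have Ft i : F t i ^+ 2 + s t i ^+ 2 = 1 by exact: Fs1.
have le := entropy_le_cost L_unit st Ft dens0 (dens (ltW t0)) (transported t0).
apply: (le_trans le).
have e2 : 2 <= expR (2 * t) by have := expR_ge1Dx (2 * t); lra.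
have e0 : 0 < expR (2 * t) by exact: expR_gt0.
have cost u : transition_cost L m0 (F t) (s t) u <= expR (- (2 * t)) * wt u.
  rewrite /transition_cost /wt mulr_sumr; apply: ler_sum => i _.
  have Ek := expk_gt0 k_gt i (ltW t0).
  have s20 : 0 < s t i ^+ 2 by rewrite exprn_gt0.
  have ratio : F t i ^+ 2 / s t i ^+ 2 = (1 + k i) / (expR (2 * t) - 1).
    rewrite F2// s2//; field; rewrite (gt_eqF Ek) andbT gt_eqF//; lra.
  have r1 : F t i ^+ 2 / s t i ^+ 2 <= 2 * (expR (- (2 * t)) * (1 + k i)).
    rewrite ratio expRN [leRHS](_ : _ = (1 + k i) * (2 / expR (2 * t))); last by ring.
    rewrite ler_wpM2l//; have e1 : 0 < expR (2 * t) - 1 by lra.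
    by rewrite ler_pdivlMr// mulrC ler_pdivrMr//; lra.
  have r2 : F t i ^+ 2 <= F t i ^+ 2 / s t i ^+ 2.
    rewrite ler_pdivlMr// ler_piMr ?sqr_ge0// -(Ft i) lerDr sqr_ge0//.
  have w2 := sqr_ge0 (w u i).
  have : F t i ^+ 2 * w u i ^+ 2 <= 2 * (expR (- (2 * t)) * (1 + k i)) * w u i ^+ 2.
    by rewrite ler_wpM2r// (le_trans r2).
  by move: r1; lra.
have en0 : 0 <= expR (- (2 * t)) by exact: expR_ge0.
have p0 u : setT u -> (0 <= (rho0 u * wt u)%:E)%E by rewrite lee_fin mulr_ge0.
have mp : measurable_fun setT (fun u => (rho0 u * wt u)%:E).
  by apply/measurable_EFinP; exact: measurable_funM.
rewrite mulrC EFinM -cE -(ge0_integralZl_EFin _ measurableT p0 mp en0).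
apply: ge0_le_integral; first exact: measurableT.
- move=> u _; rewrite lee_fin mulr_ge0// sumr_ge0// => i _.
  by apply: mulr_ge0; rewrite ?invr_ge0//; apply: addr_ge0;
    [apply: mulr_ge0|apply: divr_ge0]; exact: sqr_ge0.
- apply/measurable_EFinP; apply: measurable_funM => //; apply: measurable_sum => i.
  apply: measurable_funM => //; apply: measurable_funD => //; apply: measurable_funM => //.
  by apply: measurable_funX; exact: measurable_wcoord.
- exact: measurable_funeM.
- move=> u _; rewrite -EFinM lee_fin mulrCA ler_wpM2l//.
Qed.

(** Covers the short times, on which the kernel is too concentrated for the cost
    to be of use. *)
Lemma entropy_nonincreasing t : 0 < t -> (entropy L m0 (rho t) <= entropy L m0 rho0)%E.
Proof.
move=> t0; apply: (entropy_contraction L_unit (fun i => s_gt0 i t0) (fun i => Fs1 i t0) dens0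
  (dens (ltW t0)) (transported t0)).
Qed.

End convergence.

Theorem corollary5 (R : realType) (K d : nat)
    (A : 'M[R]_(K, d)) (y : 'cV[R]_K) (Gam : 'M[R]_K) (Gam0 : 'M[R]_d)
    (Gam_spd : spd Gam) (Gam0_spd : spd Gam0)
    (rho0 : 'cV[R]_d -> R) (rho : R -> 'cV[R]_d -> R) :
  let Phi_R := regularized_misfit A y Gam Gam0 in
  let rho_inf := gibbs Phi_R in
  ~ gaussian rho0 ->
  (KL rho0 rho_inf < +oo)%E ->
  fp_solution Phi_R rho0 rho ->
  exists c kappa : R, 0 < c /\ 0 < kappa /\
    forall t : R, 0 < t ->
      (KL (rho t) rho_inf <= (c * expR (- (kappa * t)))%:E)%E /\
      (L1_dist (rho t) rho_inf <= (c * expR (- (kappa * t)))%:E)%E.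
Proof.
move=> Phi_R rho_inf _ KL0 sol.
have [B Bspd [m0 [c0 PhiB]]] := regularized_misfit_quadratic A y Gam Gam0_spd.
(* The Riccati equation will be solved from time [1] on, in both directions:
   regularity is known at positive times only. *)
have C1 := solution_covariance_spd sol ltr01.
have [L L_unit [LB [l l_gt0 Ll]]] := simultaneous_diagonalization Bspd C1.
have PhiE u : Phi_R u = 2^-1 * (\sum_a wcoord L m0 u a ^+ 2) + c0.
  rewrite /Phi_R PhiB -LB; congr (_ * _ + _).
  rewrite -mulmxA -mulmxA mulmxA -trmx_mul mxE; apply: eq_bigr => a _.
  by rewrite mxE /wcoord expr2.
have [k [k_gt kE]] := wcov_formula L_unit PhiE sol Ll l_gt0.
have rhoE : rho_inf = equilibrium L m0 := gibbs_equilibrium L_unit PhiE.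
have dens t : 0 <= t -> prob_density (rho t) := @fp_density _ _ _ _ _ sol t.
have dens0 : prob_density rho0 by rewrite -(fp_init sol); exact: dens.
rewrite rhoE in KL0 *.
have H0_fin := entropy_finite L_unit dens0 KL0.
have H0_ge0 := entropy_ge0 m0 L_unit dens0.
pose h0 := fine (entropy L m0 rho0).
have h0E : entropy L m0 rho0 = h0%:E by rewrite /h0 fineK// ge0_fin_numE.
have h00 : 0 <= h0 by rewrite -lee_fin -h0E.
have [c1 c10 late] := entropy_decay L_unit PhiE sol k_gt kE.
(* The factor [expR 2] compensates for [expR (- (2 * t))] when [t < 1]. *)
pose c2 := c1 + h0 * expR 2.
have c20 : 0 <= c2 by rewrite addr_ge0// mulr_ge0// expR_ge0.
have decay t : 0 < t -> (entropy L m0 (rho t) <= (c2 * expR (- (2 * t)))%:E)%E.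
  move=> t0; have e0 := expR_ge0 (- (2 * t)).
  have [t1|t1] := leP 1 t.
    apply: (le_trans (late t t1)); rewrite lee_fin ler_wpM2r// lerDl.
    by rewrite mulr_ge0// expR_ge0.
  apply: (le_trans (entropy_nonincreasing L_unit PhiE sol k_gt kE t0)).
  rewrite h0E lee_fin /c2 mulrDl -mulrA -expRD.
  have : 1 <= expR (2 - 2 * t) by have := expR_ge1Dx (2 - 2 * t); lra.
  have : 0 <= c1 * expR (- (2 * t)) by exact: mulr_ge0.
  by set x := c1 * _; set z := expR _; nra.
have e2le (t : R) : 0 < t -> expR (- (2 * t)) <= expR (- (1 * t)) by move=> t0; rewrite ler_expR; lra.
exists (c2 + 2), 1; split; first by lra.
split=> // t t0; have dt := decay t t0; have den := dens t (ltW t0).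
split.
  have fin : (entropy L m0 (rho t) < +oo)%E by apply: (le_lt_trans dt); exact: ltry.
  rewrite (KL_entropy L_unit den fin); apply: (le_trans dt); rewrite lee_fin.
  have := e2le t t0; have := expR_ge0 (- (2 * t)).
  by set x := expR (- (2 * t)); set z := expR _; nra.
(* The square root of the entropy bound, as weight in the estimate of the distance. *)
have e_gt0 : 0 < expR (- (1 * t)) by exact: expR_gt0.
apply: (le_trans (L1_le_entropy m0 L_unit den e_gt0)).
have v0 : 0 <= (2 * expR (- (1 * t)))^-1 by rewrite invr_ge0 mulr_ge0// ltW.
apply: (@le_trans _ _ ((2 * expR (- (1 * t)))^-1%:E * (c2 * expR (- (2 * t)))%:E +
    (2 * expR (- (1 * t)))%:E)%E).
  by rewrite leeD2r// lee_wpmul2l.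
rewrite -EFinM -EFinD lee_fin (_ : - (2 * t) = - (1 * t) + - (1 * t)); last by ring.
rewrite expRD; set z := expR _ in e_gt0 *.
rewrite (_ : (2 * z)^-1 * _ = c2 / 2 * z); last by field; rewrite gt_eqF.
by nra.
Qed.
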